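(* Let $1\le k\le j\le\infty$. The right Kan extension functor $\mathrm{RKan}_k\colon\mathcal P(\Omega^c_{\le k})\to\mathcal P(\Omega^c_{\le j})$ along the inclusion $i_k\colon\Omega^c_{\le k}\hookrightarrow\Omega^c_{\le j}$ (i.e. the right adjoint of $i_k^*$) preserves complete Segal presheaves.
   Context: **Trees.** A (dendroidal) tree $(T,L)$, often written $T$, is a finite poset $T$ with a minimal element (a least element, called the root) such that $\{y\le x\}$ is linearly ordered for every $x\in T$, together with a subset $L$ of the maximal elements of $T$ (the leaves). Elements of $T$ are called edges. For an edge $e$, $v(e)$ is the set of minimal elements of $T_{>e}$, and $|v(e)|$ is the valence of $e$. The edge $\eta$ is $(\{r\},\{r\})$; the $n$-corolla $C_n$ ($n\ge1$) is $\{0,1,\dots,n\}$ with $0$ least, $1,\dots,n$ pairwise incomparable and $L=\{1,\dots,n\}$; $C_0=(\{0\},\varnothing)$. **Category $\Omega$.** Objects are trees; $\mathrm{Hom}_\Omega(T,T')$ is the set of operad maps $\mathrm{Free}(T)\to\mathrm{Free}(T')$, where $\mathrm{Free}(T)$ is the coloured symmetric operad in sets with colours the edges of $T$, freely generated by one operation $v(e)\to e$ for each non-leaf edge $e$. **Closed trees.** A tree is closed if $L=\varnothing$; $\Omega^c\subset\Omega$ is the full subcategory of closed trees. (Explicitly: objects are finite rooted trees and morphisms are order-preserving maps that preserve independence, i.e. send incomparable pairs to incomparable pairs.) The inclusion $\Omega^c\hookrightarrow \Omega$ has left adjoint $(T,L)^c=(T,\varnothing)$. A tree is $k$-dendroidal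 if all its edges have valence $\le k$ (no condition if $k=\infty$); $\Omega^c_{\le k}\subset\Omega^c$ is the full subcategory of closed $k$-dendroidal trees, $\Omega^c_{\le\infty}=\Omega^c$. **Segal presheaves.** $\mathcal S$ is the $\infty$-category of spaces and $\mathcal P(\mathcal C)=\mathrm{Fun}(\mathcal C^{\mathrm{op}},\mathcal S)$. A morphism $f\colon T\to T'$ is a subtree inclusion if it is injective on edges and whenever $f(e_0)\le e'\le f(e_2)$ with $e'\in T'$, $e'$ lies in the image of $f$. For a tree $T$, $(\Omega^{\mathrm{el}})_{/T}\subset\Omega_{/T}$ is the full subcategory of subtree inclusions $f\colon X\to T$ with $X=\eta$ or $X=C_n$ for some $n$, where, if $X=C_n$ has root $x$, the edge $f(x)$ must also have valence $n$. A presheaf $\mathcal F$ on $\Omega^c_{\le k}$ is Segal if for every closed $k$-dendroidal $T$ the canonical map $\mathcal F(T)\to\lim_{X\in((\Omega^{\mathrm{el}})_{/T})^{\mathrm{op}}}\mathcal F(X^c)$ is an equivalence. Let $r\colon\Delta\to\Omega^c_{\le k}$ send $[n]$ to the closure of $(\{0\le1\le\dots\le n\},\{n\})$. A Segal presheaf $\mathcal F$ is complete if $r^*\mathcal F$ is a complete Segal space in the sense of Rezk. *)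

(* Defs.v *)
From HB Require Import structures.
From mathcomp Require Import all_boot all_order.
From mathcomp Require Import boolp.

Set Implicit Arguments.
Unset Strict Implicit.
Unset Printing Implicit Defensive.

Import Order.TTheory.

#[local] Obligation Tactic := try by [].

(* The infinity-category of presheaves of spaces on an ordinary category C is
   modelled by the simplicial category of injectively fibrant simplicial
   presheaves on C (Lurie, Higher Topos Theory, 4.2.4.4).  A simplicial
   presheaf on C is encoded as a presheaf of sets on C * Delta.  In this model every
   object is cofibrant, so [mapping] below computes mapping spaces, limits of spaces
   are homotopy limits, and the right adjoint of restriction along a functor is the
   strict one (restriction is left Quillen). *)

Record category := Category {
  ob :> Type;
  hom : ob -> ob -> Type;
  idm : forall x, hom x x;
  ccomp : forall x y z, hom y z -> hom x y -> hom x z;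
  comp1m : forall x y (f : hom x y), ccomp (idm y) f = f;
  compm1 : forall x y (f : hom x y), ccomp f (idm x) = f;
  compA : forall x y z t (h : hom z t) (g : hom y z) (f : hom x y),
    ccomp h (ccomp g f) = ccomp (ccomp h g) f }.

Arguments hom {c} _ _.
Arguments idm {c} _.
Arguments ccomp {c x y z} _ _.

Record functor (C D : category) := Functor {
  fob :> C -> D;
  fhom : forall x y : C, hom x y -> hom (fob x) (fob y);
  fid : forall x, fhom (idm x) = idm (fob x);
  fcomp : forall (x y z : C) (g : hom y z) (f : hom x y),
    fhom (ccomp g f) = ccomp (fhom g) (fhom f) }.

Arguments fhom {C D} _ {x y} _.

Program Definition idF (C : category) : functor C C :=
  {| fob := fun x => x; fhom := fun x y f => f |}.

Program Definition prodc (C D : category) : category :=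
  {| ob := (C * D)%type;
     hom := fun x y => (hom x.1 y.1 * hom x.2 y.2)%type;
     idm := fun x => (idm x.1, idm x.2);
     ccomp := fun x y z g f => (ccomp g.1 f.1, ccomp g.2 f.2) |}.
Next Obligation. by move=> C D x y [f g] /=; rewrite !comp1m. Qed.
Next Obligation. by move=> C D x y [f g] /=; rewrite !compm1. Qed.
Next Obligation. by move=> *; rewrite /= !compA. Qed.

Program Definition sndF (C D : category) : functor (prodc C D) D :=
  {| fob := fun x : prodc C D => x.2; fhom := fun x y f => f.2 |}.

Program Definition prodF (C D C' D' : category) (u : functor C C') (v : functor D D') :
    functor (prodc C D) (prodc C' D') :=
  {| fob := fun x : prodc C D => (u x.1, v x.2) : prodc C' D';
     fhom := fun x y f => (fhom u f.1, fhom v f.2) |}.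
Next Obligation. by move=> * /=; rewrite !fid. Qed.
Next Obligation. by move=> * /=; rewrite !fcomp. Qed.

Program Definition insF (C D : category) (c : C) : functor D (prodc C D) :=
  {| fob := fun x => (c, x) : prodc C D; fhom := fun x y f => (idm c, f) |}.
Next Obligation. by move=> * /=; rewrite /= comp1m. Qed.

Program Definition full (C : category) (P : C -> Prop) : category :=
  {| ob := {x : C | P x};
     hom := fun x y => hom (sval x) (sval y);
     idm := fun x => idm (sval x);
     ccomp := fun x y z g f => ccomp g f |}.
Next Obligation. by move=> *; rewrite /= comp1m. Qed.
Next Obligation. by move=> *; rewrite /= compm1. Qed.
Next Obligation. by move=> *; rewrite /= compA. Qed.

Program Definition full_incl (C : category) (P Q : C -> Prop)
    (PQ : forall x, P x -> Q x) : functor (full P) (full Q) :=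
  {| fob := fun x : full P => exist Q (sval x) (PQ _ (svalP x)) : full Q;
     fhom := fun x y f => f |}.

Program Definition slice (C : category) (c : C) : category :=
  {| ob := {x : C & hom x c};
     hom := fun x y => {h : hom (projT1 x) (projT1 y) |
                          ccomp (projT2 y) h = projT2 x};
     idm := fun x => exist _ (idm (projT1 x)) _;
     ccomp := fun x y z g f => exist _ (ccomp (sval g) (sval f)) _ |}.
Next Obligation. by move=> * /=; rewrite compm1. Qed.
Next Obligation. by move=> C c x y z g f /=; rewrite compA (svalP g) (svalP f). Qed.
Next Obligation. by move=> C c x y [f p]; apply/eq_exist; rewrite /= comp1m. Qed.
Next Obligation. by move=> C c x y [f p]; apply/eq_exist; rewrite /= compm1. Qed.
Next Obligation. by move=> *; apply/eq_exist; rewrite /= compA. Qed.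

Record psh (C : category) := Psh {
  sec :> C -> Type;
  res : forall c d : C, hom c d -> sec d -> sec c;
  res_id : forall c (x : sec c), res (idm c) x = x;
  res_comp : forall (c d e : C) (g : hom d e) (f : hom c d) (x : sec e),
    res (ccomp g f) x = res f (res g x) }.

Arguments res {C} _ {c d} _ _.

Record pmap (C : category) (F G : psh C) := Pmap {
  app :> forall c, F c -> G c;
  app_nat : forall (c d : C) (f : hom c d) (x : F d),
    app (res F f x) = res G f (app x) }.

Lemma pmap_app (C : category) (F G : psh C) (f g : pmap F G) :
  f = g -> forall c x, f c x = g c x.
Proof. by move->. Qed.

Lemma pmap_eq (C : category) (F G : psh C) (f g : pmap F G) :
  (forall c x, f c x = g c x) -> f = g.
Proof.
case: f g => [f fP] [g gP] /= fg.
have {}fg : f = g by apply: functional_extensionality_dep => c; apply: funext.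
by subst g; congr Pmap; exact: Prop_irrelevance.
Qed.

Program Definition pcomp (C : category) (F G H : psh C) (g : pmap G H) (f : pmap F G) :
    pmap F H := {| app := fun c x => g c (f c x) |}.
Next Obligation. by move=> *; rewrite /= !app_nat. Qed.

Program Definition pull (C D : category) (u : functor C D) (F : psh D) : psh C :=
  {| sec := fun c => F (u c); res := fun c d f => res F (fhom u f) |}.
Next Obligation. by move=> *; rewrite /= fid res_id. Qed.
Next Obligation. by move=> *; rewrite /= fcomp res_comp. Qed.

Program Definition pull_map (C D : category) (u : functor C D) (F G : psh D)
    (f : pmap F G) : pmap (pull u F) (pull u G) :=
  {| app := fun c x => f (u c) x |}.
Next Obligation. by move=> *; rewrite /= app_nat. Qed.

Program Definition yo (C : category) (c : C) : psh C :=
  {| sec := fun d => hom d c; res := fun d e f g => ccomp g f |}.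
Next Obligation. by move=> *; rewrite /= compm1. Qed.
Next Obligation. by move=> *; rewrite /= compA. Qed.

Program Definition prodp (C : category) (F G : psh C) : psh C :=
  {| sec := fun c => (F c * G c)%type;
     res := fun c d f x => (res F f x.1, res G f x.2) |}.
Next Obligation. by move=> C F G c [x y] /=; rewrite !res_id. Qed.
Next Obligation. by move=> * /=; rewrite !res_comp. Qed.

Program Definition ran (C D : category) (u : functor C D) (F : psh C) : psh D :=
  {| sec := fun d => pmap (pull u (yo d)) F;
     res := fun d e f phi => {| app := fun c x => phi c (ccomp f x) |} |}.
Next Obligation. by move=> C D u F d e f phi * /=; rewrite -app_nat /= compA. Qed.
Next Obligation. by move=> *; apply: pmap_eq => * /=; rewrite comp1m. Qed.
Next Obligation. by move=> *; apply: pmap_eq => * /=; rewrite compA. Qed.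

Section RanAdjunction.
Variables (C D : category) (u : functor C D) (H : psh D) (F : psh C).

Program Definition ran_transpose (phi : pmap (pull u H) F) : pmap H (ran u F) :=
  {| app := fun d h => {| app := fun c x => phi c (res H x h) |} |}.
Next Obligation. by move=> phi d h c c' f x /=; rewrite res_comp -app_nat. Qed.
Next Obligation. by move=> phi c d f x; apply: pmap_eq => * /=; rewrite res_comp. Qed.

Program Definition ran_untranspose (psi : pmap H (ran u F)) : pmap (pull u H) F :=
  {| app := fun c h => psi (u c) h c (idm (u c)) |}.
Next Obligation.
move=> psi c d f x /=; rewrite app_nat /= compm1.
by rewrite -(app_nat (psi (u d) x)) /= comp1m.
Qed.

Lemma ran_transposeK phi : ran_untranspose (ran_transpose phi) = phi.
Proof. by apply: pmap_eq => * /=; rewrite res_id. Qed.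

Lemma ran_untransposeK psi : ran_transpose (ran_untranspose psi) = psi.
Proof.
apply: pmap_eq => d h; apply: pmap_eq => c x /=.
by rewrite app_nat /= compm1.
Qed.

End RanAdjunction.

Definition mono_map (m n : nat) :=
  {f : 'I_m.+1 -> 'I_n.+1 | forall i j : 'I_m.+1, (i <= j)%N -> (f i <= f j)%N}.

Program Definition Delta : category :=
  {| ob := nat;
     hom := mono_map;
     idm := fun n => exist _ (fun i => i) _;
     ccomp := fun m n p g f => exist _ (fun i => sval g (sval f i)) _ |}.
Next Obligation. by move=> m n p [g gP] [f fP] i j ij; apply/gP/fP. Qed.
Next Obligation. by move=> m n [f fP]; apply/eq_exist. Qed.
Next Obligation. by move=> m n [f fP]; apply/eq_exist. Qed.
Next Obligation. by move=> *; apply/eq_exist. Qed.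

Program Definition cmap (m n : nat) (i : 'I_n.+1) : @hom Delta m n :=
  exist _ (fun=> i) _.

Program Definition coface (n : nat) (i : 'I_n.+2) : @hom Delta n n.+1 :=
  exist _ (lift i) _.
Next Obligation. by move=> n i j k jk; rewrite /= leq_bump2. Qed.

Definition sset := psh Delta.

Program Definition horn (n : nat) (k : 'I_n.+1) : sset :=
  {| sec := fun m => {a : @hom Delta m n | exists2 i, i != k & forall x, sval a x != i};
     res := fun m p f a => exist _ (ccomp (sval a) f) _ |}.
Next Obligation. by move=> n k m p f [a [i ik ai]]; exists i => //= x; apply: ai. Qed.
Next Obligation. by move=> n k m [a aP]; apply/eq_exist; rewrite compm1. Qed.
Next Obligation. by move=> *; apply/eq_exist; exact: compA. Qed.

Definition kan (K : sset) : Prop :=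
  forall (n : nat) (k : 'I_n.+2) (h : pmap (horn k) K),
    exists g : pmap (yo (n.+1 : Delta)) K,
      forall m (a : horn k m), g m (sval a) = h m a.

Definition homotopic (X K : sset) (f g : pmap X K) : Prop :=
  exists H : pmap (prodp X (yo (1 : Delta))) K,
    forall m (x : X m), H m (x, cmap m ord0) = f m x /\ H m (x, cmap m ord_max) = g m x.

(* Weak homotopy equivalence: composition with f induces a bijection [Y, K] -> [X, K]
   for every Kan complex K. *)
Definition weq (X Y : sset) (f : pmap X Y) : Prop :=
  forall K : sset, kan K ->
    (forall g : pmap X K, exists h : pmap Y K, homotopic (pcomp h f) g) /\
    (forall h h' : pmap Y K, homotopic (pcomp h f) (pcomp h' f) -> homotopic h h').

Definition spsh (C : category) := psh (prodc C Delta).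

Definition at_ (C : category) (c : C) (F : spsh C) : sset := pull (insF Delta c) F.

Definition at_map (C : category) (c : C) (F G : spsh C) (f : pmap F G) :
  pmap (at_ c F) (at_ c G) := pull_map (insF Delta c) f.

Definition spull (C D : category) (u : functor C D) : spsh D -> spsh C :=
  pull (prodF u (idF Delta)).

Definition inj_fibrant (C : category) (F : spsh C) : Prop :=
  forall (A B : spsh C) (j : pmap A B),
    (forall c, injective (j c)) -> (forall c : C, weq (at_map c j)) ->
    forall f : pmap A F, exists g : pmap B F, pcomp g j = f.

Record spaces_psh (C : category) := SpacesPsh {
  psh_of :> spsh C;
  psh_of_fibrant : inj_fibrant psh_of }.

Lemma weq_ext (sX sY : Delta -> Type)
    (rX rX' : forall c d : Delta, hom c d -> sX d -> sX c)
    (rY rY' : forall c d : Delta, hom c d -> sY d -> sY c)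
    (f : forall c, sX c -> sY c) iX cX iX' cX' iY cY iY' cY' n n' :
  (forall c d (a : hom c d) x, rX c d a x = rX' c d a x) ->
  (forall c d (a : hom c d) x, rY c d a x = rY' c d a x) ->
  weq (@Pmap _ (@Psh _ sX rX iX cX) (@Psh _ sY rY iY cY) f n) ->
  weq (@Pmap _ (@Psh _ sX rX' iX' cX') (@Psh _ sY rY' iY' cY') f n').
Proof.
move=> eX eY.
have {}eX : rX = rX'.
  by do 3![apply: functional_extensionality_dep => ?]; apply: funext.
have {}eY : rY = rY'.
  by do 3![apply: functional_extensionality_dep => ?]; apply: funext.
subst rX' rY'.
have -> : iX' = iX by exact: Prop_irrelevance.
have -> : cX' = cX by exact: Prop_irrelevance.
have -> : iY' = iY by exact: Prop_irrelevance.
have -> : cY' = cY by exact: Prop_irrelevance.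
by have -> : n' = n by exact: Prop_irrelevance.
Qed.

Lemma spull_weq (C D : category) (u : functor C D) (A B : spsh D) (j : pmap A B) :
  (forall d : D, weq (at_map d j)) ->
  forall c : C, weq (at_map c (pull_map (prodF u (idF Delta)) j)).
Proof.
by move=> jweq c; apply: weq_ext (jweq (u c)) => * /=; rewrite fid.
Qed.

(* Since restriction along u preserves levelwise monomorphisms and levelwise weak
   equivalences, its right adjoint preserves injectively fibrant objects, and on
   these it computes the right adjoint of restriction of presheaves of spaces. *)
Lemma ran_fibrant (C D : category) (u : functor C D) (F : spsh C) :
  inj_fibrant F -> inj_fibrant (ran (prodF u (idF Delta)) F).
Proof.
move=> Ffib A B j jinj jweq f.
have jinj' c : injective (pull_map (prodF u (idF Delta)) j c) by exact: jinj.
have [g gP] := Ffib _ _ _ jinj' (spull_weq u jweq) (ran_untranspose f).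
exists (ran_transpose g); rewrite -[f]ran_untransposeK -gP.
by apply: pmap_eq => d h; apply: pmap_eq => c x /=; rewrite app_nat.
Qed.

Program Definition mapping (C : category) (A F : spsh C) : sset :=
  {| sec := fun n => pmap (prodp A (pull (sndF C Delta) (yo (n : Delta)))) F;
     res := fun m n a phi =>
       {| app := fun c x => phi c (x.1, ccomp a x.2) |} |}.
Next Obligation. by move=> C A F m n a phi c d f x; rewrite -app_nat; congr (phi _ (_, _)); apply/eq_exist. Qed.
Next Obligation. by move=> C A F m phi; apply: pmap_eq => c [x [y yP]]; congr (phi _ (_, _)); apply/eq_exist. Qed.
Next Obligation. by move=> C A F m n p b a phi; apply: pmap_eq => c x; congr (phi _ (_, _)); apply/eq_exist. Qed.

Program Definition ordc (n : nat) : category :=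
  {| ob := 'I_n.+1; hom := fun i j => is_true (i <= j)%N |}.
Next Obligation. move=> n i j l jl ij; exact: leq_trans ij jl. Defined.

Program Definition ordF (m n : nat) (a : @hom Delta m n) : functor (ordc m) (ordc n) :=
  {| fob := fun i : ordc m => sval a i : ordc n; fhom := fun i j ij => svalP a i j ij |}.
Next Obligation. by move=> *; apply: bool_irrelevance. Qed.
Next Obligation. by move=> *; apply: bool_irrelevance. Qed.

Program Definition compF (C D E : category) (v : functor D E) (u : functor C D) :
    functor C E :=
  {| fob := fun x => v (u x); fhom := fun x y f => fhom v (fhom u f) |}.
Next Obligation. by move=> * /=; rewrite !fid. Qed.
Next Obligation. by move=> * /=; rewrite !fcomp. Qed.

(* The n-simplices of the nerve of the coslice category d / D: chains
   d -> s 0 -> ... -> s n in D. *)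
Definition chain (D : category) (d : D) (n : nat) :=
  {s : functor (ordc n) D & hom d (s ord0)}.

Lemma chain_eq (D : category) (d : D) (n : nat) (s : 'I_n.+1 -> D) h h' i i' c c'
    (a a' : hom d (s ord0)) :
  (forall x y (f : @hom (ordc n) x y), h x y f = h' x y f) -> a = a' ->
  existT (fun s : functor (ordc n) D => hom d (s ord0)) (@Functor (ordc n) D s h i c) a =
  existT (fun s : functor (ordc n) D => hom d (s ord0)) (@Functor (ordc n) D s h' i' c') a'.
Proof.
move=> hh' ->; have {}hh' : h = h'.
  by do 2![apply: functional_extensionality_dep => ?]; apply: funext.
subst h'; have -> : i = i' by exact: Prop_irrelevance.
by have -> : c = c' by exact: Prop_irrelevance.
Qed.

Program Definition coslice_nerve (D : category) : spsh D :=
  {| sec := fun x : prodc D Delta => chain x.1 x.2;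
     res := fun x y f (s : chain y.1 y.2) =>
       existT _ (compF (projT1 s) (ordF f.2))
         (ccomp (fhom (projT1 s) (leq0n (sval f.2 ord0)
                                  : @hom (ordc y.2) ord0 (sval f.2 ord0)))
           (ccomp (projT2 s) f.1)) |}.
Next Obligation.
move=> D [d n] [[s h i c] a] /=; apply: chain_eq => [x y f|] /=.
  by congr h; apply: bool_irrelevance.
rewrite compm1 -[RHS]comp1m; congr ccomp; rewrite -i /=.
by congr h; apply: bool_irrelevance.
Qed.
Next Obligation.
move=> D [d m] [e n] [f p] [g b] [g' b'] [[s h i c] a] /=.
apply: chain_eq => [x y q|] /=; first by congr h; apply: bool_irrelevance.
rewrite !compA -c; do 3!congr ccomp.
by congr h; apply: bool_irrelevance.
Qed.

(* Bousfield-Kan formula for the limit of a levelwise Kan diagram D^op -> spaces. *)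
Definition holim (D : category) (G : spsh D) : sset := mapping (coslice_nerve D) G.

Section ConeMap.
Variables (D C : category) (u : functor D C) (c : C) (F : spsh C).
Variable tau : forall d : D, hom (u d) c.
Hypothesis tau_nat : forall (d e : D) (h : hom d e), ccomp (tau e) (fhom u h) = tau d.

Program Definition cone_map : pmap (at_ c F) (holim (spull u F)) :=
  {| app := fun n x =>
       {| app := fun y s => res F ((tau y.1, s.2) : @hom (prodc C Delta) (u y.1, y.2) (c, n)) x |} |}.
Next Obligation.
by move=> n x [d p] [e q] [f a] [s b] /=; rewrite -res_comp /= tau_nat.
Qed.
Next Obligation.
move=> m n a x; apply: pmap_eq => -[d p] [s b] /=.
by rewrite -res_comp /= comp1m.
Qed.
End ConeMap.

Definition RKan (C D : category) (u : functor C D) (F : spaces_psh C) : spaces_psh D :=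
  SpacesPsh (@ran_fibrant _ _ u _ (@psh_of_fibrant _ F)).

(* The adjunction between restriction and RKan on mapping spaces: an isomorphism of
   simplicial sets Map (u^* H, F) -> Map (H, RKan u F). *)
Section RKanAdjunction.
Variables (C D : category) (u : functor C D) (H : spsh D) (F : spaces_psh C).

Program Definition RKan_transpose :
    pmap (mapping (spull u H) F) (mapping H (RKan u F)) :=
  {| app := fun n phi =>
       {| app := fun y x =>
            {| app := fun z g => phi z (res H g x.1, ccomp x.2 g.2) |} |} |}.
Next Obligation.
move=> n phi y x c d f g; rewrite -app_nat; congr (phi _ (_, _)).
  by rewrite res_comp.
by apply/eq_exist.
Qed.
Next Obligation.
move=> n phi c d f x; apply: pmap_eq => z g; congr (phi _ (_, _)).
  by rewrite res_comp.
by apply/eq_exist.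
Qed.
Next Obligation.
move=> m n a phi; apply: pmap_eq => c x; apply: pmap_eq => z g.
by congr (phi _ (_, _)); apply/eq_exist.
Qed.

Program Definition RKan_untranspose :
    pmap (mapping H (RKan u F)) (mapping (spull u H) F) :=
  {| app := fun n psi =>
       {| app := fun z x =>
            psi (u z.1, z.2) x z (idm ((u z.1, z.2) : prodc D Delta)) |} |}.
Next Obligation.
move=> n psi z t f x.
have /= -> := pmap_app (app_nat psi (fhom (prodF u (idF Delta)) f) x) (idm _ : pull _ (yo _) z).
rewrite -(app_nat (psi (u t.1, t.2) x : pmap _ _)); congr (psi _ _ _ _).
by rewrite /= compm1 comp1m; congr pair; apply/eq_exist.
Qed.
Next Obligation. by move=> m n a psi; apply: pmap_eq. Qed.

Lemma RKan_transposeK n : cancel (RKan_transpose n) (RKan_untranspose n).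
Proof.
move=> phi; apply: pmap_eq => -[z m] [x [a aP]]; congr (phi _ (_, _)).
  exact: (@res_id _ H (u z, m) x).
by apply/eq_exist.
Qed.

Lemma RKan_untransposeK n : cancel (RKan_untranspose n) (RKan_transpose n).
Proof.
move=> psi; apply: pmap_eq => z [x a]; apply: pmap_eq => t g /=.
have /= -> := pmap_app (app_nat psi g (x, a)) (idm _ : pull _ (yo _) t).
by congr (psi _ _ _ _); exact: compm1.
Qed.
End RKanAdjunction.

Local Open Scope order_scope.

Record tree := Tree {
  tree_disp : Order.disp_t;
  edge :> finPOrderType tree_disp;
  leaf : {set edge};
  tree_rooted : exists r : edge, forall x : edge, r <= x;
  tree_linear : forall x y z : edge, y <= x -> z <= x -> y >=< z;
  leaf_maximal : forall l x : edge, l \in leaf -> l <= x -> x = l }.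

Definition inputs (T : tree) (e : T) : {set T} :=
  [set x : T | (e < x) && [forall y : T, (e < y) ==> (y <= x) ==> (y == x)]].

(* [free_op s e] : the operad Free(T) has an operation with inputs s and output e.
   There is at most one such operation (it is determined by the subtree of T with
   root e and set of leaves s), so Free(T) amounts to this relation, and a map of
   operads Free(T) -> Free(T') to a map on colours preserving it. *)
Inductive free_op (T : tree) : seq T -> T -> Prop :=
| free_id e : free_op [:: e] e
| free_graft e (s : T -> seq T) :
    e \notin leaf T ->
    (forall c, c \in inputs e -> free_op (s c) c) ->
    free_op (flatten [seq s c | c <- enum (inputs e)]) e
| free_perm s t e : perm_eq s t -> free_op s e -> free_op t e.

Definition omega_map (T T' : tree) :=
  {f : T -> T' | forall s e, free_op s e -> free_op (map f s) (f e)}.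

Program Definition Omega : category :=
  {| ob := tree;
     hom := omega_map;
     idm := fun T => exist _ id _;
     ccomp := fun T U V g f => exist _ (sval g \o sval f) _ |}.
Next Obligation. by move=> T s e; rewrite map_id. Qed.
Next Obligation.
by move=> T U V [g gP] [f fP] s e /fP /gP /=; rewrite map_comp.
Qed.
Next Obligation. by move=> T U [f fP]; apply/eq_exist. Qed.
Next Obligation. by move=> T U [f fP]; apply/eq_exist. Qed.
Next Obligation. by move=> *; apply/eq_exist. Qed.

Definition is_closed (T : tree) : Prop := leaf T = set0.

Program Definition closure (T : tree) : tree := {| edge := edge T; leaf := set0 |}.
Next Obligation. exact: tree_rooted. Qed.
Next Obligation. exact: tree_linear. Qed.
Next Obligation. by move=> T l x; rewrite inE. Qed.

Section FreeOp.
Variable T : tree.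
Implicit Types (e x c : T) (s : seq T).

Lemma inputs_lt e c : c \in inputs e -> e < c.
Proof. by rewrite inE => /andP[]. Qed.

Lemma inputs_inj e x c c' :
  c \in inputs e -> c' \in inputs e -> c <= x -> c' <= x -> c = c'.
Proof.
rewrite !inE => /andP[ec /forallP minc] /andP[ec' /forallP minc'] cx c'x.
case/orP: (tree_linear cx c'x) => [le|ge].
- by move: (minc' c); rewrite ec le => /eqP.
- by move: (minc c'); rewrite ec' ge => /eqP ->.
Qed.

Lemma inputs_ex e x : e < x -> exists2 c, c \in inputs e & c <= x.
Proof.
move=> ex; pose P := [pred y : T | (e < y) && (y <= x)].
have Px : P x by rewrite /= ex lexx.
case: (@arg_minnP _ x P (fun y => #|[set z : T | z <= y]|) Px).
move=> c /andP[ec cx] minc; exists c => //.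
rewrite inE ec; apply/forallP => y; apply/implyP => ey; apply/implyP => yc.
have Py : P y by rewrite /= ey (le_trans yc cx).
apply: contraT => yNc.
have /minc := Py; rewrite leqNgt => /negP[]; apply: proper_card.
apply/properP; split; first by apply/subsetP => z; rewrite !inE => /le_trans; apply.
exists c; rewrite !inE ?lexx //; apply: contra yNc => cy.
by rewrite eq_le yc cy.
Qed.

Lemma free_op_le s e : free_op s e -> forall x, x \in s -> e <= x.
Proof.
elim=> {s e} [e x|e s _ _ IH x|s t e st _ IH x].
- by rewrite inE => /eqP ->.
- case/flatten_mapP => c; rewrite mem_enum => ce xc.
  by rewrite (le_trans (ltW (inputs_lt ce))) ?(IH c).
- by rewrite -(perm_mem st); apply: IH.
Qed.

Lemma free_op_uniq s e : free_op s e -> uniq s.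
Proof.
elim=> {s e} [//|e s _ sP IH|s t e st _ IH]; last by rewrite -(perm_uniq st).
have: {subset enum (inputs e) <= inputs e} by move=> c; rewrite mem_enum.
elim: (enum _) (enum_uniq (inputs e)) => //= c l IHl /andP[cl ul] sub.
rewrite cat_uniq IH ?sub ?mem_head // IHl //; last first.
  by move=> x xl; apply: sub; rewrite inE xl orbT.
rewrite andbT; apply/hasPn => x /flatten_mapP[c' c'l xc'].
apply/negP => xc; have cin : c \in inputs e by rewrite sub ?mem_head.
have c'in : c' \in inputs e by rewrite sub // inE c'l orbT.
suff cc' : c = c' by rewrite cc' c'l in cl.
exact: inputs_inj cin c'in (free_op_le (sP _ cin) xc) (free_op_le (sP _ c'in) xc').
Qed.

Lemma free_op_gen e : e \notin leaf T -> free_op (enum (inputs e)) e.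
Proof.
move=> eP; rewrite -[enum _]flatten_seq1 //.
by apply: free_graft => // c _; apply: free_id.
Qed.

Lemma free_op_subst s e (sub : T -> seq T) :
  free_op s e -> (forall x, x \in s -> free_op (sub x) x) ->
  free_op (flatten [seq sub x | x <- s]) e.
Proof.
elim=> {s e} [e|e s eP _ IH|s t e st _ IH] subP.
- by rewrite /= cats0; apply: subP; rewrite inE.
- have -> : flatten [seq sub x | x <- flatten [seq s c | c <- enum (inputs e)]] =
     flatten [seq flatten [seq sub x | x <- s c] | c <- enum (inputs e)].
    by elim: (enum _) => //= c l <-; rewrite map_cat flatten_cat.
  apply: free_graft => // c ce; apply: IH => // x xc; apply: subP.
  by apply/flatten_mapP; exists c; rewrite ?mem_enum.
- apply: (free_perm (s := flatten [seq sub x | x <- s])).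
    exact/perm_flatten/perm_map.
  by apply: IH => x; rewrite (perm_mem st); apply: subP.
Qed.

Hypothesis closedT : is_closed T.

Lemma closed_ind (P : T -> Prop) :
  (forall e, (forall c, c \in inputs e -> P c) -> P e) -> forall e, P e.
Proof.
move=> IH e; have [n] := ubnP #|[set x | e < x]|; elim: n e => // n IHn e le.
apply: IH => c /inputs_lt ec; apply: IHn; apply: leq_trans (ltnSE le).
apply/proper_card/properP; split; last by exists c; rewrite !inE ?ltxx.
by apply/subsetP => x; rewrite !inE; apply: lt_trans.
Qed.

Lemma closed_free_op0 e : free_op [::] e.
Proof.
elim/closed_ind: e => e IH.
have -> : [::] = flatten [seq (fun=> [::]) c | c <- enum (inputs e)] :> seq T.
  by elim: (enum _).
by apply: free_graft => //; rewrite closedT inE.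
Qed.

Lemma closed_free_op_le s e x : e <= x -> free_op s x -> free_op s e.
Proof.
move=> + sx; elim/closed_ind: e => e IH.
rewrite le_eqVlt => /predU1P[-> //|/inputs_ex[c ce cx]].
pose g c' : seq T := if c' == c then s else [::].
have -> : s = flatten [seq g c' | c' <- enum (inputs e)].
  have: c \in enum (inputs e) by rewrite mem_enum.
  elim: (enum _) (enum_uniq (inputs e)) => //= c' l IHl /andP[c'l ul].
  rewrite inE /g [c' == c]eq_sym; have [cc' _|cc' /= cl] := eqVneq c c'.
    rewrite -cc' in c'l; rewrite -[LHS]cats0; congr (_ ++ _).
    elim: l c'l {IHl ul} => //= d l IHl; rewrite inE negb_or => /andP[dc /IHl <-].
    by rewrite eq_sym (negPf dc).
  exact: IHl.
apply: free_graft => [|d de]; first by rewrite closedT inE.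
rewrite /g; case: eqP => [-> |_]; [exact: IH | exact: closed_free_op0].
Qed.

End FreeOp.

Lemma closure_op_mono (T : tree) (s : seq T) (e : T) :
  free_op s e -> @free_op (closure T) s e.
Proof.
elim=> {s e} [e|e s _ _ IH|s t e st _ IH].
- exact: (@free_id (closure T)).
- by apply: (@free_graft (closure T)) => //; rewrite inE.
- exact: (@free_perm (closure T)) IH.
Qed.

Definition closure_unit (T : tree) : @hom Omega T (closure T).
Proof. by exists id => s e /closure_op_mono; rewrite map_id. Defined.

Definition closure_transpose (X T : tree) (cT : is_closed T) (f : @hom Omega X T) :
  @hom Omega (closure X) T.
Proof.
exists (sval f : closure X -> T) => s e.
elim=> {s e} [e|e s _ sP IH|s t e st _ IH].
- exact: free_id.
- have [eL|eL] := boolP ((e : X) \in leaf X).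
    suff -> : inputs e = set0 by rewrite enum_set0; apply: closed_free_op0.
    apply/setP => c; rewrite [RHS]inE; apply/negP => /inputs_lt ec.
    by move: (ec); rewrite (leaf_maximal eL (ltW ec)) ltxx.
  have fP := svalP f _ _ (free_op_gen eL); have fU := free_op_uniq fP.
  pose sub (x : T) := flatten [seq map (sval f) (s c) |
    c <- enum (inputs (e : X)) & sval f c == x].
  have subE c : c \in inputs (e : X) -> sub (sval f c) = map (sval f) (s c).
    move=> ce; rewrite /sub.
    suff -> : [seq c' <- enum (inputs (e : X)) | sval f c' == sval f c] = [:: c].
      by rewrite /= cats0.
    have : c \in enum (inputs (e : X)) by rewrite mem_enum.
    elim: (enum _) fU => //= d l IHl /andP[dl ul]; rewrite inE.
    have [-> _|dc /= cl] := eqVneq c d.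
      rewrite eqxx; congr cons; apply/eqP; rewrite -[_ == _]negbK -has_filter.
      by apply/hasPn => y yl; apply: contra dl => /eqP <-; apply: map_f.
    rewrite ifN ?IHl //; apply: contra dl => /eqP ->; exact: map_f.
  have -> : map (sval f) (flatten [seq s c | c <- enum (inputs (e : X))]) =
      flatten [seq sub x | x <- map (sval f) (enum (inputs (e : X)))].
    rewrite map_flatten -!map_comp; congr flatten; apply/eq_in_map => c.
    by rewrite mem_enum => /subE.
  apply: free_op_subst => // x /mapP[c]; rewrite mem_enum => ce ->.
  by rewrite subE //; apply: IH.
- by apply: free_perm IH; apply: perm_map.
Defined.

Lemma closure_closed (T : tree) : is_closed (closure T).
Proof. by []. Qed.

Definition closure_map (X Y : tree) (f : @hom Omega X Y) :
    @hom Omega (closure X) (closure Y) :=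
  closure_transpose (@closure_closed Y) (ccomp (closure_unit Y) f).

(* In [option nat], None stands for infinity. *)

Definition le_oo (k j : option nat) : bool :=
  match k, j with
  | _, None => true
  | None, Some _ => false
  | Some a, Some b => (a <= b)%N
  end.

Lemma le_oo_trans i j k : le_oo i j -> le_oo j k -> le_oo i k.
Proof. by case: i j k => [a|] [b|] [c|] //=; apply: leq_trans. Qed.

Arguments le_oo : simpl never.

Definition dendroidal (k : option nat) (T : tree) : Prop :=
  forall e : T, le_oo (Some #|inputs e|) k.

Definition closed_dendroidal (k : option nat) (T : tree) : Prop :=
  is_closed T /\ dendroidal k T.

Definition OmegaC (k : option nat) : category := @full Omega (closed_dendroidal k).

Lemma closed_dendroidal_le k j : le_oo k j ->
  forall T, closed_dendroidal k T -> closed_dendroidal j T.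
Proof. by move=> kj T [cT dT]; split=> // e; apply: le_oo_trans kj. Qed.

Definition incl_OmegaC k j (kj : le_oo k j) : functor (OmegaC k) (OmegaC j) :=
  @full_incl Omega _ _ (closed_dendroidal_le kj).

Lemma card_inputs (T : tree) (e : T) : (#|inputs e| <= #|T|.-1)%N.
Proof.
rewrite (cardD1 e T) inE /=; apply/subset_leq_card/subsetP => x /inputs_lt.
by rewrite !inE andbT => /gt_eqF ->.
Qed.

Record star (n : nat) := Star { star_val : 'I_n.+1 }.
HB.instance Definition _ n := [isNew for @star_val n].
HB.instance Definition _ n := [Finite of star n by <:].

Definition star_le n (x y : star n) := (star_val x == ord0) || (x == y).
Fact star_le_refl n : reflexive (@star_le n).
Proof. by move=> x; rewrite /star_le eqxx orbT. Qed.
Fact star_le_anti n : antisymmetric (@star_le n).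
Proof.
move=> [x] [y] /andP[/orP[/eqP /= xE|/eqP //]].
by rewrite /star_le /= xE => /orP[/eqP ->|/eqP].
Qed.
Fact star_le_trans n : transitive (@star_le n).
Proof. by rewrite /star_le => y x z /orP[-> //|/eqP ->]. Qed.
Fact star_display : Order.disp_t. Proof. exact: Order.Disp tt tt. Qed.
HB.instance Definition _ n := Order.Le_isPOrder.Build star_display
  (star n) (@star_le_refl n) (@star_le_anti n) (@star_le_trans n).

Fact star_rooted n : exists r : star n, forall x : star n, r <= x.
Proof. by exists (Star ord0). Qed.

Fact star_linear n (x y z : star n) : y <= x -> z <= x -> y >=< z.
Proof.
case/orP => [y0 _|/eqP <- zx]; first by rewrite /Order.comparable; apply/orP; left; apply/orP; left.
by rewrite /Order.comparable zx orbT.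
Qed.

Program Definition corolla (n : nat) : tree :=
  {| edge := star n; leaf := [set x : star n | star_val x != ord0] |}.
Next Obligation. exact: star_rooted. Qed.
Next Obligation. exact: star_linear. Qed.
Next Obligation.
by move=> n l x; rewrite inE => l0 /orP[|/eqP //]; rewrite (negPf l0).
Qed.

Program Definition eta : tree := {| edge := star 0; leaf := [set: star 0] |}.
Next Obligation. exact: star_rooted. Qed.
Next Obligation. exact: star_linear. Qed.
Next Obligation. by move=> [l] [x] _ _; rewrite [x]ord1 [l]ord1. Qed.

Lemma card_star n : #|{: star n}| = n.+1.
Proof.
by rewrite -[RHS]card_ord; apply: (bij_eq_card (f := @star_val n)); exists (@Star n) => -[].
Qed.

Definition subtree_inclusion (X T : tree) (f : @hom Omega X T) : Prop :=
  injective (sval f) /\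
  forall (e0 e2 : X) (e' : T), sval f e0 <= e' -> e' <= sval f e2 ->
    exists e1 : X, sval f e1 = e'.

Definition elementary (T : tree) (x : @slice Omega T) : Prop :=
  subtree_inclusion (projT2 x) /\
  (projT1 x = eta \/
   exists n : nat, projT1 x = corolla n /\
     forall r : projT1 x, (forall y : projT1 x, r <= y) ->
       #|inputs (sval (projT2 x) r)| = n).

Definition OmegaEl (T : tree) : category := full (@elementary T).

Lemma elementary_dendroidal k (T : tree) (x : OmegaEl T) :
  dendroidal k T -> closed_dendroidal k (closure (projT1 (sval x))).
Proof.
move=> dT; split=> // e; case: x e => -[X f] [_ /= XP] e.
suff [y Xy] : exists y : T, (#|X|.-1 <= #|inputs y|)%N.
  apply: le_oo_trans (dT y); rewrite /le_oo; apply: leq_trans Xy.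
  exact: (card_inputs e).
case: XP => [XE|[n [XE XP]]].
  exists (sval f e); suff -> : #|X| = 1%N by [].
  by rewrite XE card_star.
have [r rP] := tree_rooted X; exists (sval f r).
rewrite (XP r rP); suff -> : #|X| = n.+1 by [].
by rewrite XE card_star.
Qed.

Section ClosureDiagram.
Variables (k : option nat) (T : OmegaC k).

Program Definition el_closure : functor (OmegaEl (sval T)) (OmegaC k) :=
  {| fob := fun x : OmegaEl (sval T) =>
       exist _ (closure (projT1 (sval x))) (elementary_dendroidal x (svalP T).2)
       : OmegaC k;
     fhom := fun x y h => closure_map (sval h) |}.
Next Obligation. by move=> *; apply/eq_exist. Qed.
Next Obligation. by move=> *; apply/eq_exist. Qed.

Definition el_cone (x : OmegaEl (sval T)) : hom (el_closure x) T :=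
  closure_transpose (svalP T).1 (projT2 (sval x)).

Lemma el_cone_nat (x y : OmegaEl (sval T)) (h : hom x y) :
  ccomp (el_cone y) (fhom el_closure h) = el_cone x.
Proof.
by apply/eq_exist; have := congr1 sval (svalP h).
Qed.
End ClosureDiagram.

(* cone_map is the canonical map from F(T) to the limit of the F(X^c). *)
Definition segal (k : option nat) (F : spsh (OmegaC k)) : Prop :=
  forall T : OmegaC k, weq (cone_map F (@el_cone_nat k T)).

Fact ord_rooted n : exists r : 'I_n.+1, forall x : 'I_n.+1, r <= x.
Proof. by exists ord0 => x; apply: leq0n. Qed.

Fact ord_linear n (x y z : 'I_n.+1) : y <= x -> z <= x -> y >=< z.
Proof. by move=> _ _; apply: comparableT. Qed.

Fact ord_max_maximal n (l x : 'I_n.+1) : l \in [set ord_max] -> l <= x -> x = l.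
Proof.
rewrite inE => /eqP -> nx; apply/le_anti/andP; split=> //.
exact: leq_ord.
Qed.

Definition linear_tree (n : nat) : tree :=
  Tree (@ord_rooted n) (@ord_linear n) (@ord_max_maximal n).

Lemma linear_tree_inputs (n : nat) (e c c' : linear_tree n) :
  c \in inputs e -> c' \in inputs e -> c = c'.
Proof.
move=> ce c'e; case: (leP c c') => [cc'|/ltW c'c].
- exact: inputs_inj ce c'e cc' (lexx _).
- exact: inputs_inj ce c'e (lexx _) c'c.
Qed.

Lemma linear_tree_dendroidal k (n : nat) : le_oo (Some 1) k ->
  closed_dendroidal k (closure (linear_tree n)).
Proof.
move=> k1; split=> // e; apply: le_oo_trans k1.
rewrite /le_oo; apply/card_le1_eqP => c c' ce c'e.
exact: (linear_tree_inputs (n := n) c'e ce).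
Qed.

Definition linear_map (m n : nat) (a : @hom Delta m n) :
  @hom Omega (closure (linear_tree m)) (closure (linear_tree n)).
Proof.
exists (sval a : closure (linear_tree m) -> closure (linear_tree n)) => s e.
elim=> {s e} [e|e s _ _ IH|s t e st _ IH].
- exact: free_id.
- have : {subset enum (inputs e) <= inputs e} by move=> c; rewrite mem_enum.
  case: (enum _) (enum_uniq (inputs e)) => [|c [|c' l]] /= + sub.
  + by move=> _; apply: closed_free_op0.
  + move=> _; have ce := sub c (mem_head _ _); rewrite cats0.
    apply: closed_free_op_le (IH c ce) => //.
    exact: (svalP a e c (ltW (@inputs_lt (closure (linear_tree m)) e c ce))).
  + rewrite inE negb_or -andbA => /andP[/eqP[]].
    apply: (linear_tree_inputs (n := m) (e := e)); apply: sub;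
      by rewrite !inE eqxx ?orbT.
- by apply: free_perm IH; apply: perm_map.
Defined.

Program Definition lin (k : option nat) (k1 : le_oo (Some 1) k) :
    functor Delta (OmegaC k) :=
  {| fob := fun n : Delta =>
       exist _ (closure (linear_tree n)) (linear_tree_dendroidal n k1) : OmegaC k;
     fhom := fun m n a => linear_map a |}.
Next Obligation. by move=> *; apply/eq_exist. Qed.
Next Obligation. by move=> *; apply/eq_exist. Qed.

(* For a simplicial space W, [at_ n W] is the space W_n and [W (n, m)] its set of
   m-simplices. *)
Section Rezk.
Variable W : spsh Delta.

Lemma res_eq (c d : prodc Delta Delta) (f g : hom c d) (x : W d) :
  sval f.1 =1 sval g.1 -> sval f.2 =1 sval g.2 -> res W f x = res W g x.
Proof.
case: f g => [[f fP] [a aP]] [[g gP] [b bP]] /= fg ab.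
by congr (res W (_, _) x); apply/eq_exist/funext.
Qed.

Definition op (m n p : nat) (a : @hom Delta m n) : W (n, p) -> W (m, p) :=
  res W ((a, idm (p : Delta)) : @hom (prodc Delta Delta) (m, p) (n, p)).

Definition vertex (n p : nat) (i : 'I_p.+1) : W (n, p) -> W (n, 0) :=
  res W ((idm (n : Delta), cmap 0 i) : @hom (prodc Delta Delta) (n, 0) (n, p)).

Definition src (p : nat) : W (1, p) -> W (0, p) := op (cmap 0 ord0).
Definition tgt (p : nat) : W (1, p) -> W (0, p) := op (cmap 0 ord_max).
Definition degen (p : nat) : W (0, p) -> W (1, p) := op (cmap 1 ord0).

Program Definition spine_edge (n : nat) (i : 'I_n) : @hom Delta 1 n :=
  exist _ (fun b : 'I_2 => if b == ord0 then widen_ord (leqnSn n) i else lift ord0 i) _.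
Next Obligation.
move=> n i b c; case: eqP => [_|b0]; case: eqP => [c0|_] //=.
by rewrite c0 leqn0 => /eqP b0'; case: b0; apply: val_inj.
Qed.

(* The iterated fibre product W_1 *_(W_0) ... *_(W_0) W_1 with n factors; it is the
   homotopy fibre product when W is Reedy fibrant. *)
Program Definition spine_space (n : nat) : sset :=
  {| sec := fun p => {x : 'I_n -> W (1, p) |
       forall i j : 'I_n, nat_of_ord j = i.+1 -> tgt (x i) = src (x j)};
     res := fun p q a x => exist _ (fun i =>
       res W ((idm (1 : Delta), a) : @hom (prodc Delta Delta) (1, p) (1, q)) (sval x i)) _ |}.
Next Obligation.
move=> n p q a [x xP] i j ij /=; rewrite /tgt /src /op -!res_comp /=.
have := congr1 (res W ((idm (0 : Delta), a) : @hom (prodc Delta Delta) (0, p) (0, q)))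
  (xP i j ij).
rewrite /tgt /src /op -!res_comp /= => E.
by etransitivity; [|etransitivity; [exact: E|]]; congr (res W (_, _) _);
  apply/eq_exist.
Qed.
Next Obligation.
by move=> n p [x xP]; apply/eq_exist/funext => i /=; apply: res_id.
Qed.
Next Obligation.
move=> n p q t b a [x xP]; apply/eq_exist/funext => i /=; rewrite -res_comp.
exact: res_eq.
Qed.

Program Definition spine_map (n : nat) : pmap (at_ (n : Delta) W) (spine_space n) :=
  {| app := fun p x => exist _ (fun i => op (spine_edge i) x) _ |}.
Next Obligation.
move=> n p x i j ij /=; rewrite /tgt /src /op -!res_comp /=.
apply: res_eq => b //=.
by apply: val_inj; rewrite /= ij /bump add1n.
Qed.
Next Obligation.
move=> n p q a x; apply/eq_exist/funext => i /=.
by rewrite /op -!res_comp; apply: res_eq.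
Qed.

(* On Delta the injective and the Reedy model structures coincide, so the first
   condition is Rezk's requirement that W be Reedy fibrant. *)
Definition segal_space : Prop :=
  inj_fibrant W /\ forall n, (2 <= n)%N -> weq (spine_map n).

(* f, g : W_(1, 0) with the same source x and target y lie in the same component of the
   mapping space map_W(x, y), the fibre of W_1 -> W_0 * W_0 over (x, y). *)
Definition map_homotopic (f g : W (1, 0)) : Prop :=
  exists p : W (1, 1),
    [/\ vertex ord0 p = f, vertex ord_max p = g,
        src p = res W ((idm (0 : Delta), cmap 1 ord0)
                       : @hom (prodc Delta Delta) (0, 1) (0, 0)) (src f) &
        tgt p = res W ((idm (0 : Delta), cmap 1 ord0)
                       : @hom (prodc Delta Delta) (0, 1) (0, 0)) (tgt f)].

(* k : W_(2, 0) exhibits its face opposite to 1 as a composite of the face opposite to 2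
   followed by the face opposite to 0. *)
Definition homotopy_equivalence (g : W (1, 0)) : Prop :=
  (exists k : W (2, 0), op (coface (inord 2)) k = g /\
     map_homotopic (op (coface (inord 1)) k) (degen (src g))) /\
  (exists k : W (2, 0), op (coface (inord 0)) k = g /\
     map_homotopic (op (coface (inord 1)) k) (degen (tgt g))).

(* The union of the components of W_1 consisting of homotopy equivalences: a simplex
   belongs to it when all its vertices are homotopy equivalences. *)
Program Definition hoequiv_space : sset :=
  {| sec := fun p => {x : W (1, p) | forall i, homotopy_equivalence (vertex i x)};
     res := fun p q a x => exist _
       (res W ((idm (1 : Delta), a) : @hom (prodc Delta Delta) (1, p) (1, q)) (sval x)) _ |}.
Next Obligation.
move=> p q a [x xP] i /=; have := xP (sval a i); rewrite /vertex -res_comp.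
by congr homotopy_equivalence; apply: res_eq.
Qed.
Next Obligation. by move=> p [x xP]; apply/eq_exist; apply: res_id. Qed.
Next Obligation.
by move=> p q t b a [x xP]; apply/eq_exist; rewrite /= -res_comp; apply: res_eq.
Qed.

Lemma to0_eq (m : nat) (a b : @hom Delta m 0) : a = b.
Proof.
case: a b => [a aP] [b bP]; apply/eq_exist/funext => i.
by rewrite [a i]ord1 [b i]ord1.
Qed.

Lemma degen_homotopy_equivalence (x : W (0, 0)) : homotopy_equivalence (degen x).
Proof.
have hd : map_homotopic (degen x) (degen x).
  exists (res W ((cmap 1 ord0, cmap 1 ord0)
                 : @hom (prodc Delta Delta) (1, 1) (0, 0)) x).
  by rewrite /vertex /src /tgt /degen /op -!res_comp /=; split;
    congr (res W (_, _) x); apply: to0_eq.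
have src_degen : src (degen x) = x.
  rewrite /src /degen /op -res_comp -[RHS]res_id /=.
  by congr (res W (_, _) x); apply: to0_eq.
have tgt_degen : tgt (degen x) = x.
  rewrite /tgt /degen /op -res_comp -[RHS]res_id /=.
  by congr (res W (_, _) x); apply: to0_eq.
have opd (a : @hom Delta 1 2) : op a (op (cmap 2 ord0) x) = degen x.
  rewrite /degen /op -res_comp /=.
  by congr (res W (_, _) x); apply: to0_eq.
by split; exists (op (cmap 2 ord0) x); rewrite !opd ?src_degen ?tgt_degen.
Qed.

Program Definition degen_map : pmap (at_ (0 : Delta) W) hoequiv_space :=
  {| app := fun p x => exist _ (degen x) _ |}.
Next Obligation.
move=> p x i.
suff -> : vertex i (degen x) = degen (vertex i x).
  exact: degen_homotopy_equivalence.
by rewrite /vertex /degen /op -!res_comp; apply: res_eq.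
Qed.
Next Obligation.
move=> p q a x; apply/eq_exist.
by rewrite /degen /op -!res_comp; apply: res_eq.
Qed.

Definition complete_segal_space : Prop := segal_space /\ weq degen_map.

End Rezk.

Definition complete_segal (k : option nat) (k1 : le_oo (Some 1) k)
    (F : spsh (OmegaC k)) : Prop :=
  segal F /\ complete_segal_space (spull (lin k1) F).

(* Main.v *)
From HB Require Import structures.
Require Import Defs.
From mathcomp Require Import all_boot all_order zify.
From mathcomp Require Import boolp.
Import Defs.

(* Write M A for the space of maps A -> F and P_T for the presheaf S |-> Hom (S, T) on
   k-dendroidal closed trees, so that RKan F takes the value M P_T at T.  The homotopy
   colimit of the P_(X^c), over the elementary subtrees X of T, is levelwise equivalent to
   the subpresheaf K_T of P_T of the maps with image in a star of T.  Hence RKan F is Segal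
   at T if and only if K_T -> P_T is F-local, i.e. M P_T -> M K_T is an equivalence.

   A map S -> T of closed trees is determined by its image up to a surjection, and the
   image is a rooted k-dendroidal subset of T; the subpresheaves of P_T considered below
   consist of the maps with image in a given family of subsets.  Given an inner edge e of T,
   the parts T1 and T2 of T below and above e satisfy K_T = K_T1 + K_T2, so by induction it
   suffices that P_T1 + P_T2 -> P_T is local.  This inclusion is filtered by attaching the
   pairs {A, A - e} along the inner horn of A at e.  The horn of a k-dendroidal A is local by
   the Segal condition for A, A1 and A2 and the same filtration of the horn; if A is not
   k-dendroidal neither is A - e, and nothing is attached.

   The linear trees are k-dendroidal, so RKan F and F have the same underlying simplicial
   space. *)

Set Implicit Arguments.
Unset Strict Implicit.
Unset Printing Implicit Defensive.

#[local] Obligation Tactic := try by [].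

(** * Simplicial sets *)

(** When the valences of T exceed k, the Segal condition of F says nothing about T directly; it
    applies only to the k-dendroidal subsets of T. As images of maps from k-dendroidal trees are
    k-dendroidal, the other subsets may be put into a family or removed without changing its
    subpresheaf, so all subsets of T can be filtered as if there were no bound. The one harmful case
    would be A - e k-dendroidal and A not. It is excluded because deleting an inner edge between
    vertices of valence n and m creates a vertex of valence n + m - 1, which is at least n and m
    when both are positive; hence the insistence that something lies above e.

    Locality concerns weak equivalences, which are not stable under base change. But for an
    injection A -> B the restriction M B -> M A is a map of Kan complexes with the homotopy lifting
    property; if it is a weak equivalence, it lifts against all injections. This property is stable
    under base change, so pushouts of local inclusions are local. *)

Section PartialMaps.
Variable C : category.

(* A map from a subpresheaf of B to E, encoded as its graph. *)
Record pgraph (B E : psh C) := PGraph {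
  graph :> forall c, B c -> E c -> Prop;
  graph_res : forall (c d : C) (f : hom c d) x y,
    graph x y -> graph (res B f x) (res E f y);
  graph_fun : forall (c : C) (x : B c) y y', graph x y -> graph x y' -> y = y' }.

Lemma graph_total (B E : psh C) (G : pgraph B E) :
  (forall (c : C) (x : B c), exists y, G c x y) ->
  exists g : pmap B E, forall (c : C) (x : B c), G c x (g c x).
Proof.
move=> tot; pose g c x := projT1 (cid (tot c x)).
have gP c x : G c x (g c x) by exact: projT2 (cid (tot c x)).
have gN (c d : C) (f : hom c d) x : g c (res B f x) = res E f (g d x).
  exact: graph_fun (gP _ _) (graph_res _ (gP _ _)).
by exists (Pmap gN).
Qed.

Lemma pmap_inverse (A B : psh C) (f : pmap A B) :
  (forall c, bijective (f c)) ->
  exists g : pmap B A, (forall c, cancel (f c) (g c)) /\ forall c, cancel (g c) (f c).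
Proof.
move=> fB.
have ex c : exists g, cancel (f c) g /\ cancel g (f c) by have [g fg gf] := fB c; exists g.
pose g c := projT1 (cid (ex c)); have gP c : _ := projT2 (cid (ex c)).
have N (c d : C) (a : hom c d) x : g c (res B a x) = res A a (g d x).
  by apply: (can_inj (gP c).1); rewrite app_nat (gP c).2 (gP d).2.
by exists (Pmap N); split=> c x; [exact: (gP c).1 | exact: (gP c).2].
Qed.

Program Definition dom (B E : psh C) (G : pgraph B E) : psh C :=
  {| sec := fun c => {x : B c | exists y, G c x y};
     res := fun c d f x => exist _ (res B f (sval x)) _ |}.
Next Obligation. by move=> B E G c d f [x [y xy]]; exists (res E f y); apply: graph_res. Qed.
Next Obligation. by move=> B E G c [x xP]; apply/eq_exist; exact: res_id. Qed.
Next Obligation. by move=> B E G c d e g f [x xP]; apply/eq_exist; exact: res_comp. Qed.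

Program Definition dom_incl (B E : psh C) (G : pgraph B E) : pmap (dom G) B :=
  {| app := fun c x => sval x |}.

Lemma dom_incl_inj (B E : psh C) (G : pgraph B E) c : injective (dom_incl G c).
Proof. by move=> [x xP] [y yP] /= xy; apply/eq_exist. Qed.

Lemma dom_map (B E : psh C) (G : pgraph B E) :
  exists g : pmap (dom G) E, forall (c : C) (x : dom G c), G c (sval x) (g c x).
Proof.
pose g (c : C) (x : dom G c) := projT1 (cid (svalP x)).
have gP c x : G c (sval x) (g c x) by exact: projT2 (cid (svalP x)).
have gN (c d : C) (f : hom c d) x : g c (res (dom G) f x) = res E f (g d x).
  by apply: (graph_fun (gP c (res (dom G) f x))); exact: (graph_res f (gP d x)).
by exists (Pmap gN).
Qed.

(** The cells [b i] need not be free: the two hypotheses are the compatibilities, with [G] and among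
    the cells, that keep the union of the graphs single-valued. It serves for all simplices of one
    dimension at once in [attach_cells] and for a single simplex in [prism_fill]. *)
Lemma graph_attach (B E : psh C) (G : pgraph B E) (I : Type) (d : C)
    (b : I -> B d) (e : I -> E d) :
  (forall i (c : C) (f : hom c d) y, G c (res B f (b i)) y -> y = res E f (e i)) ->
  (forall i j (c : C) (f g : hom c d),
     res B f (b i) = res B g (b j) -> res E f (e i) = res E g (e j)) ->
  exists G' : pgraph B E, forall (c : C) (x : B c) (y : E c),
    G' c x y <->
    G c x y \/ exists i, exists2 f : hom c d, x = res B f (b i) & y = res E f (e i).
Proof.
move=> bG bb.
pose R (c : C) (x : B c) (y : E c) :=
  G c x y \/ exists i, exists2 f : hom c d, x = res B f (b i) & y = res E f (e i).
have Rres (c c' : C) (f : hom c c') x y : R c' x y -> R c (res B f x) (res E f y).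
  case=> [xy|[i [g -> ->]]]; first by left; apply: graph_res.
  by right; exists i, (ccomp g f); rewrite res_comp.
have Rfun (c : C) (x : B c) y y' : R c x y -> R c x y' -> y = y'.
  case=> [xy|[i [f xf ->]]] [xy'|[j [g xg ->]]].
  - exact: graph_fun xy xy'.
  - by apply: bG; rewrite -xg.
  - by symmetry; apply: bG; rewrite -xf.
  - by apply: bb; rewrite -xf.
by exists (PGraph Rres Rfun).
Qed.

Program Definition idp (B : psh C) : pmap B B := {| app := fun c x => x |}.

Program Definition empty_graph (B E : psh C) : pgraph B E :=
  {| graph := fun c x y => False |}.

End PartialMaps.

Arguments idp {C} B.

Notation simplex n := (yo (n : Delta)).

Section Nerves.

Lemma Delta_eq (m n : Delta) (a b : hom m n) : (forall i, sval a i = sval b i) -> a = b.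
Proof. by case: a b => [a aP] [b bP] /= ab; apply/eq_exist/funext. Qed.

Lemma cmapC (m n p : Delta) (i : 'I_p.+1) (a : hom m n) :
  @ccomp Delta _ _ _ (cmap n i) a = cmap m i.
Proof. exact: Delta_eq. Qed.

Lemma cmap01 m : cmap m (ord0 : 'I_2) <> cmap m (ord_max : 'I_2).
Proof. by move/(congr1 (fun a : @hom Delta m 1 => val (sval a ord0))). Qed.

Lemma cmap10 m : cmap m (ord_max : 'I_2) <> cmap m (ord0 : 'I_2).
Proof. by move/esym/cmap01. Qed.

Definition misses m n (a : @hom Delta m n) (i : 'I_n.+1) := forall x, sval a x != i.

Lemma misses_comp m n p (a : @hom Delta m n) (b : @hom Delta p m) i :
  misses a i -> misses (@ccomp Delta _ _ _ a b) i.
Proof. by move=> ai x; apply: ai. Qed.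

(** Since the section can be made to pass through any given [x], a surjection is determined by the
    set of its sections. This is the combinatorial core of the Eilenberg-Zilber lemma, used in
    [attach_cells]. *)
Lemma surj_section (m n : nat) (a : @hom Delta m n) (x : 'I_m.+1) :
  (forall i, ~ misses a i) ->
  exists2 d : @hom Delta n m, @ccomp Delta _ _ _ a d = idm (n : Delta) & sval d (sval a x) = x.
Proof.
move=> asurj.
have pre i : exists y, sval a y == i.
  apply/existsP; apply: contra_notT (asurj i) => /existsPn ai y.
  exact: ai.
pose d i := if i == sval a x then x else projT1 (cid (pre i)).
have dP i : sval a (d i) = i.
  by rewrite /d; case: eqP => [->//|_]; apply/eqP; exact: projT2 (cid (pre i)).
have dmono (i j : 'I_n.+1) : (i <= j)%N -> (d i <= d j)%N.
  move=> ij; rewrite leqNgt; apply/negP => dji.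
  have /= := svalP a _ _ (ltnW dji); rewrite !dP => ji.
  have eij : i = j by apply/val_inj/eqP; rewrite eqn_leq ij ji.
  by rewrite eij ltnn in dji.
exists (exist _ d dmono); last by rewrite /= /d eqxx.
by apply: Delta_eq => i /=; rewrite dP.
Qed.

Lemma endo_surj (n : nat) (a : @hom Delta n n) :
  (forall i, ~ misses a i) -> a = idm (n : Delta).
Proof.
move=> asurj.
have [d ad _] := @surj_section _ _ a ord0 asurj.
have da : cancel (sval d) (sval a).
  by move=> i; rewrite -[LHS]/(sval (@ccomp Delta _ _ _ a d) i) ad.
have ainj : injective (sval a).
  have /bij_can_sym dbij : bijective (sval d) by exact: injF_bij (can_inj da).
  exact: can_inj ((dbij (sval a)).2 da).
have amono (i j : 'I_n.+1) : (i < j)%N -> (sval a i < sval a j)%N.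
  move=> ij; rewrite ltn_neqAle (svalP a _ _ (ltnW ij)) andbT.
  by apply: contraTneq ij => /val_inj/ainj ->; rewrite ltnn.
have le i : (i <= n)%N -> forall j : 'I_n.+1, j = i :> nat -> (i <= sval a j)%N.
  elim: i => // i IH lein j ji.
  have lin : (i < n.+1)%N by rewrite ltnS ltnW.
  by apply: leq_ltn_trans (IH (ltnW lein) (Ordinal lin) erefl) (amono _ _ _); rewrite ji.
have ge i : (i <= n)%N -> forall j : 'I_n.+1, (j + i = n)%N -> (sval a j + i <= n)%N.
  elim: i => [|i IH] lein j ji; first by rewrite addn0 leq_ord.
  have lj : (j.+1 < n.+1)%N by have := leq_addr i j.+1; rewrite addSnnS ji.
  rewrite addnS -addSn; apply: leq_trans (IH (ltnW lein) (Ordinal lj) _).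
    by rewrite leq_add2r; apply: amono => /=.
  by rewrite /= addSnnS.
apply: Delta_eq => i; apply/val_inj/eqP; rewrite eqn_leq /= le ?leq_ord // andbT.
have := ge (n - i) (leq_subr _ _) i; rewrite subnKC ?leq_ord // => /(_ erefl).
by move=> /= ?; rewrite -(leq_add2r (n - i)) subnKC ?leq_ord.
Qed.

Lemma misses_face m n (a : @hom Delta m n) i : misses a i ->
  exists n' (a' : @hom Delta m n') (j : @hom Delta n' n),
    (n' < n)%N /\ a = @ccomp Delta _ _ _ j a'.
Proof.
case: n a i => [|n] a i ai; first by have := ai ord0; rewrite [i]ord1 [sval a ord0]ord1 eqxx.
pose f x : 'I_n.+1 := odflt ord0 (unlift i (sval a x)).
have fP x : sval a x = lift i (f x).
  by rewrite /f; case: unliftP (ai x) => [j -> //|->]; rewrite eqxx.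
have fmono (x y : 'I_m.+1) : (x <= y)%N -> (f x <= f y)%N.
  by move=> /(svalP a x y); rewrite !fP /= leq_bump2.
exists n, (exist _ f fmono), (coface i); split=> //.
by apply: Delta_eq => x; rewrite fP.
Qed.

End Nerves.

(** * Trivial fibrations by induction on skeleta *)

Section CellInduction.

(** Right lifting property against the boundary inclusions. The partial map [u] may be defined
    beyond the boundary; the filler has to agree with it only there. *)
Definition fill_boundary (E B : sset) (p : pmap E B) : Prop :=
  forall (n : nat) (u : pgraph (simplex n) E) (v : B n),
    (forall m (a : @hom Delta m n) y, u m a y -> p m y = res B a v) ->
    (forall m (a : @hom Delta m n), (exists i, misses a i) -> exists y, u m a y) ->
    exists2 e : E n, p n e = v &
      forall m (a : @hom Delta m n) y, (exists i, misses a i) -> u m a y -> y = res E a e.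

(** Right lifting property against all monomorphisms, the subobject being the domain of [G]. *)
Definition trivial_fibration (E B : sset) (p : pmap E B) : Prop :=
  forall (V : sset) (G : pgraph V E) (v : pmap V B),
    (forall m x y, G m x y -> p m y = v m x) ->
    exists2 e : pmap V E, (forall m x, p m (e m x) = v m x) &
      forall m x y, G m x y -> y = e m x.

(** An [n]-simplex outside the domain of [G] is nondegenerate, because the simplices of lower
    dimension are in the domain; its boundary lies in the domain for the same reason. Fillers are
    therefore chosen independently for all such simplices. *)
Lemma attach_cells (E B : sset) (p : pmap E B) (V : sset) (G : pgraph V E)
    (v : pmap V B) (n : nat) :
  fill_boundary p -> (forall m x y, G m x y -> p m y = v m x) ->
  (forall m, (m < n)%N -> forall x : V m, exists y, G m x y) ->
  exists G' : pgraph V E,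
    [/\ forall m x y, G' m x y -> p m y = v m x,
        forall m, (m < n.+1)%N -> forall x : V m, exists y, G' m x y &
        forall m x y, G m x y -> G' m x y].
Proof.
move=> pfill Gv IH; pose bnd b := ~ exists y, G n b y.
have face (b : V n) m (a : @hom Delta m n) i : misses a i -> exists y, G m (res V a b) y.
  move=> ai; have [n' [a' [j [n'n ->]]]] := misses_face ai.
  by rewrite res_comp; have [y yP] := IH _ n'n (res V j b); exists (res E a' y); apply: graph_res.
have nface b m (a : @hom Delta m n) y : bnd b -> G m (res V a b) y -> exists i, misses a i.
  move=> bG aby; apply: contra_notP bG => asurj.
  have [d ad _] := @surj_section m n a ord0 (fun i ai => asurj (ex_intro _ i ai)).
  by exists (res E d y); rewrite -[b]res_id -ad res_comp; apply: graph_res.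
have ex_e b : exists e : E n, p n e = v n b /\
    forall m (a : @hom Delta m n) y, (exists i, misses a i) -> G m (res V a b) y -> y = res E a e.
  pose u m (a : simplex n m) y := G m (res V a b) y.
  have ures (c d : Delta) (f : hom c d) x y : u d x y -> u c (res (simplex n) f x) (res E f y).
    by rewrite /u /= res_comp; apply: graph_res.
  have ufun c x y y' : u c x y -> u c x y' -> y = y' by exact: graph_fun.
  have [m a y /Gv ->||e pe eP] := pfill n (PGraph ures ufun) (v n b).
  - by rewrite app_nat.
  - by move=> m a [i ai]; apply: face ai.
  - by exists e.
pose e b := projT1 (cid (ex_e b)); have eP b := projT2 (cid (ex_e b)).
have [[b bG] m a y aby|[b bG] [b' b'G] m a a' aa'|G' G'P] :=
  @graph_attach _ _ _ G {b | bnd b} n (fun b => sval b) (fun b => e (sval b)).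
- exact: (eP b).2 (nface _ _ _ _ bG aby) aby.
(* If the common restriction is in the domain of [G], both values are prescribed. Otherwise [a] is
   surjective, and each section of [a] is a section of [a']: if the composite missed a vertex, [b]
   would be in the domain. Hence [b = b'], then [a = a']. *)
- rewrite /= in aa' *.
  have [[y aby]|abN] := pselect (exists y, G m (res V a b) y).
    rewrite -((eP b).2 _ _ _ (nface _ _ _ _ bG aby) aby).
    move: aby; rewrite aa' => aby.
    exact: (eP b').2 (nface _ _ _ _ b'G aby) aby.
  have asurj i : ~ misses a i by move=> /(face b); exact: abN.
  have eid d : @ccomp Delta _ _ _ a d = idm (n : Delta) ->
      @ccomp Delta _ _ _ a' d = idm (n : Delta).
    move=> ad; apply: endo_surj => i /(face b')[y]; rewrite res_comp -aa' -res_comp ad res_id.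
    move=> bGy.
    by apply: bG; exists y.
  have bb' : b = b'.
    have [d ad _] := surj_section ord0 asurj.
    by rewrite -[b]res_id -ad res_comp aa' -res_comp eid // res_id.
  suff -> : a = a' by rewrite bb'.
  apply: Delta_eq => x; have [d ad dx] := surj_section x asurj.
  by rewrite -{2}dx -[RHS]/(sval (@ccomp Delta _ _ _ a' d) (sval a x)) eid.
exists G'; split.
- by move=> m x y /G'P[/Gv//|[b [f -> ->]]]; rewrite app_nat (eP _).1 app_nat.
- move=> m; rewrite ltnS leq_eqVlt => /predU1P[-> x|mn x]; last first.
    by have [y xy] := IH m mn x; exists y; apply/G'P; left.
  have [[y xy]|xG] := pselect (exists y, G n x y).
    by exists y; apply/G'P; left.
  exists (e x); apply/G'P; right; exists (exist _ x xG), (idm (n : Delta)).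
    by rewrite /= res_id.
  by rewrite /= res_id.
- by move=> m x y xy; apply/G'P; left.
Qed.

Lemma boundary_trivial_fibration (E B : sset) (p : pmap E B) :
  fill_boundary p -> trivial_fibration p.
Proof.
move=> pfill V G0 v G0v.
pose S n (G : pgraph V E) := (forall m x y, G m x y -> p m y = v m x) /\
  forall m, (m < n)%N -> forall x : V m, exists y, G m x y.
have S0 : S 0 G0 by split.
have step n (G : {G | S n G}) : exists G' : {G' | S n.+1 G'},
    forall m x y, sval G m x y -> sval G' m x y.
  case: G => G [Gv Gn]; have [G' [G'v G'n GG']] := attach_cells pfill Gv Gn.
  by exists (exist _ G' (conj G'v G'n)).
pose fix Gs n : {G | S n G} :=
  if n is n'.+1 then projT1 (cid (step n' (Gs n'))) else exist _ G0 S0.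
have GsS n m x y : sval (Gs n) m x y -> sval (Gs n.+1) m x y.
  exact: (projT2 (cid (step n (Gs n)))).
have Gsle n n' m x y : (n <= n')%N -> sval (Gs n) m x y -> sval (Gs n') m x y.
  by move=> /subnK <- xy; elim: (n' - n)%N => // k; exact: GsS.
pose H m x y := exists n, sval (Gs n) m x y.
have Hres (c d : Delta) (f : hom c d) x y : H d x y -> H c (res V f x) (res E f y).
  by move=> [n xy]; exists n; apply: graph_res.
have Hfun c (x : V c) y y' : H c x y -> H c x y' -> y = y'.
  move=> [n xy] [n' xy']; apply: graph_fun (Gsle _ _ _ _ _ (leq_maxl n n') xy) _.
  exact: Gsle (leq_maxr n n') xy'.
have [n x|g gP] := @graph_total _ _ _ (PGraph Hres Hfun).
  by have [y xy] := (svalP (Gs n.+1)).2 n (ltnSn n) x; exists y, n.+1.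
exists g => [m x|m x y xy]; last exact: Hfun m x _ _ (ex_intro _ 0 xy) (gP m x).
by have [n] := gP m x; exact: (svalP (Gs n)).1.
Qed.
End CellInduction.

(** * Prisms, path spaces and homotopies *)

Section Prisms.

Lemma kan_graph (K : sset) (n : nat) (k : 'I_n.+2) (u : pgraph (simplex n.+1) K) :
  kan K ->
  (forall m (a : @hom Delta m n.+1) i, i != k -> misses a i -> exists y, u m a y) ->
  exists e : K n.+1, forall m (a : @hom Delta m n.+1) i y,
    i != k -> misses a i -> u m a y -> y = res K a e.
Proof.
move=> Kkan uP.
have uh m (a : horn k m) : exists y, u m (sval a) y.
  by case: a => a [i ik ai]; apply: uP ik ai.
pose h m a := projT1 (cid (uh m a)); have hP m a : u m (sval a) (h m a) := projT2 (cid (uh m a)).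
have hN (c d : Delta) (f : hom c d) x : h c (res (horn k) f x) = res K f (h d x).
  exact: graph_fun (hP c (res (horn k) f x)) (graph_res f (hP d x)).
have [g gP] := Kkan n k (Pmap hN).
exists (g n.+1 (idm (n.+1 : Delta))) => m a i y ik ai uy.
pose a' : horn k m := exist _ a (ex_intro2 _ _ i ik ai).
rewrite (graph_fun uy (hP m a')) -[h m a']/(Pmap hN m a') -gP -app_nat /=.
by congr (g m _); apply: Delta_eq.
Qed.

Variables (n : nat).

Definition degeneracy_fun (q : nat) (x : 'I_n.+2) : 'I_n.+1 := inord (x - (q < x)).

Lemma degeneracyE q x : (q <= n)%N -> degeneracy_fun q x = (x - (q < x))%N :> nat.
Proof. by move=> qn; rewrite inordK //; have := ltn_ord x; lia. Qed.

Lemma degeneracy_mono q (x y : 'I_n.+2) : (q <= n)%N ->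
  (x <= y)%N -> (degeneracy_fun q x <= degeneracy_fun q y)%N.
Proof. by move=> qn xy; rewrite !degeneracyE //; lia. Qed.

Program Definition degeneracy q (qn : (q <= n)%N) : @hom Delta n.+1 n :=
  exist _ (degeneracy_fun q) _.
Next Obligation. by move=> q qn i j; apply: degeneracy_mono. Qed.

Program Definition cut (q : nat) : @hom Delta n.+1 1 :=
  exist _ (fun x : 'I_n.+2 => if (x <= q)%N then ord0 else ord_max) _.
Next Obligation.
by move=> q i j ij /=; case: (leqP i q) => // qi; case: (leqP j q) => //=; lia.
Qed.

Notation prism := (prodp (simplex n) (simplex 1)).

(** The maximal simplex of the prism with vertices (0,0), ..., (q,0), (q,1), ..., (n,1);
    [in_shuffle q] characterises the simplices that it contains. *)
Definition shuffle q (qn : (q <= n)%N) : prism n.+1 := (degeneracy qn, cut q).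

Definition in_shuffle (q : nat) m (x : prism m) := forall i,
  (sval x.2 i = ord0 -> (sval x.1 i <= q)%N) /\ (sval x.2 i = ord_max -> (q <= sval x.1 i)%N).

Lemma ord2P (i : 'I_2) : {i = ord0} + {i = ord_max}.
Proof. by case: i => [[|[|]]] // lti; [left|right]; apply: val_inj. Qed.

Lemma in_shuffleP q (qn : (q <= n)%N) m (x : prism m) :
  in_shuffle q x <-> exists a : @hom Delta m n.+1, x = res prism a (shuffle qn).
Proof.
split=> [xq|[a ->] i]; last first.
  rewrite /= degeneracyE //; case: (leqP (sval a i) q) => aq; split=> //= _; lia.
pose f i : 'I_n.+2 := inord (sval x.1 i + (sval x.2 i == ord_max)).
have fE i : f i = (sval x.1 i + (sval x.2 i == ord_max))%N :> nat.
  by rewrite inordK //; have := ltn_ord (sval x.1 i); case: eqP; lia.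
have fmono (i j : 'I_m.+1) : (i <= j)%N -> (f i <= f j)%N.
  move=> ij; rewrite !fE; have := svalP x.1 _ _ ij; have := svalP x.2 _ _ ij.
  case: (ord2P (sval x.2 i)) => ->; case: (ord2P (sval x.2 j)) => -> //=; lia.
exists (exist _ f fmono); case: x @f xq fE fmono => [a t] f xq fE fmono /=.
congr pair; apply: Delta_eq => i; apply: val_inj; rewrite /= ?degeneracyE // fE.
  have [/= x0 x1] := xq i; case: (ord2P (sval t i)) => ti; rewrite ti /=.
    by have := x0 ti; lia.
  by have := x1 ti; lia.
have [/= x0 x1] := xq i; case: (ord2P (sval t i)) => ti; rewrite ti /=.
  by rewrite addn0 x0.
by have := x1 ti; case: (leqP (sval a i + 1) q) => //=; lia.
Qed.

Lemma shuffle_inj q (qn : (q <= n)%N) m (a b : @hom Delta m n.+1) :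
  res prism a (shuffle qn) = res prism b (shuffle qn) -> a = b.
Proof.
case=> sab tab; apply: Delta_eq => i; apply: val_inj.
have /(congr1 val) /= := congr1 (@^~ i) sab; rewrite !degeneracyE //.
have /(congr1 val) /= := congr1 (@^~ i) tab.
by case: (leqP (sval a i) q); case: (leqP (sval b i) q) => //=; lia.
Qed.

(** The open box: the bottom of the prism and the walls over the boundary. *)
Definition open_prism m (x : prism m) :=
  x.2 = cmap m ord0 \/ exists i, misses x.1 i.

(* The nondegenerate simplices [shuffle q] are attached for q = n, ..., 0, each
   along the horn opposite to its vertex q. *)
Lemma shuffle_horn q (qn : (q <= n)%N) m (a : @hom Delta m n.+1) :
  let x := res prism a (shuffle qn) in
  (open_prism x \/ exists i : 'I_n.+1, (q < i)%N /\ in_shuffle i x) <->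
  exists2 j, j != inord q & misses a j.
Proof.
move=> x; have qE : (inord q : 'I_n.+2) = q :> nat by rewrite inordK; lia.
split=> [xP|[j jq aj]].
  apply: contrapT => noj.
  have hit (j : 'I_n.+2) : j != q :> nat -> exists i, sval a i = j.
    move=> jq; apply: contra_notP noj => ai; exists j.
      by apply: contra jq => /eqP ->; rewrite qE.
    by move=> i; apply/eqP => aij; apply: ai; exists i.
  have lq : (q.+1 < n.+2)%N by [].
  have [|i0 i0q] := hit (Ordinal lq); first by rewrite /=; lia.
  case: xP => [[x2|[i xi]]|[i [qi xq]]].
  - have := congr1 (fun b : @hom Delta m 1 => val (sval b i0)) x2.
    by rewrite /= i0q /= ltnn.
  - pose j := if (i < q)%N then i : nat else i.+1.
    have jn : (j < n.+2)%N by rewrite /j; have := ltn_ord i; case: ifP; lia.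
    have [|i1 i1j] := hit (Ordinal jn); first by rewrite /= /j; case: ifP; lia.
    have /negP[] := xi i1; apply/eqP/val_inj.
    by rewrite /= degeneracyE // i1j /= /j; case: ifP; lia.
  - have [_] := xq i0; rewrite /= i0q /= ltnn degeneracyE //= => /(_ erefl).
    by lia.
have jqN : j != q :> nat by apply: contra jq => /eqP jq; apply/eqP/val_inj; rewrite /= qE.
have ajN i : sval a i != j :> nat by apply: aj.
have jn := ltn_ord j; have an i := ltn_ord (sval a i).
(* The face opposite to q + 1 is shared with the next shuffle or, for q = n, is the bottom of the
   prism. Any other face, apart from the one opposite to q, projects into the boundary of the
   simplex. *)
have [jq1|jq1] := eqVneq (j : nat) q.+1; last first.
  left; right; exists (inord (j - (q < j))) => i; apply/eqP => /(congr1 val) /=.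
  rewrite degeneracyE // inordK; last by lia.
  by have := ajN i; lia.
have [qn'|qn'] := eqVneq q n.
  left; left; apply: Delta_eq => i /=; case: leqP => // qa.
  by have := ajN i; have := an i; lia.
right; exists (inord q.+1); rewrite inordK; last by lia.
split=> // i; rewrite /= degeneracyE //; case: leqP => qa; split=> // _; first by lia.
by have := ajN i; lia.
Qed.

Lemma prism_fill (K : sset) (G : pgraph prism K) : kan K ->
  (forall m x, (exists y, G m x y) <-> open_prism x) ->
  exists g : pmap prism K, forall m x y, G m x y -> y = g m x.
Proof.
move=> Kkan Gdom.
(* [k] counts the shuffles already attached, from the last one down. *)
have /(_ n.+1 (leqnn _))[G' [GG' G'P]] k : (k <= n.+1)%N -> exists G' : pgraph prism K,
    (forall m x y, G m x y -> G' m x y) /\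
    forall m x, (exists y, G' m x y) <->
      open_prism x \/ exists i : 'I_n.+1, (n.+1 - k <= i)%N /\ in_shuffle i x.
  elim: k => [_|k IH kn].
    exists G; split=> // m x; rewrite Gdom; split=> [|[//|[i []]]]; first by left.
    by have := ltn_ord i; lia.
  have [G' [GG' G'P]] := IH (ltnW kn); pose q := (n.+1 - k.+1)%N.
  have qk : (n.+1 - k = q.+1)%N by rewrite /q; lia.
  have qn : (q <= n)%N by rewrite /q; lia.
  rewrite qk in G'P.
  pose u m (a : simplex n.+1 m) y := G' m (res prism a (shuffle qn)) y.
  have ures (c d : Delta) (f : hom c d) x y :
      u d x y -> u c (res (simplex n.+1) f x) (res K f y).
    by rewrite /u res_comp; apply: graph_res.
  have ufun c x y y' : u c x y -> u c x y' -> y = y' by exact: graph_fun.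
  have uP m a : (exists y, u m a y) <-> exists2 j, j != inord q & misses a j.
    by rewrite -(shuffle_horn qn) -G'P.
  have [m a i iq ai|e eP] := kan_graph (k := inord q) (u := PGraph ures ufun) Kkan.
    by apply/uP; exists i.
  have [_ m a y uy|_ _ m a b /shuffle_inj -> //|G'' G''P] :=
    @graph_attach _ _ _ G' unit n.+1 (fun=> shuffle qn) (fun=> e).
    have [j jq aj] : exists2 j, j != inord q & misses a j by apply/uP; exists y.
    exact: eP jq aj uy.
  exists G''; split=> [m x y xy|m x]; first by apply/G''P; left; apply: GG'.
  split=> [[y /G''P[xy|[_ [a -> _]]]]|].
  - have /G'P[|[i [qi xi]]] : exists y, G' m x y by exists y.
      by left.
    by right; exists i; split=> //; apply: ltnW.
  - right; exists (inord q); rewrite inordK //; split=> //.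
    by apply/(in_shuffleP qn); exists a.
  - case=> [ox|[i []]].
      have /G'P[y xy] : open_prism x \/ exists i : 'I_n.+1, (q < i)%N /\ in_shuffle i x by left.
      by exists y; apply/G''P; left.
    rewrite leq_eqVlt => /predU1P[<- /(in_shuffleP qn)[a ->]|qi xi].
      by exists (res K a e); apply/G''P; right; exists tt, a.
    have /G'P[y xy] : open_prism x \/ exists i : 'I_n.+1, (q < i)%N /\ in_shuffle i x.
      by right; exists i.
    by exists y; apply/G''P; left.
have [m x|g gP] := graph_total (G := G').
  apply/G'P; have [x2|x2] := pselect (x.2 = cmap m ord0); first by left; left.
  have [i0 i0P] : exists i, sval x.2 i != ord0.
    apply: contrapT => none; apply: x2; apply: Delta_eq => i /=.
    by apply/eqP; apply: contrapT => /negP ni; apply: none; exists i.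
  (* A simplex not contained in the bottom lies in the shuffle indexed by the first coordinate of
     its earliest vertex in the top. *)
  case: (@arg_minnP _ i0 (fun i => sval x.2 i != ord0) val i0P) => i iP imin.
  right; exists (sval x.1 i); split=> [|k]; first by lia.
  split=> xk; apply: (svalP x.1).
    rewrite leqNgt; apply: contra iP => ik; rewrite -(inj_eq val_inj) /= -leqn0.
    by apply: leq_trans (svalP x.2 _ _ (ltnW ik)) _; rewrite xk.
  by apply: imin; rewrite xk.
by exists g => m x y /GG' xy; apply: graph_fun xy (gP m x).
Qed.

End Prisms.

Section Paths.
Variable K : sset.

Program Definition path : sset :=
  {| sec := fun n : Delta => pmap (prodp (simplex n) (simplex 1)) K;
     res := fun m n a phi => {| app := fun c x => phi c (ccomp a x.1, x.2) |} |}.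
Next Obligation.
move=> m n a phi c d f [b t]; rewrite -app_nat; congr (phi _ (_, _)); exact: Delta_eq.
Qed.
Next Obligation.
by move=> n phi; apply: pmap_eq => c [b t]; congr (phi _ (_, _)); apply: Delta_eq.
Qed.
Next Obligation.
by move=> m n p a b phi; apply: pmap_eq => c [x t]; congr (phi _ (_, _)); apply: Delta_eq.
Qed.

Program Definition path_ev (i : 'I_2) : pmap path K :=
  {| app := fun n phi => phi n (idm (n : Delta), cmap n i) |}.
Next Obligation.
move=> i m n a phi /=; rewrite -(app_nat phi a) /=.
by congr (phi _ (_, _)); apply: Delta_eq.
Qed.

Program Definition path_of (X : sset) (H : pmap (prodp X (simplex 1)) K) : pmap X path :=
  {| app := fun n x => {| app := fun c y => H c (res X y.1 x, y.2) |} |}.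
Next Obligation.
by move=> X H n x c d f [b t]; rewrite -app_nat; congr (H _ (_, _)); exact: res_comp.
Qed.
Next Obligation.
move=> X H m n f x; apply: pmap_eq => c [b t] /=; congr (H _ (_, _)).
exact/esym/res_comp.
Qed.

(** By adjunction, filling a boundary against evaluation at 0 means extending a map from the open
    box to the prism, which is [prism_fill]. *)
Lemma path_ev_trivial_fibration : kan K -> trivial_fibration (path_ev ord0).
Proof.
move=> Kkan; apply: boundary_trivial_fibration => n u v uv udom.
pose R m (x : prodp (simplex n) (simplex 1) m) (z : K m) :=
  (x.2 = cmap m ord0 /\ z = res K x.1 v) \/
  exists y : path m, [/\ exists i, misses x.1 i, u m x.1 y & z = y m (idm (m : Delta), x.2)].
have Rres (c d : Delta) (f : hom c d) x y : R d x y ->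
    R c (res (prodp (simplex n) (simplex 1)) f x) (res K f y).
  case=> [[x2 ->]|[y' [[i xi] uy ->]]]; [left|right].
    by split; [rewrite /= x2; exact: cmapC | exact/esym/res_comp].
  exists (res path f y'); split; first by exists i; apply: misses_comp.
    exact: graph_res.
  by rewrite -(app_nat y' f) /=; congr (y' _ (_, _)); apply: Delta_eq.
have Rfun c x y y' : R c x y -> R c x y' -> y = y'.
  case=> [[x2 ->]|[z [_ uz ->]]] [[x2' ->]|[z' [_ uz' ->]]] //.
  - by rewrite -(uv _ _ _ uz') /= x2.
  - by rewrite -(uv _ _ _ uz) /= x2'.
  - by rewrite (graph_fun uz uz').
have [m x|g gP] := prism_fill (G := PGraph Rres Rfun) Kkan.
  split=> [[y [[x2 _]|[z [xi _ _]]]]|[x2|xi]]; [by left|by right| |].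
    by exists (res K x.1 v); left.
  have [y uy] := udom _ _ xi; exists (y m (idm (m : Delta), x.2)).
  by right; exists y.
exists (g : path n) => [|m a y ai uy].
  by rewrite /= -(gP n (idm (n : Delta), cmap n ord0) v) //; left; rewrite /= res_id.
apply: pmap_eq => c [b t] /=; rewrite -(gP c (ccomp a b, t) (y c (b, t))) //.
right; exists (res path b y); split.
- by case: ai => i ai; exists i; apply: misses_comp.
- exact: (graph_res b uy).
- by congr (y _ (_, _)); apply: Delta_eq.
Qed.

End Paths.

Lemma snd_cmap (V : sset) (c d : Delta) (a : hom c d) (x : prodp V (simplex 1) d) i :
  x.2 = cmap d i -> (res (prodp V (simplex 1)) a x).2 = cmap c i.
Proof. by move=> /= ->; apply: Delta_eq. Qed.

Section Homotopies.
Variables (X K : sset).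
Implicit Types f g h : pmap X K.

Lemma homotopic_refl f : homotopic f f.
Proof.
have N (c d : Delta) (a : hom c d) (x : prodp X (simplex 1) d) :
    f c (res (prodp X (simplex 1)) a x).1 = res K a (f d x.1) by rewrite /= app_nat.
by exists (@Pmap _ (prodp X (simplex 1)) K (fun m x => f m x.1) N).
Qed.

Hypothesis Kkan : kan K.

(** The two homotopies are maps from [X] to the path space that start at the same [f]. Lifting the
    constant homotopy at [f] through evaluation at 0 joins them, and evaluation of the lift at 1 is
    a homotopy from [g] to [h]. With reflexivity this single property gives symmetry and
    transitivity. *)
Lemma homotopic_euclid f g h : homotopic f g -> homotopic f h -> homotopic g h.
Proof.
move=> [H HP] [H' H'P].
pose R m (x : prodp X (simplex 1) m) (y : path K m) :=
  (x.2 = cmap m ord0 /\ y = path_of H m x.1) \/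
  (x.2 = cmap m ord_max /\ y = path_of H' m x.1).
have Rres (c d : Delta) (a : hom c d) x y : R d x y ->
    R c (res (prodp X (simplex 1)) a x) (res (path K) a y).
  by case=> [[x2 ->]|[x2 ->]]; [left|right]; rewrite -app_nat (snd_cmap _ x2).
have Rfun c x y y' : R c x y -> R c x y' -> y = y'.
  by case=> [[x2 ->]|[x2 ->]] [[x2' ->]|[x2' ->]] //;
    move: x2'; rewrite x2 => E; [case: (cmap01 E)|case: (cmap10 E)].
have N (c d : Delta) (a : hom c d) (x : prodp X (simplex 1) d) :
    f c (res (prodp X (simplex 1)) a x).1 = res K a (f d x.1) by rewrite /= app_nat.
have [m x y|e _ eP] := path_ev_trivial_fibration Kkan (G := PGraph Rres Rfun)
    (v := @Pmap _ (prodp X (simplex 1)) K (fun m x => f m x.1) N).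
  by case=> [[x2 ->]|[x2 ->]] /=; rewrite res_id; [case: (HP m x.1)|case: (H'P m x.1)].
exists (pcomp (path_ev K ord_max) e) => m x /=.
split.
  rewrite -(eP m (x, cmap m ord0) (path_of H m x)) /= ?res_id; last by left.
  by have [] := HP m x.
rewrite -(eP m (x, cmap m ord_max) (path_of H' m x)) /= ?res_id; last by right.
by have [] := H'P m x.
Qed.

Lemma homotopic_sym f g : homotopic f g -> homotopic g f.
Proof. by move=> fg; apply: homotopic_euclid fg (homotopic_refl f). Qed.

Lemma homotopic_trans f g h : homotopic f g -> homotopic g h -> homotopic f h.
Proof. by move=> /homotopic_sym; apply: homotopic_euclid. Qed.

End Homotopies.

Lemma homotopic_precomp (X Y K : sset) (a : pmap X Y) (f g : pmap Y K) :
  homotopic f g -> homotopic (pcomp f a) (pcomp g a).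
Proof.
move=> [H HP].
have N (c d : Delta) (u : hom c d) (x : prodp X (simplex 1) d) :
    H c (a c (res (prodp X (simplex 1)) u x).1, (res (prodp X (simplex 1)) u x).2) =
    res K u (H d (a d x.1, x.2)) by rewrite -app_nat /= app_nat.
exists (@Pmap _ (prodp X (simplex 1)) K (fun m x => H m (a m x.1, x.2)) N) => m x /=.
exact: HP.
Qed.

Lemma homotopic_postcomp (X Y K : sset) (b : pmap Y K) (f g : pmap X Y) :
  homotopic f g -> homotopic (pcomp b f) (pcomp b g).
Proof.
move=> [H HP]; exists (pcomp b H) => m x /=.
by have [-> ->] := HP m x.
Qed.

Arguments homotopic_postcomp {X Y K} b {f g}.
Arguments homotopic_precomp {X Y K} a {f g}.

(** * Weak equivalences and the Whitehead theorem for fibrations *)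

Section WeakEquivalences.
Lemma pcompA (C : category) (A B D E : psh C) (h : pmap D E) (g : pmap B D) (f : pmap A B) :
  pcomp h (pcomp g f) = pcomp (pcomp h g) f.
Proof. exact: pmap_eq. Qed.

Lemma pcompm1 (C : category) (A B : psh C) (f : pmap A B) : pcomp f (idp A) = f.
Proof. exact: pmap_eq. Qed.

Variables X Y Z : sset.

Lemma weq_comp (f : pmap X Y) (g : pmap Y Z) : weq f -> weq g -> weq (pcomp g f).
Proof.
move=> fW gW K Kkan; have [fs fi] := fW K Kkan; have [gs gi] := gW K Kkan; split.
  move=> a; have [b bf] := fs a; have [c cg] := gs b; exists c; rewrite pcompA.
  exact (homotopic_trans Kkan (homotopic_precomp f cg) bf).
by move=> h h'; rewrite !pcompA => /fi/gi.
Qed.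

Lemma weq_cancel_l (f : pmap X Y) (g : pmap Y Z) : weq f -> weq (pcomp g f) -> weq g.
Proof.
move=> fW gfW K Kkan; have [fs fi] := fW K Kkan; have [gfs gfi] := gfW K Kkan; split.
  move=> b; have [c cgf] := gfs (pcomp b f); exists c.
  by apply: fi; rewrite -pcompA.
move=> h h' hh'; apply: gfi; rewrite !pcompA; exact: homotopic_precomp.
Qed.

Lemma weq_cancel_r (f : pmap X Y) (g : pmap Y Z) : weq g -> weq (pcomp g f) -> weq f.
Proof.
move=> gW gfW K Kkan; have [gs gi] := gW K Kkan; have [gfs gfi] := gfW K Kkan; split.
  by move=> a; have [c ca] := gfs a; exists (pcomp c g); rewrite -pcompA.
move=> h h' hh'; have [c ch] := gs h; have [c' c'h'] := gs h'.
suff cc' : homotopic c c'.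
  apply: (homotopic_trans Kkan (homotopic_sym Kkan ch) _).
  exact: (homotopic_trans Kkan (homotopic_precomp g cc') c'h').
apply: gfi; rewrite !pcompA.
apply: (homotopic_trans Kkan (homotopic_precomp f ch) _).
apply: (homotopic_trans Kkan hh' _).
exact: (homotopic_sym Kkan (homotopic_precomp f c'h')).
Qed.

(** Homotopy of maps into [X] or [Y] is not symmetric in general, so each homotopy may run in either
    direction; after composition with a map to a Kan complex the direction is immaterial. *)
Lemma weq_homotopy_inverse (f : pmap X Y) (g : pmap Y X) :
  (homotopic (pcomp g f) (idp X) \/ homotopic (idp X) (pcomp g f)) ->
  (homotopic (pcomp f g) (idp Y) \/ homotopic (idp Y) (pcomp f g)) -> weq f.
Proof.
move=> gf fg K Kkan.
have gfK (a : pmap X K) : homotopic (pcomp a (pcomp g f)) a.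
  case: gf => /(homotopic_postcomp a); rewrite pcompm1 // => /(homotopic_sym Kkan).
  exact.
have fgK (a : pmap Y K) : homotopic (pcomp a (pcomp f g)) a.
  case: fg => /(homotopic_postcomp a); rewrite pcompm1 // => /(homotopic_sym Kkan).
  exact.
split=> [a|h h' hh']; first by exists (pcomp a g); rewrite -pcompA; exact: gfK.
apply: (homotopic_trans Kkan (homotopic_sym Kkan (fgK h)) _).
apply: (homotopic_trans Kkan _ (fgK h')); rewrite !pcompA.
exact: homotopic_precomp.
Qed.

Lemma weq_iso (f : pmap X Y) (g : pmap Y X) :
  (forall m, cancel (f m) (g m)) -> (forall m, cancel (g m) (f m)) -> weq f.
Proof.
move=> fK gK; apply: (weq_homotopy_inverse (g := g)); left.
  have -> : pcomp g f = idp X by apply: pmap_eq => m x; exact: fK.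
  exact: homotopic_refl.
have -> : pcomp f g = idp Y by apply: pmap_eq => m x; exact: gK.
exact: homotopic_refl.
Qed.

End WeakEquivalences.

Lemma weq_bij (X Y : sset) (f : pmap X Y) : (forall m, bijective (f m)) -> weq f.
Proof.
move=> fB.
have [g [fg gf]] := pmap_inverse fB; exact: weq_iso fg gf.
Qed.

Lemma weq_square (X Y X' Y' : sset) (f : pmap X Y) (f' : pmap X' Y')
    (a : pmap X X') (b : pmap Y Y') :
  weq a -> weq b -> pcomp f' a = pcomp b f -> weq f <-> weq f'.
Proof.
move=> aW bW sq; split=> W.
- by apply: weq_cancel_l aW _; rewrite sq; apply: weq_comp.
- by apply: weq_cancel_r bW _; rewrite -sq; apply: weq_comp.
Qed.

(** The deformation only has to preserve the image of [i], not to fix it; the retraction is then a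
    left inverse of [i] up to homotopy. Both choices of the final end [i1] occur in applications. *)
Lemma weq_deformation_retract (X Y : sset) (i : pmap X Y) (D : pmap (prodp Y (simplex 1)) Y)
    (i0 i1 : 'I_2) :
  i0 != i1 -> (forall m, injective (i m)) ->
  (forall m y, D m (y, cmap m i1) = y) ->
  (forall m y, exists x, i m x = D m (y, cmap m i0)) ->
  (forall m x t, exists x', i m x' = D m (i m x, t)) -> weq i.
Proof.
move=> i01 i_inj D1 D0 DX.
pose r m y := projT1 (cid (D0 m y)); have rP m y : i m (r m y) = _ := projT2 (cid (D0 m y)).
have rN (c d : Delta) (a : hom c d) y : r c (res Y a y) = res X a (r d y).
  by apply: i_inj; rewrite rP app_nat rP -app_nat; congr (D _ (_, _)); apply: Delta_eq.
pose q m x := projT1 (cid (DX m x.1 x.2)).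
have qP m x : i m (q m x) = _ := projT2 (cid (DX m x.1 x.2)).
have qN (c d : Delta) (a : hom c d) (x : prodp X (simplex 1) d) :
    q c (res (prodp X (simplex 1)) a x) = res X a (q d x).
  by apply: i_inj; rewrite qP app_nat qP -app_nat; congr (D _ (_, _)); apply: app_nat.
have ends : (i0 = ord0 /\ i1 = ord_max) \/ (i0 = ord_max /\ i1 = ord0).
  by case: (ord2P i0) i01 => ->; case: (ord2P i1) => -> //; [left|right].
apply: (@weq_homotopy_inverse _ _ _ (Pmap rN)).
- case: ends => -[e0 e1]; [left|right]; exists (Pmap qN) => m x; split;
    by apply: i_inj; rewrite /= qP /= ?rP ?e0 ?e1 // -?e1 D1.
- case: ends => -[e0 e1]; [left|right]; exists D => m y; split;
    by rewrite /= ?rP ?e0 ?e1 // -?e1 D1.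
Qed.

Program Definition liftpr (V B : sset) (v : pmap V B) : pmap (prodp V (simplex 1)) B :=
  {| app := fun m x => v m x.1 |}.
Next Obligation. by move=> V B v m n a x; rewrite /= app_nat. Qed.

(** The relative homotopy lifting property: the last two hypotheses on [G] say that its domain is
    the union of V x {0} and U x [0,1] for a subobject U of V. *)
Definition homotopy_lifting (E B : sset) (p : pmap E B) : Prop :=
  forall (V : sset) (G : pgraph (prodp V (simplex 1)) E) (v : pmap (prodp V (simplex 1)) B),
    (forall m x y, G m x y -> p m y = v m x) ->
    (forall m x, exists y, G m (x, cmap m ord0) y) ->
    (forall m x t, (exists y, G m (x, t) y) ->
       t = cmap m ord0 \/ forall t', exists y, G m (x, t') y) ->
    exists2 e : pmap (prodp V (simplex 1)) E, (forall m x, p m (e m x) = v m x) &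
      forall m x y, G m x y -> y = e m x.

Lemma trivial_fibration_weq (E B : sset) (p : pmap E B) : trivial_fibration p -> weq p.
Proof.
move=> ptf; have [//|s ps _] := ptf B (empty_graph B E) (idp B).
pose R m (x : prodp E (simplex 1) m) (y : E m) :=
  (x.2 = cmap m ord0 /\ y = s m (p m x.1)) \/ (x.2 = cmap m ord_max /\ y = x.1).
have Rres (c d : Delta) (a : hom c d) x y : R d x y ->
    R c (res (prodp E (simplex 1)) a x) (res E a y).
  by case=> [[x2 ->]|[x2 ->]]; [left|right]; rewrite (snd_cmap _ x2) -?app_nat.
have Rfun c x y y' : R c x y -> R c x y' -> y = y'.
  by case=> [[x2 ->]|[x2 ->]] [[x2' ->]|[x2' ->]] //;
    move: x2'; rewrite x2 => E'; [case: (cmap01 E')|case: (cmap10 E')].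
have [m x y|H _ HP] := ptf _ (PGraph Rres Rfun) (liftpr p).
  by case=> [[_ ->]|[_ ->]] //; rewrite ps.
apply: (weq_homotopy_inverse (g := s)); left.
  by exists H => m x; split; symmetry; apply: HP; [left|right].
have -> : pcomp p s = idp B by apply: pmap_eq => m x; exact: ps.
exact: homotopic_refl.
Qed.

Program Definition at_end (V E : sset) (i : 'I_2) (e : pmap (prodp V (simplex 1)) E) : pmap V E :=
  {| app := fun m x => e m (x, cmap m i) |}.
Next Obligation.
by move=> V E i e m n a x /=; rewrite -app_nat; congr (e _ (_, _)); apply: Delta_eq.
Qed.

Section WhiteheadFibration.
Variables (E B : sset) (p : pmap E B).
Hypotheses (Ekan : kan E) (Bkan : kan B) (plift : homotopy_lifting p) (pW : weq p).

(** Being Kan, [E] and [B] are themselves test objects for [weq], so [p] has a homotopy inverse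
    [psi]. Lifting the homotopy from [pcomp p psi] to the identity, with start [psi], moves [psi] to
    a strict section. *)
Lemma fibration_section : exists2 s : pmap B E,
  (forall m x, p m (s m x) = x) & homotopic (pcomp s p) (idp E).
Proof.
have [/(_ (idp E))[psi psip] _] := pW Ekan.
have [_ /(_ (pcomp p psi) (idp B))[|H HP]] := pW Bkan.
  by rewrite -pcompA; apply: (homotopic_postcomp p psip).
pose R m (x : prodp B (simplex 1) m) (y : E m) := x.2 = cmap m ord0 /\ y = psi m x.1.
have Rres (c d : Delta) (a : hom c d) x y : R d x y ->
    R c (res (prodp B (simplex 1)) a x) (res E a y).
  by case=> [x2 ->]; rewrite -app_nat /R (snd_cmap _ x2).
have Rfun c x y y' : R c x y -> R c x y' -> y = y' by move=> [_ ->] [_ ->].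
have [m [x t] y|m x|m x t [y [t0 _]]|e pe eP] := plift (G := PGraph Rres Rfun) (v := H).
- by case=> /= -> ->; have [] := HP m x.
- by exists (psi m x).
- by left.
exists (at_end ord_max e) => [m x|]; first by rewrite /= pe; have [] := HP m x.
have psis : homotopic psi (at_end ord_max e).
  by exists e => m x; split=> //; symmetry; apply: eP.
exact (homotopic_trans Ekan (homotopic_sym Ekan (homotopic_precomp p psis)) psip).
Qed.

(* A homotopy k from s p to the identity is made fibrewise by lifting, against p, the
   square whose left and right sides are s p k and k and whose projection is constant
   in the first direction. *)
Lemma fibration_fibrewise_section : exists (s : pmap B E) (k : pmap (prodp E (simplex 1)) E),
  [/\ forall m x, p m (s m x) = x,
      forall m x, k m (x, cmap m ord0) = s m (p m x),
      forall m x, k m (x, cmap m ord_max) = x &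
      forall m x, p m (k m x) = p m x.1].
Proof.
have [s ps [k kP]] := fibration_section.
have k0 m x : k m (x, cmap m ord0) = s m (p m x) by have [] := kP m x.
have k1 m x : k m (x, cmap m ord_max) = x by have [] := kP m x.
pose P := prodp E (simplex 1).
have kkN (c d : Delta) (a : hom c d) (z : prodp P (simplex 1) d) :
  k c ((res (prodp P (simplex 1)) a z).1.1, (res (prodp P (simplex 1)) a z).2) =
  res E a (k d (z.1.1, z.2)) by rewrite -app_nat.
pose kk := Pmap kkN.
pose R m (z : prodp P (simplex 1) m) (y : E m) :=
  [\/ z.2 = cmap m ord0 /\ y = s m (p m z.1.1),
      z.1.2 = cmap m ord0 /\ y = s m (p m (kk m z)) |
      z.1.2 = cmap m ord_max /\ y = kk m z].
have Rres (c d : Delta) (a : hom c d) x y : R d x y ->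
    R c (res (prodp P (simplex 1)) a x) (res E a y).
  case=> [[x2 ->]|[x2 ->]|[x2 ->]].
  - by constructor 1; rewrite -!app_nat (snd_cmap _ x2).
  - by constructor 2; rewrite -!app_nat -(snd_cmap a x2).
  - by constructor 3; rewrite -!app_nat -(snd_cmap a x2).
have Rfun c x y y' : R c x y -> R c x y' -> y = y'.
  case: x => [[x t] t'].
  case=> [[/= x2 ->]|[/= x2 ->]|[/= x2 ->]] [[/= x2' ->]|[/= x2' ->]|[/= x2' ->]] //;
    subst; rewrite ?k0 ?ps ?k1 //; try by case: (cmap01 x2').
  by case: (cmap10 x2').
have [m [[x t] t'] y|m x|m [x t] t' [y]|e pe eP] :=
  plift (G := PGraph Rres Rfun) (v := pcomp p kk).
- by case=> [[/= -> ->]|[/= _ ->]|[_ ->]] //; rewrite ?k0 !ps //= k0 ps.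
- by exists (s m (p m x.1)); constructor 1.
- case=> [[/= -> _]|[/= -> _]|[/= -> _]]; first by left.
    by right=> t''; exists (s m (p m (kk m ((x, cmap m ord0), t'')))); constructor 2.
  by right=> t''; exists (kk m ((x, cmap m ord_max), t'')); constructor 3.
exists s, (at_end ord_max e); split=> // m x /=.
- rewrite -(eP m ((x, cmap m ord0), cmap m ord_max) (s m (p m x))) //.
  by constructor 2; rewrite /= k1.
- by rewrite -(eP m ((x, cmap m ord_max), cmap m ord_max) x) //; constructor 3; rewrite /= k1.
- by rewrite pe /= k1.
Qed.

(** The lifting problem is deformed. At time 0 it is solved by [s] after [v]; over the domain of [G]
    the fibrewise homotopy [k] leads from this solution to the prescribed values. Lifting the
    constant homotopy at [v] gives a solution of the original problem at time 1. *)
Lemma weq_trivial_fibration : trivial_fibration p.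
Proof.
have [s [k [ps k0 k1 pk]]] := fibration_fibrewise_section.
move=> V G v Gv.
pose R m (x : prodp V (simplex 1) m) (y : E m) :=
  (x.2 = cmap m ord0 /\ y = s m (v m x.1)) \/ (exists2 z, G m x.1 z & y = k m (z, x.2)).
have Rres (c d : Delta) (a : hom c d) x y : R d x y ->
    R c (res (prodp V (simplex 1)) a x) (res E a y).
  case=> [[x2 ->]|[z xz ->]]; [left|right]; first by rewrite -!app_nat (snd_cmap _ x2).
  by exists (res E a z); [exact: graph_res | rewrite -app_nat].
have Rfun c x y y' : R c x y -> R c x y' -> y = y'.
  case: x => x t; case=> [[/= x2 ->]|[z /= xz ->]] [[/= x2' ->]|[z' /= xz' ->]] //.
  - by rewrite x2 k0 (Gv _ _ _ xz').
  - by rewrite x2' k0 (Gv _ _ _ xz).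
  - by rewrite (graph_fun xz xz').
have [m [x t] y|m x|m x t [y]|e pe eP] := plift (G := PGraph Rres Rfun) (v := liftpr v).
- by case=> [[_ ->]|[z xz ->]]; rewrite /= ?ps // pk (Gv _ _ _ xz).
- by exists (s m (v m x)); left.
- case=> [[/= -> _]|[z xz _]]; first by left.
  by right=> t'; exists (k m (z, t')); right; exists z.
exists (at_end ord_max e) => m x; first by rewrite /= pe.
by move=> y xy; rewrite -[y]k1; apply: eP; right; exists y.
Qed.

End WhiteheadFibration.

(** * Spaces of maps into an injectively fibrant presheaf *)

Definition deforms (Y : sset) (U : forall m, Y m -> Prop) : Prop :=
  exists (D : pmap (prodp Y (simplex 1)) Y) (i0 i1 : 'I_2),
    [/\ i0 != i1, forall m y, D m (y, cmap m i1) = y,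
        forall m y, U m (D m (y, cmap m i0)) &
        forall m y t, U m y -> U m (D m (y, t))].

Section Fibrant.
Variables (C : category) (F : spsh C).
Hypothesis Ffib : inj_fibrant F.

(** This is how injective fibrancy enters the study of mapping spaces: the lifting properties below
    all reduce to it by exhibiting, level by level, a deformation onto the domain of a partial map.
    These deformations need not be natural in [c]. *)
Lemma extend_graph (B : spsh C) (G : pgraph B F) :
  (forall c : C, @deforms (at_ c B) (fun m x => exists y, G (c, m) x y)) ->
  exists g : pmap B F, forall c x y, G c x y -> y = g c x.
Proof.
move=> GD; have [f fP] := dom_map G.
have [||g gf] := Ffib (j := dom_incl G) _ _ f.
- by move=> c; apply: dom_incl_inj.
- move=> c; have [D [i0 [i1 [i01 D1 D0 DU]]]] := GD c.
  apply: (weq_deformation_retract (D := D) i01).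
  + by move=> m; apply: dom_incl_inj.
  + exact: D1.
  + by move=> m y; exists (exist _ (D m (y, cmap m i0)) (D0 m y) : dom G (c, m)).
  + by move=> m [x xP] t; exists (exist _ (D m (x, t)) (DU m x t xP) : dom G (c, m)).
exists g => c x y xy.
have /= -> := pmap_app gf (exist _ x (ex_intro _ y xy) : dom G c).
exact: graph_fun xy (fP c (exist _ x (ex_intro _ y xy))).
Qed.

Program Definition mapping_map (A B : spsh C) (j : pmap A B) : pmap (mapping B F) (mapping A F) :=
  {| app := fun n phi => {| app := fun c x => phi c (j c x.1, x.2) |} |}.
Next Obligation. by move=> A B j n phi c d f x; rewrite -app_nat /= app_nat. Qed.
Next Obligation. by move=> A B j m n a phi; apply: pmap_eq. Qed.

Definition const (V : sset) : spsh C := pull (sndF C Delta) V.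

Section Lifting.
Variables (A B : spsh C) (j : pmap A B).
Hypothesis j_inj : forall c, injective (j c).

(** By adjunction, a lift is an extension to B x V of a map to [F] given on the union of A x V and B
    x U, with U the domain of [G]; the second hypothesis deforms B x V onto this union. *)
Lemma mapping_lift (V : sset) (G : pgraph V (mapping B F)) (v : pmap V (mapping A F)) :
  (forall m x y, G m x y -> mapping_map j m y = v m x) ->
  (forall c : C, @deforms (at_ c (prodp B (const V)))
    (fun m x => (exists a, j (c, m) a = x.1) \/ exists y, G m x.2 y)) ->
  exists2 e : pmap V (mapping B F), (forall m x, mapping_map j m (e m x) = v m x) &
    forall m x y, G m x y -> y = e m x.
Proof.
move=> Gv GD.
pose R (c : prodc C Delta) (x : prodp B (const V) c) (z : F c) :=
  (exists2 a, j c a = x.1 & z = v c.2 x.2 c (a, idm (c.2 : Delta))) \/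
  (exists2 y : mapping B F c.2, G c.2 x.2 y & z = y c (x.1, idm (c.2 : Delta))).
have vN (c d : prodc C Delta) (f : hom c d) x (a : A d) :
    res F f (v d.2 x d (a, idm (d.2 : Delta))) =
    v c.2 (res V f.2 x) c (res A f a, idm (c.2 : Delta)).
  by rewrite app_nat -app_nat; congr (v _ _ _ (_, _)); apply: Delta_eq.
have yN (c d : prodc C Delta) (f : hom c d) (y : mapping B F d.2) b :
    res F f (y d (b, idm (d.2 : Delta))) =
    res (mapping B F) f.2 y c (res B f b, idm (c.2 : Delta)).
  by rewrite -app_nat /=; congr (y _ (_, _)); apply: Delta_eq.
have Rres (c d : prodc C Delta) (f : hom c d) x y : R d x y ->
    R c (res (prodp B (const V)) f x) (res F f y).
  case=> [[a ja ->]|[y' xy' ->]]; [left|right].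
    by exists (res A f a); rewrite ?vN // app_nat ja.
  by exists (res (mapping B F) f.2 y'); [exact: graph_res | rewrite yN].
have Gvx (c : prodc C Delta) x y a : G c.2 x y ->
    v c.2 x c (a, idm (c.2 : Delta)) = y c (j c a, idm (c.2 : Delta)).
  by move=> xy; rewrite -(Gv _ _ _ xy).
have Rfun c x y y' : R c x y -> R c x y' -> y = y'.
  case=> [[a ja ->]|[z xz ->]] [[a' ja' ->]|[z' xz' ->]].
  - by rewrite (_ : a = a') //; apply: j_inj; rewrite ja.
  - by rewrite -ja; apply: Gvx.
  - by rewrite -ja'; symmetry; apply: Gvx.
  - by rewrite (graph_fun xz xz').
have domR c x : (exists y, R c x y) <-> (exists a, j c a = x.1) \/ exists y, G c.2 x.2 y.
  split=> [[y [[a ja _]|[y' xy' _]]]|[[a ja]|[y xy]]].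
  - by left; exists a.
  - by right; exists y'.
  - by exists (v c.2 x.2 c (a, idm (c.2 : Delta))); left; exists a.
  - by exists (y c (x.1, idm (c.2 : Delta))); right; exists y.
have [c|g gP] := extend_graph (G := PGraph Rres Rfun).
  have [D [i0 [i1 [i01 D1 D0 DU]]]] := GD c; exists D, i0, i1; split=> //.
    by move=> m y; apply/domR.
  by move=> m y t /domR yP; apply/domR/DU.
have eN m (x : V m) (c d : prodc C Delta) (f : hom c d)
    (b : prodp B (const (simplex m)) d) :
  g c ((res (prodp B (const (simplex m))) f b).1,
       res V (res (prodp B (const (simplex m))) f b).2 x) =
  res F f (g d (b.1, res V b.2 x)).
  by rewrite -app_nat; congr (g _ (_, _)); exact: (@res_comp _ V _ _ _ b.2 f.2 x).
pose e0 m x : mapping B F m := Pmap (eN m x).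
have e0N (m n : Delta) (a : hom m n) x : e0 m (res V a x) = res (mapping B F) a (e0 n x).
  by apply: pmap_eq => c [b t] /=; congr (g _ (_, _)); exact: esym (@res_comp _ V _ _ _ a t x).
exists (Pmap e0N) => m x.
  apply: pmap_eq => c [a t] /=; symmetry; apply: gP; left; exists a => //=.
  by rewrite app_nat /=; congr (v _ _ _ (_, _)); apply: Delta_eq.
move=> y xy; apply: pmap_eq => c [b t] /=; apply: gP; right.
exists (res (mapping B F) t y); first exact: graph_res.
by rewrite /=; congr (y _ (_, _)); apply: Delta_eq.
Qed.

Lemma mapping_homotopy_lifting : homotopy_lifting (mapping_map j).
Proof.
move=> V G v Gv G0 Gdom.
apply: mapping_lift Gv _ => c.
pose Y := at_ c (prodp B (const (prodp V (simplex 1)))).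
(* The minimum of two points of the interval: it is the identity for [t] at 1 and contracts the
   interval to 0 for [t] at 0. *)
pose andb m (s t : @hom Delta m 1) (i : 'I_m.+1) : 'I_2 :=
  if sval s i == ord0 then ord0 else sval t i.
have and_mono m (s t : @hom Delta m 1) (x y : 'I_m.+1) :
    (x <= y)%N -> (andb m s t x <= andb m s t y)%N.
  move=> xy; have := svalP s _ _ xy; have := svalP t _ _ xy; rewrite /andb.
  by case: (ord2P (sval s x)) => ->; case: (ord2P (sval s y)) => ->.
pose D0 m (z : prodp Y (simplex 1) m) : Y m :=
  (z.1.1, (z.1.2.1, exist _ (andb m z.1.2.2 z.2) (and_mono _ _ _))).
have D0N (m n : Delta) (a : hom m n) z :
    D0 m (res (prodp Y (simplex 1)) a z) = res Y a (D0 n z).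
  by congr (_, (_, _)); apply: Delta_eq.
exists (Pmap D0N), ord0, ord_max; split=> //.
- move=> m [b [x s]]; congr (_, (_, _)); apply: Delta_eq => i.
  by rewrite /= /andb; case: (ord2P (sval s i)) => ->.
- move=> m [b [x s]]; right; have [y xy] := G0 m x; exists y => /=.
  by congr (G m (_, _) y): xy; apply: Delta_eq => i; rewrite /= /andb; case: ifP.
- move=> m [b [x s]] t [[a ja]|]; [by left; exists a | right].
  case/Gdom: (b0) => [->|]; last exact.
  have [y xy] := G0 m x; exists y => /=.
  by congr (G m (_, _) y): xy; apply: Delta_eq => i; rewrite /= /andb.
Qed.

Lemma mapping_trivial_fibration :
  (forall c : C, @deforms (at_ c B) (fun m b => exists a, j (c, m) a = b)) ->
  trivial_fibration (mapping_map j).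
Proof.
move=> jD V G v Gv; apply: mapping_lift Gv _ => c.
have [D [i0 [i1 [i01 D1 D0 DU]]]] := jD c.
pose Y := at_ c (prodp B (const V)).
pose D' m (z : prodp Y (simplex 1) m) : Y m := (D m (z.1.1, z.2), z.1.2).
have D'N (m n : Delta) (a : hom m n) z :
    D' m (res (prodp Y (simplex 1)) a z) = res Y a (D' n z).
  by congr (_, _); exact: (app_nat D a (z.1.1, z.2)).
exists (Pmap D'N), i0, i1; split=> //.
- by move=> m [b x]; rewrite /= /D' D1.
- by move=> m [b x]; left; apply: D0.
- by move=> m [b x] t [ja|xy]; [left; apply: DU | right].
Qed.

End Lifting.

Lemma mapping_kan (B : spsh C) : kan (mapping B F).
Proof.
move=> n k h.
pose R m (a : simplex n.+1 m) (y : mapping B F m) :=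
  exists2 a' : horn k m, sval a' = a & y = h m a'.
have Rres (c d : Delta) (f : hom c d) x y : R d x y ->
    R c (res (simplex n.+1) f x) (res (mapping B F) f y).
  by case=> [a <- ->]; exists (res (horn k) f a); rewrite ?app_nat.
have Rfun c x y y' : R c x y -> R c x y' -> y = y'.
  by move=> [[a aP] /= <- ->] [[a' a'P] /= E ->]; congr (h _ _); apply/eq_exist.
(* The empty presheaf: the absolute extension problem becomes a lifting problem over the one-point
   space [mapping A F]. *)
pose A : spsh C := dom (empty_graph B F).
have noA c (a : A c) : False by case: a => a [].
have v0N n' c d f (x : prodp A (const (simplex n')) d) :
  False_rect (F c) (noA c (res (prodp A (const (simplex n'))) f x).1) =
  res F f (False_rect (F d) (noA d x.1)) by case: (noA _ x.1).
pose v0 n' : mapping A F n' := Pmap (v0N n').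
have vN (c d : Delta) (a : hom c d) (x : simplex n.+1 d) : v0 c = res (mapping A F) a (v0 d).
  by apply: pmap_eq => ? [z]; case: (noA _ z).
(* A deformation of the simplex onto the horn. Vertices move only to [k], so every missed vertex
   other than [k] stays missed. For k <= n it is truncation at [k] and ends in the face opposite to
   the last vertex; for k = n + 1 it ends at the constant [k], and monotonicity forces the opposite
   direction of time. *)
pose clip m (a : @hom Delta m n.+1) (t : @hom Delta m 1) (i : 'I_m.+1) : 'I_n.+2 :=
  if (k < n.+1)%N then
    if (sval t i == ord0) && (k < sval a i)%N then k else sval a i
  else if sval t i == ord0 then sval a i else k.
have clip_mono m a t (x y : 'I_m.+1) : (x <= y)%N -> (clip m a t x <= clip m a t y)%N.
  move=> xy; have := svalP a _ _ xy; have := svalP t _ _ xy; rewrite /clip.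
  have := ltn_ord (sval a x); have := ltn_ord (sval a y).
  by case: (ord2P (sval t x)) => ->; case: (ord2P (sval t y)) => -> //=;
    case: (ltnP k n.+1) => kn; do ?case: ifP; lia.
have [||c|e _ eP] := @mapping_lift A B (dom_incl _) _ _ (PGraph Rres Rfun)
    (@Pmap _ (simplex n.+1) _ (fun m x => v0 m) vN).
- exact: dom_incl_inj.
- by move=> m x y _; apply: pmap_eq => ? [z]; case: (noA _ z).
- pose Y := at_ c (prodp B (const (simplex n.+1))).
  pose D0 m (z : prodp Y (simplex 1) m) : Y m :=
    (z.1.1, exist _ (clip m z.1.2 z.2) (clip_mono _ _ _)).
  have D0N (m p : Delta) (a : hom m p) z :
      D0 m (res (prodp Y (simplex 1)) a z) = res Y a (D0 p z).
    by congr (_, _); apply: Delta_eq.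
  have inR m (a : @hom Delta m n.+1) i : i != k -> misses a i -> exists y, R m a y.
    move=> ik ai; pose a' : horn k m := exist _ a (ex_intro2 _ _ i ik ai).
    by exists (h m a'), a'.
  have RU m (a : @hom Delta m n.+1) t i :
      i != k -> misses a i -> misses (exist _ (clip m a t) (clip_mono m a t) : @hom Delta m n.+1) i.
    move=> ik ai x; by rewrite /= /clip; do ?case: ifP => _ //; rewrite eq_sym.
  exists (Pmap D0N), (if (k < n.+1)%N then ord0 else ord_max),
    (if (k < n.+1)%N then ord_max else ord0).
  split=> //; first by case: ifP.
  + move=> m [b a]; congr pair; apply: Delta_eq => x /=; rewrite /clip.
    by case: (ltnP k n.+1) => kn //=.
  + move=> m [b a]; right; case: (ltnP k n.+1) => kn.
    * apply: (inR _ _ ord_max) => [|x].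
        by rewrite -(inj_eq val_inj) /=; lia.
      rewrite /= /clip kn /=; case: ifP => [_|].
        by rewrite -(inj_eq val_inj) /=; lia.
      by rewrite -(inj_eq val_inj) /=; lia.
    * apply: (inR _ _ ord0) => [|x]; first by rewrite -(inj_eq val_inj) /=; lia.
      by rewrite /= /clip ltnNge kn /= -(inj_eq val_inj) /=; lia.
  + move=> m [b a] t [[z]|[y [[a' [i ik ai]] /= <- _]]]; first by case: (noA _ z).
    by right; apply: (inR _ _ i ik); apply: RU.
exists e => m a; symmetry; apply: eP; exists a => //.
Qed.

Lemma weq_mapping_trivial_fibration (A B : spsh C) (j : pmap A B) :
  (forall c, injective (j c)) -> weq (mapping_map j) -> trivial_fibration (mapping_map j).
Proof.
move=> j_inj; apply: weq_trivial_fibration; do ?exact: mapping_kan.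
exact: mapping_homotopy_lifting.
Qed.

End Fibrant.

(** * Subpresheaves and local inclusions *)

Section Subpresheaves.
Variables (C : category) (B : psh C).

Record sub := Sub {
  mem_sub :> forall c, B c -> Prop;
  mem_res : forall (c d : C) (f : hom c d) x, mem_sub x -> mem_sub (res B f x) }.

Lemma sub_eq (X Y : sub) : (forall c x, X c x <-> Y c x) -> X = Y.
Proof.
case: X Y => [X XP] [Y YP] /= XY.
have {}XY : X = Y.
  by apply: functional_extensionality_dep => c; apply/funext => x; apply/propext/XY.
by subst Y; congr Sub; exact: Prop_irrelevance.
Qed.

Program Definition subp (X : sub) : psh C :=
  {| sec := fun c => {x : B c | X c x};
     res := fun c d f x => exist _ (res B f (sval x)) (mem_res f (svalP x)) |}.
Next Obligation. by move=> X c [x xP]; apply/eq_exist; exact: res_id. Qed.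
Next Obligation. by move=> X c d e g f [x xP]; apply/eq_exist; exact: res_comp. Qed.

Definition sub_le (X Y : sub) := forall c x, X c x -> Y c x.

Program Definition sub_incl (X Y : sub) (XY : sub_le X Y) : pmap (subp X) (subp Y) :=
  {| app := fun c x => exist _ (sval x) (XY _ _ (svalP x)) |}.
Next Obligation. by move=> X Y XY c d f x; apply/eq_exist. Qed.

Lemma sub_incl_inj (X Y : sub) (XY : sub_le X Y) c : injective (sub_incl XY c).
Proof. by move=> [x xP] [y yP] [xy]; apply/eq_exist. Qed.

Program Definition subU (X Y : sub) : sub := {| mem_sub := fun c x => X c x \/ Y c x |}.
Next Obligation. by move=> X Y c d f x [?|?]; [left|right]; apply: mem_res. Qed.

Program Definition subI (X Y : sub) : sub := {| mem_sub := fun c x => X c x /\ Y c x |}.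
Next Obligation. by move=> X Y c d f x [? ?]; split; apply: mem_res. Qed.

Lemma sub_glue (X Y : sub) (V F : psh C) (f : pmap (prodp (subp X) V) F)
    (g : pmap (prodp (subp Y) V) F) :
  (forall c x (Xx : X c x) (Yx : Y c x) v, f c (exist _ x Xx, v) = g c (exist _ x Yx, v)) ->
  exists h : pmap (prodp (subp (subU X Y)) V) F,
    (forall c x (Xx : X c x) Ux v, h c (exist _ x Ux, v) = f c (exist _ x Xx, v)) /\
    (forall c x (Yx : Y c x) Ux v, h c (exist _ x Ux, v) = g c (exist _ x Yx, v)).
Proof.
move=> fg.
pose R (c : C) (x : prodp (subp (subU X Y)) V c) (z : F c) :=
  (exists Xx : X c (sval x.1), z = f c (exist _ _ Xx, x.2)) \/
  (exists Yx : Y c (sval x.1), z = g c (exist _ _ Yx, x.2)).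
have Rres (c d : C) (a : hom c d) x y : R d x y ->
    R c (res (prodp (subp (subU X Y)) V) a x) (res F a y).
  case=> -[Xx ->]; [left|right]; exists (mem_res a Xx).
    by rewrite -(app_nat f a (exist _ _ Xx, x.2)); congr (f _ (_, _)); apply/eq_exist.
  by rewrite -(app_nat g a (exist _ _ Xx, x.2)); congr (g _ (_, _)); apply/eq_exist.
have Rfun c x y y' : R c x y -> R c x y' -> y = y'.
  case=> -[Xx ->] [] [Xx' ->].
  - by rewrite (Prop_irrelevance Xx Xx').
  - exact: fg.
  - by symmetry; exact: fg.
  - by rewrite (Prop_irrelevance Xx Xx').
have [c [[x [Xx|Yx]] v]|h hP] := graph_total (G := PGraph Rres Rfun).
- by exists (f c (exist _ x Xx, v)); left; exists Xx.
- by exists (g c (exist _ x Yx, v)); right; exists Yx.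
exists h; split=> c x p Ux v.
- exact: Rfun _ _ _ _ (hP c (exist _ x Ux, v)) (or_introl (ex_intro _ p erefl)).
- exact: Rfun _ _ _ _ (hP c (exist _ x Ux, v)) (or_intror (ex_intro _ p erefl)).
Qed.

End Subpresheaves.

Section Local.
Variables (C : category) (F : spsh C) (B : spsh C).
Hypothesis Ffib : inj_fibrant F.
Implicit Types X Y Z : sub B.

Notation M := (mapping_map F).

Definition local X Y : Prop := exists XY : sub_le X Y, weq (M (sub_incl XY)).

Lemma local_refl X : local X X.
Proof.
exists (fun _ _ => id).
by apply: weq_bij => m; exists id => phi; apply: pmap_eq => c [[x xP] t] /=;
  congr (phi c (_, _)); apply/eq_exist.
Qed.

Lemma mapping_incl_comp X Y Z (XY : sub_le X Y) (YZ : sub_le Y Z) (XZ : sub_le X Z) :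
  M (sub_incl XZ) = pcomp (M (sub_incl XY)) (M (sub_incl YZ)).
Proof.
by apply: pmap_eq => m phi; apply: pmap_eq => c [x t] /=; congr (phi c (_, _)); apply/eq_exist.
Qed.

Lemma local_trans X Y Z : local X Y -> local Y Z -> local X Z.
Proof.
move=> [XY XYW] [YZ YZW]; have XZ : sub_le X Z by move=> c x /XY/YZ.
by exists XZ; rewrite (mapping_incl_comp XY YZ); apply: weq_comp.
Qed.

Lemma local_cancel X Y Z : sub_le Y Z -> local X Y -> local X Z -> local Y Z.
Proof.
move=> YZ [XY XYW] [XZ XZW]; exists YZ.
by apply: weq_cancel_r XYW _; rewrite -(mapping_incl_comp XY YZ XZ).
Qed.

(** Maps to [F] turn the union into a fibre product, so restriction from the union to [X] is a base
    change of restriction from [Z] to the intersection. The latter is first promoted from a weak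
    equivalence to a trivial fibration, a property that base change preserves. *)
Lemma local_pushout X Z : local (subI X Z) Z -> local X (subU X Z).
Proof.
move=> [IZ IZW]; have XU : sub_le X (subU X Z) by move=> c x; left.
have ZU : sub_le Z (subU X Z) by move=> c x; right.
have IX : sub_le (subI X Z) X by move=> c x [].
exists XU; apply: trivial_fibration_weq => V G v Gv.
pose R m x z := exists2 y, G m x y & z = M (sub_incl ZU) m y.
have Rres (c d : Delta) (a : hom c d) x y : R d x y ->
    R c (res V a x) (res (mapping (subp Z) F) a y).
  move=> [y' xy ->]; exists (res (mapping (subp (subU X Z)) F) a y'); first exact: graph_res.
  by rewrite -app_nat.
have Rfun c x y y' : R c x y -> R c x y' -> y = y'.
  by move=> [z xz ->] [z' xz' ->]; rewrite (graph_fun xz xz').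
have /(_ _ (PGraph Rres Rfun) (pcomp (M (sub_incl IX)) v))[m x y [z xz ->]|e eP Re] :=
  weq_mapping_trivial_fibration Ffib (sub_incl_inj (XY := IZ)) IZW.
  rewrite /= -(Gv _ _ _ xz); apply: pmap_eq => c [[b bP] t] /=.
  by congr (z c (_, _)); apply/eq_exist.
have agree m x c b (Xb : X c b) (Zb : Z c b) t :
    v m x c (exist _ b Xb, t) = e m x c (exist _ b Zb, t).
  have := pmap_app (eP m x) (exist _ b (conj Xb Zb), t) => /= E.
  etransitivity; last (etransitivity; first exact: (esym E)).
  - by congr (v m x c (_, _)); apply/eq_exist.
  - by congr (e m x c (_, _)); apply/eq_exist.
have glue m x := cid (sub_glue (agree m x)).
pose g m x : mapping (subp (subU X Z)) F m := projT1 (glue m x).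
have gX m x c b (Xb : X c b) Ub t : g m x c (exist _ b Ub, t) = v m x c (exist _ b Xb, t).
  exact: (projT2 (glue m x)).1.
have gZ m x c b (Zb : Z c b) Ub t : g m x c (exist _ b Ub, t) = e m x c (exist _ b Zb, t).
  exact: (projT2 (glue m x)).2.
have gN (c d : Delta) (a : hom c d) x :
    g c (res V a x) = res (mapping (subp (subU X Z)) F) a (g d x).
  apply: pmap_eq => c' [[b Ub] t]; case: (Ub) => [Xb|Zb].
  - by rewrite gX app_nat [RHS]/= gX.
  - by rewrite gZ app_nat [RHS]/= gZ.
exists (Pmap gN) => m x.
  by apply: pmap_eq => c [[b Xb] t]; rewrite /= gX.
move=> y xy; apply: pmap_eq => c [[b Ub] t] /=; case: (Ub) => [Xb|Zb].
- rewrite gX -(Gv _ _ _ xy) /=; congr (y c (_, _)); exact/eq_exist.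
- by rewrite gZ -(Re m x (M (sub_incl ZU) m y)) /=; [congr (y c (_, _)); exact/eq_exist|exists y].
Qed.

End Local.

Section Codiscrete.
Variables (E : Type) (x0 : E).

Program Definition codiscrete : sset :=
  {| sec := fun m : Delta => 'I_m.+1 -> E; res := fun m n a x => fun i => x (sval a i) |}.

Variables (C : category) (F A : spsh C).

Program Definition codiscrete_proj : pmap (prodp A (const C codiscrete)) A :=
  {| app := fun c x => x.1 |}.

Program Definition codiscrete_sect : pmap A (prodp A (const C codiscrete)) :=
  {| app := fun c x => (x, fun=> x0) |}.

(** The codiscrete simplicial set contracts to [x0] by moving to [x0] exactly the vertices at time
    0; precomposition with this contraction is the required homotopy. *)
Lemma weq_codiscrete_proj : weq (mapping_map F codiscrete_proj).
Proof.
apply: (@weq_homotopy_inverse _ _ _ (mapping_map F codiscrete_sect)); left.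
  suff -> : pcomp (mapping_map F codiscrete_sect) (mapping_map F codiscrete_proj) =
            idp (mapping A F) by exact: homotopic_refl.
  by apply: pmap_eq => m phi; apply: pmap_eq => c [x t].
pose AE := prodp A (const C codiscrete).
pose sel m (t : @hom Delta m 1) (x : 'I_m.+1 -> E) i := if sval t i == ord0 then x0 else x i.
have hN m (z : prodp (mapping AE F) (simplex 1) m) (c d : prodc C Delta) (f : hom c d)
    (y : prodp AE (const C (simplex m)) d) :
  let y' := res (prodp AE (const C (simplex m))) f y in
  z.1 c ((y'.1.1, sel c.2 (@ccomp Delta _ _ _ z.2 y'.2) y'.1.2), y'.2) =
  res F f (z.1 d ((y.1.1, sel d.2 (@ccomp Delta _ _ _ z.2 y.2) y.1.2), y.2)).
  by rewrite -app_nat.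
pose h m z : mapping AE F m := Pmap (hN m z).
have hhN (m n : Delta) (a : hom m n) z :
    h m (res (prodp (mapping AE F) (simplex 1)) a z) = res (mapping AE F) a (h n z).
  by apply: pmap_eq.
exists (Pmap hhN) => m phi; split; apply: pmap_eq => c [[y x] t] /=;
  by congr (phi c ((_, _), _)); apply/funext.
Qed.

End Codiscrete.

Import Order.TTheory.
Local Open Scope order_scope.

(** * Maps of trees and their images *)

Section OmegaMaps.

Lemma free_op_antichain (T : tree) (s : seq T) e :
  free_op s e -> {in s &, forall x y, x <= y -> x = y}.
Proof.
elim=> {s e} [e x y|e s _ sP IH x y|s t e st _ IH x y].
- by rewrite !inE => /eqP -> /eqP ->.
- case/flatten_mapP => c; rewrite mem_enum => ce xc.
  case/flatten_mapP => c'; rewrite mem_enum => c'e yc' xy.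
  have cc' : c = c'.
    apply: (inputs_inj ce c'e _ (free_op_le (sP _ c'e) yc')).
    exact: le_trans (free_op_le (sP _ ce) xc) xy.
  by subst c'; apply: (IH c ce).
- by rewrite -!(perm_mem st); apply: IH.
Qed.

(** In a closed tree a branch that carries no element of [s] can be capped by operations without
    inputs. Hence only distinctness, incomparability and position above [e] constrain the inputs. *)
Lemma antichain_free_op (T : tree) (s : seq T) e : is_closed T ->
  uniq s -> (forall x, x \in s -> e <= x) -> {in s &, forall x y, x <= y -> x = y} ->
  free_op s e.
Proof.
move=> cT; elim/(closed_ind): e s => e IH s us es anti.
have [e_s|e_s] := boolP (e \in s).
  suff -> : s = [:: e] by apply: free_id.
  have se x : x \in s -> x = e by move=> xs; rewrite (anti e x) // es.
  case: s us {es anti} e_s se => // x [|y s] /= us _ se; first by rewrite (se x) ?mem_head.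
  have xe : x = e by apply: se; exact: mem_head.
  have ye : y = e by apply: se; rewrite !inE eqxx orbT.
  by move: us; rewrite xe ye inE eqxx.
pose sub c := [seq x <- s | c <= x].
have subP : free_op (flatten [seq sub c | c <- enum (inputs e)]) e.
  apply: free_graft => [|c ce]; first by rewrite cT inE.
  apply: IH => //; first exact: filter_uniq.
    by move=> x; rewrite mem_filter => /andP[].
  by move=> x y; rewrite !mem_filter => /andP[_ xs] /andP[_ ys]; apply: anti.
apply: (free_perm _ subP); apply: (uniq_perm (free_op_uniq subP) us) => x.
apply/flatten_mapP/idP => [[c _]|xs]; first by rewrite mem_filter => /andP[].
have [|c ce cx] := @inputs_ex T e x.
  by rewrite lt_neqAle es // andbT; apply: contraNneq e_s => ->.
by exists c; rewrite ?mem_enum // mem_filter cx.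
Qed.

(** The explicit description of maps of closed trees: the second clause is preservation of
    independence in contrapositive form. *)
Definition order_map (X T : tree) (f : X -> T) : Prop :=
  {homo f : x y / x <= y} /\ forall x y, f x <= f y -> x >=< y.

Lemma order_map_omega (X T : tree) (f : X -> T) : is_closed T -> order_map f ->
  forall s e, free_op s e -> free_op (map f s) (f e).
Proof.
move=> cT [fmono fcomp] s e se; have us := free_op_uniq se; have sa := free_op_antichain se.
have finj : {in s &, injective f}.
  move=> x y xs ys fxy; have := fcomp x y; rewrite fxy lexx => /(_ isT).
  by case/orP => [/sa|/sa]; [exact|move->].
apply: antichain_free_op => //; first by rewrite map_inj_in_uniq.
  by move=> _ /mapP[x xs ->]; apply/fmono/(free_op_le se).
move=> _ _ /mapP[x xs ->] /mapP[y ys ->] fxy.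
case/orP: (fcomp x y fxy) => [xy|yx]; first by rewrite (sa x y).
by rewrite (sa y x).
Qed.

Definition order_hom (X T : tree) (cT : is_closed T) (f : X -> T) (fP : order_map f) :
  @hom Omega X T := exist _ f (order_map_omega cT fP).

(** A relation between edges of a closed tree is a unary operation, and two incomparable edges are
    the inputs of a binary operation to the root. Images of these operations yield monotonicity and
    independence. *)
Lemma hom_order_map (X T : tree) (f : @hom Omega X T) : is_closed X -> order_map (sval f).
Proof.
move=> cX; split=> [x y xy|x y fxy].
  apply: (@free_op_le _ [:: sval f y] (sval f x)); last exact: mem_head.
  exact: (svalP f _ _ (closed_free_op_le cX xy (free_id y))).
have [r rP] := tree_rooted X.
apply: contrapT => /negP; rewrite /Order.comparable negb_or => /andP[xy yx].
have /(svalP f) fop : free_op [:: x; y] r.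
  apply: antichain_free_op => //=.
  - by rewrite inE andbT; apply: contraNneq xy => ->.
  - move=> z w; rewrite !inE => /orP[]/eqP-> /orP[]/eqP->; rewrite ?(negPf xy) ?(negPf yx) //.
have := free_op_uniq fop; rewrite /= inE andbT => /eqP[].
by apply: (free_op_antichain fop _ _ fxy); rewrite !inE eqxx ?orbT.
Qed.

Lemma omega_eq (X T : tree) (f g : @hom Omega X T) : sval f =1 sval g -> f = g.
Proof. by case: f g => [f fP] [g gP] /= fg; apply/eq_exist/funext. Qed.

End OmegaMaps.

Lemma card_le_lt (T : tree) (x y : T) : x < y ->
  (#|[set z : T | (z <= x)%O]| < #|[set z : T | (z <= y)%O]|)%N.
Proof.
move=> xy; apply/proper_card/properP; split.
  by apply/subsetP => z; rewrite !inE => zx; apply: le_trans zx (ltW xy).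
by exists y; rewrite !inE ?lexx // lt_geF.
Qed.

(** * Admissible subsets *)

Section Admissible.
Variable T : tree.
Implicit Types (A : {set T}) (a c e x y : T).

Definition rooted A : Prop := exists2 r, r \in A & forall x, x \in A -> r <= x.

Definition covers A a : {set T} :=
  [set c in A | (a < c) && [forall y in A, (a < y) ==> (y <= c) ==> (y == c)]].

Definition star_of A a : {set T} := a |: covers A a.

Lemma coversP A a c : reflect
  [/\ c \in A, a < c & forall y, y \in A -> a < y -> y <= c -> y = c] (c \in covers A a).
Proof.
rewrite inE; apply: (iffP and3P) => -[cA ac cmin]; split=> //.
  move=> y yA ay yc; move/forallP: cmin => /(_ y); rewrite yA ay yc; exact/eqP.
apply/forallP => y; apply/implyP => yA; apply/implyP => ay; apply/implyP => yc.
by rewrite (cmin y).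
Qed.

Lemma covers_setT a : covers [set: T] a = inputs a.
Proof.
apply/setP => c; apply/coversP/idP => [[_ ac cmin]|].
  rewrite inE ac; apply/forallP => y; apply/implyP => ay; apply/implyP => yc.
  by rewrite (cmin y).
rewrite inE => /andP[ac /forallP cmin]; split=> // y _ ay yc.
by move: (cmin y); rewrite ay yc; apply/eqP.
Qed.

Lemma covers_ex A a y : y \in A -> a < y -> exists2 c, c \in covers A a & c <= y.
Proof.
move=> yA ay; pose P := [pred x : T | [&& x \in A, a < x & x <= y]].
have Py : P y by rewrite /= yA ay lexx.
case: (@arg_minnP _ y P (fun x => #|[set z : T | z <= x]|) Py).
move=> c /and3P[cA ac cy] cmin; exists c => //; apply/coversP; split=> // z zA az zc.
apply/eqP; apply: contraT => zNc.
have /cmin : P z by rewrite /= zA az (le_trans zc cy).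
by rewrite leqNgt card_le_lt // lt_neqAle zNc.
Qed.

Variable k : option nat.

Definition admissible A : Prop :=
  rooted A /\ forall a, a \in A -> le_oo (Some #|covers A a|) k.

Lemma le_oo_nat m n : (m <= n)%N -> le_oo (Some n) k -> le_oo (Some m) k.
Proof. by move=> mn; apply: le_oo_trans. Qed.

Definition image_of (S : tree) (f : @hom Omega S T) : {set T} := [set sval f x | x in S].

(** The fibre of [f] over an edge [a] is a chain. If [s] is its top, each cover of [a] in the image
    is the image of an input of [s], so its valence is bounded by that of [s]. *)
Lemma image_admissible (S : tree) (f : @hom Omega S T) :
  closed_dendroidal k S -> admissible (image_of f).
Proof.
move=> [cS dS]; have [fmono fcomp] := hom_order_map f cS; split.
  have [r rP] := tree_rooted S; exists (sval f r); first exact: imset_f.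
  by move=> _ /imsetP[x _ ->]; apply: fmono.
move=> a /imsetP[s0 _ as0].
pose P := [pred s : S | sval f s == a]; have Ps0 : P s0 by rewrite /= as0.
case: (@arg_maxnP _ s0 P (fun s => #|[set z : S | z <= s]|) Ps0) => s /eqP fs smax.
apply: le_oo_nat (dS s).
apply: leq_trans (leq_imset_card (sval f) (inputs s)).
apply/subset_leq_card/subsetP => c /coversP[/imsetP[x _ cE] ac cmin].
have sx : s < x.
  have : s >=< x by apply: fcomp; rewrite fs -cE ltW.
  rewrite lt_neqAle /Order.comparable; case: eqP => [sx|_ /orP[//|/fmono]].
    by move: ac; rewrite cE -sx fs ltxx.
  by rewrite fs -cE lt_geF.
have [c' c's c'x] := inputs_ex sx; apply/imsetP; exists c' => //.
apply/esym/cmin; rewrite ?cE; [exact: imset_f| |exact: fmono].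
rewrite lt_neqAle -{2}fs fmono ?ltW ?inputs_lt // andbT; apply/eqP => ac'.
have /smax le : P c' by rewrite /= -ac'.
by have := card_le_lt (inputs_lt c's); rewrite ltnNge => /negP[].
Qed.

End Admissible.

(** * Families of subsets of a tree *)

Section Families.
Variables (k : option nat) (T : tree).

(* The restriction to OmegaC k of the presheaf represented by T. *)
Program Definition rep : spsh (OmegaC k) :=
  {| sec := fun c : prodc (OmegaC k) Delta => @hom Omega (sval c.1) T;
     res := fun c d f g => @ccomp Omega _ _ _ g f.1 |}.
Next Obligation. by move=> c g; exact: omega_eq. Qed.
Next Obligation. by move=> c d e g f h; exact: omega_eq. Qed.

Implicit Types (A Y Z : {set T}) (Q X : {set {set T}}).

Definition covered Q Y := [exists A in Q, Y \subset A].

Lemma coveredP Q Y : reflect (exists2 A, A \in Q & Y \subset A) (covered Q Y).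
Proof. exact: exists_inP. Qed.

Lemma image_of_comp (S S' : tree) (f : @hom Omega S T) (g : @hom Omega S' S) :
  image_of (@ccomp Omega _ _ _ f g) \subset image_of f.
Proof. by apply/subsetP => _ /imsetP[x _ ->]; exact: imset_f. Qed.

Program Definition fam Q : sub rep :=
  {| mem_sub := fun c f => covered Q (image_of f) |}.
Next Obligation.
move=> Q c d f g /coveredP[A AQ gA]; apply/coveredP; exists A => //.
exact: subset_trans (image_of_comp _ _) gA.
Qed.

(** Only admissible subsets are images, so families may differ on the others. This is where the
    bound [k] enters the combinatorics. *)
Lemma fam_eq Q Q' : (forall Y, admissible k Y -> covered Q Y = covered Q' Y) -> fam Q = fam Q'.
Proof.
move=> QQ'; apply: sub_eq => c f /=; rewrite QQ' //.
exact: image_admissible (svalP c.1).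
Qed.

Lemma fam_le Q Q' : (forall Y, covered Q Y -> covered Q' Y) -> sub_le (fam Q) (fam Q').
Proof. by move=> QQ' c f; apply: QQ'. Qed.

Definition downclosed X := forall Y Z, Y \in X -> Z \subset Y -> Z \in X.

Lemma covered_downclosed X Y : downclosed X -> covered X Y = (Y \in X).
Proof.
move=> Xd; apply/coveredP/idP => [[A AX YA]|YX]; first exact: Xd AX YA.
by exists Y.
Qed.

Lemma covered1 A Y : covered [set A] Y = (Y \subset A).
Proof.
apply/coveredP/idP => [[B /set1P -> //]|YA].
by exists A; rewrite ?set11.
Qed.

Lemma powerset_downclosed A : downclosed (powerset A).
Proof. by move=> Y Z; rewrite !powersetE => YA /subset_trans; apply. Qed.

Definition stars A : {set {set T}} := [set star_of A a | a in A].

Section EdgeSplitting.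
Variables (A : {set T}) (e : T).
Hypothesis eA : e \in A.

Definition below_edge := A :\: [set x | e < x].
Definition above_edge := A :&: [set x | e <= x].
Let A1 := below_edge.
Let A2 := above_edge.

Lemma below_edgeP x : reflect (x \in A /\ ~~ (e < x)) (x \in A1).
Proof. by rewrite !inE andbC; apply: andP. Qed.

Lemma above_edgeP x : reflect (x \in A /\ e <= x) (x \in A2).
Proof. by rewrite !inE; apply: andP. Qed.

Lemma covers_below a : a \in A1 -> a != e -> covers A a = covers A1 a.
Proof.
move=> /below_edgeP[aA ea] ae; apply/setP => c.
apply/coversP/coversP => [[cA ac cmin]|[/below_edgeP[cA ec] ac cmin]]; split=> //.
- apply/below_edgeP; split=> //; apply/negP => ec; suff ce : e = c by rewrite ce ltxx in ec.
  apply: cmin; rewrite // ?(ltW ec) // lt_neqAle ae /=.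
  by case/orP: (tree_linear (ltW ac) (ltW ec)) => // ea'; rewrite lt_neqAle eq_sym ae ea' in ea.
- by move=> y /below_edgeP[yA _]; apply: cmin.
- move=> y yA ay yc; apply: cmin => //; apply/below_edgeP; split=> //.
  by apply: contra ec => /lt_le_trans; apply.
Qed.

Lemma covers_above a : a \in A2 -> covers A a = covers A2 a.
Proof.
move=> /above_edgeP[aA ea]; apply/setP => c.
apply/coversP/coversP => [[cA ac cmin]|[/above_edgeP[cA ec] ac cmin]]; split=> //.
- by apply/above_edgeP; split=> //; apply: le_trans ea (ltW ac).
- by move=> y /above_edgeP[yA _]; apply: cmin.
- move=> y yA ay yc; apply: cmin => //; apply/above_edgeP; split=> //.
  exact: le_trans ea (ltW ay).
Qed.

Lemma mem_below_edge : e \in A1. Proof. by apply/below_edgeP; rewrite ltxx. Qed.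
Lemma mem_above_edge : e \in A2. Proof. by apply/above_edgeP. Qed.

Lemma star_below_e : star_of A1 e = [set e].
Proof.
apply/setP => c; rewrite !in_setU1 in_set1; case: eqP => //= _.
by apply/negP => /coversP[/below_edgeP[_ /negPf ->]].
Qed.

Lemma star_sub (B : {set T}) a : a \in B -> star_of B a \subset B.
Proof. by move=> aB; apply/subsetP => x /setU1P[->//|/coversP[]]. Qed.

Lemma below_above Y : Y \subset A1 -> Y \subset A2 -> Y \subset [set e].
Proof.
move=> /subsetP Y1 /subsetP Y2; apply/subsetP => y yY; rewrite inE.
have /below_edgeP[_ ey] := Y1 _ yY; have /above_edgeP[_ ey'] := Y2 _ yY.
by rewrite lt_neqAle ey' andbT negbK in ey; rewrite eq_sym.
Qed.

Lemma covered_stars (B : {set T}) Y :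
  reflect (exists2 a, a \in B & Y \subset star_of B a) (covered (stars B) Y).
Proof.
apply: (iffP (coveredP _ _)) => [[_ /imsetP[a aB ->] Ya]|[a aB Ya]]; first by exists a.
by exists (star_of B a) => //; apply: imset_f.
Qed.

Lemma below_or_above a : a \in A -> (a \in A1 /\ a != e) \/ a \in A2.
Proof.
move=> aA; have [ea|ea] := boolP (e <= a); first by right; apply/above_edgeP.
left; split; first by apply/below_edgeP; split=> //; apply: contra ea => /ltW.
by apply: contra ea => /eqP ->.
Qed.

Lemma stars_below Y : covered (stars A) Y -> Y \subset A1 -> covered (stars A1) Y.
Proof.
move=> /covered_stars[a /below_or_above[[a1 ae]|a2] Ya] Y1; apply/covered_stars.
  by exists a => //; rewrite /star_of -covers_below.
exists e; rewrite ?mem_below_edge // star_below_e; apply: below_above Y1 _.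
by apply: subset_trans Ya _; rewrite /star_of covers_above //; apply: star_sub.
Qed.

Lemma stars_above Y : covered (stars A) Y -> Y \subset A2 -> covered (stars A2) Y.
Proof.
move=> /covered_stars[a /below_or_above[[a1 ae]|a2] Ya] Y2; apply/covered_stars.
  exists e; rewrite ?mem_above_edge //; apply: subset_trans (_ : [set e] \subset _).
    apply: below_above Y2; apply: subset_trans Ya _.
    by rewrite /star_of covers_below //; apply: star_sub.
  by rewrite sub1set setU11.
by exists a => //; rewrite /star_of -covers_above.
Qed.

Lemma above_stars Y : covered (stars A2) Y -> covered (stars A) Y.
Proof.
move=> /covered_stars[a a2 Ya]; apply/covered_stars; have /above_edgeP[aA _] := a2.
by exists a => //; rewrite /star_of covers_above.
Qed.

Lemma edge_stars Y : Y \subset [set e] -> covered (stars A2) Y.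
Proof.
move=> Ye; apply/covered_stars; exists e; first exact: mem_above_edge.
by apply: subset_trans Ye _; rewrite sub1set setU11.
Qed.

Lemma below_stars Y : covered (stars A1) Y -> covered (stars A) Y.
Proof.
move=> /covered_stars[a a1]; have [->|ae Ya] := eqVneq a e.
  by rewrite star_below_e => /edge_stars/above_stars.
apply/covered_stars; have /below_edgeP[aA _] := a1.
by exists a => //; rewrite /star_of covers_below.
Qed.

Lemma stars_below_above Y : covered (stars A) Y -> (Y \subset A1) || (Y \subset A2).
Proof.
move=> /covered_stars[a /below_or_above[[a1 ae]|a2] Ya].
  rewrite (subset_trans Ya) //; rewrite /star_of covers_below //; exact: star_sub.
by rewrite orbC (subset_trans Ya) //; rewrite /star_of covers_above //; apply: star_sub.
Qed.

Lemma covered2 Y : covered [set A1; A2] Y = (Y \subset A1) || (Y \subset A2).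
Proof.
apply/coveredP/orP => [[B /set2P[]-> YB]|[YB|YB]]; [by left|by right| |].
- by exists A1; rewrite ?set21.
- by exists A2; rewrite ?set22.
Qed.

Variable F : spsh (OmegaC k).
Hypothesis Ffib : inj_fibrant F.

(** The stars of [A] that meet the lower part give the stars of that part, which is attached along
    them. The upper part is attached next, again along its own stars, since the two parts have only
    [e] in common. *)
Lemma local_split : local F (fam (stars A1)) (fam [set A1]) ->
  local F (fam (stars A2)) (fam [set A2]) -> local F (fam (stars A)) (fam [set A1; A2]).
Proof.
move=> L1 L2.
have E1 : subI (fam (stars A)) (fam [set A1]) = fam (stars A1).
  apply: sub_eq => c f /=; rewrite covered1; split=> [[]|Y1]; first exact: stars_below.
  split; first exact: below_stars.
  by case/covered_stars: Y1 => a aA1 /subset_trans; apply; apply: star_sub.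
have E2 : subI (subU (fam (stars A)) (fam [set A1])) (fam [set A2]) = fam (stars A2).
  apply: sub_eq => c f /=; rewrite !covered1; split=> [[[|Y1]]|Y2].
  - exact: stars_above.
  - by move=> Y2; apply/edge_stars/below_above.
  - split; first by left; apply: above_stars.
    by case/covered_stars: Y2 => a aA2 /subset_trans; apply; apply: star_sub.
have E3 : subU (subU (fam (stars A)) (fam [set A1])) (fam [set A2]) = fam [set A1; A2].
  apply: sub_eq => c f /=; rewrite covered2 !covered1.
  split=> [[[/stars_below_above //|->//]|->]|/orP[Y1|Y2]]; rewrite ?orbT //; tauto.
rewrite -E3; apply: (local_trans (Y := subU (fam (stars A)) (fam [set A1]))).
  by apply: (local_pushout Ffib); rewrite E1.
by apply: (local_pushout Ffib); rewrite E2.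
Qed.

End EdgeSplitting.

(** * Filtration by inner horns at a fixed edge *)

Section Reduction.
Variable e : T.

(** For [Y] in a set [A] containing [e]: not contained in either part of [A]. The condition mentions
    [e] alone, so that it serves for all the sets [A] of the filtration. *)
Definition nonbase Y : bool := [exists x in Y, ~~ (e <= x)] && [exists y in Y, e < y].

Lemma nonbaseP Y : reflect ((exists2 x, x \in Y & ~~ (e <= x)) /\ exists2 y, y \in Y & e < y)
  (nonbase Y).
Proof. by apply: (iffP andP) => -[/exists_inP ? /exists_inP ?]. Qed.

Lemma nonbase_sub Y Z : Y \subset Z -> nonbase Y -> nonbase Z.
Proof.
move=> /subsetP YZ /nonbaseP[[x xY ex] [y yY ey]]; apply/nonbaseP.
by split; [exists x|exists y] => //; apply: YZ.
Qed.

Lemma nonbaseD1 Y : nonbase Y -> nonbase (Y :\ e).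
Proof.
move=> /nonbaseP[[x xY ex] [y yY ey]]; apply/nonbaseP; split; [exists x|exists y] => //.
  by rewrite !inE xY andbT; apply: contraNneq ex => ->.
by rewrite !inE yY andbT; apply: contraTneq ey => ->; rewrite ltxx.
Qed.

Lemma nonbase_split A Y : e \in A -> Y \subset A ->
  ~~ nonbase Y = covered [set below_edge A e; above_edge A e] Y.
Proof.
move=> eA /subsetP YA; rewrite covered2 negb_and orbC; congr orb.
  apply/exists_inPn/subsetP => YP x xY.
    by rewrite !inE (YA x xY) andbT; apply: YP.
  by have := YP x xY; rewrite !inE => /andP[].
apply/exists_inPn/subsetP => YP x xY.
  by rewrite !inE (YA x xY) /=; have := YP x xY; rewrite negbK.
by have := YP x xY; rewrite !inE negbK => /andP[].
Qed.

Definition bases X : {set {set T}} := [set Y in X | ~~ nonbase Y].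

Lemma in_bases X Y : (Y \in bases X) = (Y \in X) && ~~ nonbase Y.
Proof. by rewrite inE. Qed.

Lemma bases_downclosed X : downclosed X -> downclosed (bases X).
Proof.
move=> Xd Y Z; rewrite !inE => /andP[YX nY] ZY; rewrite (Xd Y) //=.
by apply: contra nY; apply: nonbase_sub.
Qed.

Lemma nonbase_rooted A r : nonbase A -> r \in A -> (forall x, x \in A -> r <= x) -> r < e.
Proof.
move=> /nonbaseP[[x xA ex] [y yA ey]] rA rP.
have rNe : r != e by apply: contraNneq ex => <-; apply: rP.
rewrite lt_neqAle rNe /=.
case/orP: (tree_linear (rP y yA) (ltW ey)) => // er.
by case/negP: ex; apply: le_trans er (rP x xA).
Qed.

Lemma admissible_below A : e \in A -> nonbase A -> admissible k A ->
  admissible k (below_edge A e).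
Proof.
move=> eA nA [[r rA rP] Ak]; have re := nonbase_rooted nA rA rP; split.
  exists r; first by apply/below_edgeP; split=> //; rewrite lt_gtF.
  by move=> x /below_edgeP[xA _]; apply: rP.
move=> a a1; have /below_edgeP[aA ea] := a1; have [->|ae] := eqVneq a e.
  apply: le_oo_nat (Ak e eA); apply: subset_leq_card.
  by apply/subsetP => c /coversP[/below_edgeP[_ /negPf ->]].
by rewrite -covers_below //; apply: Ak.
Qed.

Lemma admissible_above A : e \in A -> admissible k A -> admissible k (above_edge A e).
Proof.
move=> eA [_ Ak]; split.
  by exists e => [|x /above_edgeP[]]; first exact: mem_above_edge.
by move=> a a2; have /above_edgeP[aA _] := a2; rewrite -covers_above //; apply: Ak.
Qed.

(** Deleting [e] merges its vertex into the one below, and no valence drops as long as something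
    lies above [e]. So a bound on the valences of [A :\ e] bounds those of [A]. *)
Lemma admissible_add A : e \in A -> nonbase A -> admissible k (A :\ e) -> admissible k A.
Proof.
move=> eA nA [[r rA' rP] Ak]; set A' := A :\ e in rA' rP Ak.
have nA' := nonbaseD1 nA; have re : r < e by apply: (nonbase_rooted nA').
have sub x : x \in A' -> x \in A by rewrite !inE => /andP[].
have inA' x : x \in A -> x != e -> x \in A' by rewrite !inE => -> ->.
split; first exists r; first exact: sub.
  by move=> x xA; have [->|xe] := eqVneq x e; [exact: ltW | apply/rP/inA'].
have [_ [y yA' ey]] := nonbaseP _ nA'.
move=> a aA; have [->|ae] := eqVneq a e.
  (* [p] is the element directly below [e]; the covers of [e] in [A] become covers of [p] in
     [A']. *)
  pose P := [pred p | (p \in A') && (p < e)]; have Pr : P r by rewrite /= rA'.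
  case: (@arg_maxnP _ r P (fun p => #|[set z : T | z <= p]|) Pr) => p /andP[pA' pe] pmax.
  apply: le_oo_nat (Ak p pA'); apply/subset_leq_card/subsetP => c /coversP[cA ec cmin].
  have cA' : c \in A' by apply: inA' => //; rewrite gt_eqF.
  apply/coversP; split=> // [|z zA' pz zc]; first exact: lt_trans ec.
  apply: cmin => //; first exact: sub.
  have zNe : z != e by move: zA'; rewrite !inE => /andP[].
  rewrite lt_neqAle eq_sym zNe /=; case/orP: (tree_linear zc (ltW ec)) => // ze.
  have /pmax le : P z by rewrite /= zA' lt_neqAle zNe ze.
  by have := card_le_lt pz; rewrite ltnNge => /negP[].
have aA' := inA' a aA ae; apply: le_oo_nat (Ak a aA').
have cov c : c \in covers A a -> c != e -> c \in covers A' a.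
  move=> /coversP[cA ac cmin] ce; apply/coversP; split=> //; first exact: inA'.
  by move=> z /sub zA; apply: cmin.
have [ecov|eNcov] := boolP (e \in covers A a); last first.
  apply/subset_leq_card/subsetP => c ca; apply: (cov c ca).
  by apply: contraNneq eNcov => <-.
(* Here [e] covers [a]. In [A'] the cover [e] is replaced by at least one cover [c] above it, which
   exists because of [y]; the remaining covers of [a] persist. *)
have /coversP[_ ae' emin] := ecov.
have [c cA'a cy] := covers_ex yA' (lt_trans ae' ey).
have cA : c \in A by case/coversP: cA'a => /sub.
have ec : e < c.
  have cNe : c != e by case/coversP: cA'a; rewrite !inE => /andP[].
  rewrite lt_neqAle eq_sym cNe /=; case/orP: (tree_linear cy (ltW ey)) => // ce.
  by case/eqP: cNe; apply: emin => //; case/coversP: cA'a.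
have cNcov : c \notin covers A a.
  by apply/negP => /coversP[_ _ /(_ e eA ae' (ltW ec)) E]; rewrite E ltxx in ec.
rewrite (cardsD1 e) ecov (cardsD1 c (covers A' a)) cA'a leq_add2l.
apply/subset_leq_card/subsetP => z /setD1P[ze za]; apply/setD1P; split; last exact: cov.
by apply: contraNneq cNcov => <-.
Qed.

Variable F : spsh (OmegaC k).
Hypothesis Ffib : inj_fibrant F.
Hypothesis Fseg : forall A, admissible k A -> local F (fam (stars A)) (fam [set A]).

Lemma fam_powerset A : fam (powerset A) = fam [set A].
Proof.
apply: fam_eq => Y _; rewrite covered1 (covered_downclosed _ (@powerset_downclosed A)).
by rewrite powersetE.
Qed.

(* Induction on the size of X: a maximal set A of X outside the base contains e; the pair
   {A, A - e} is attached along the inner horn of A at e, which is local by induction and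
   the Segal condition for A. *)
Lemma local_bases X : downclosed X ->
  (forall Y, Y \in X -> nonbase Y -> e |: Y \in X) ->
  local F (fam (bases X)) (fam X).
Proof.
have [n] := ubnP #|X|; elim: n X => // n IH X leX Xd Xe.
have [/existsP[A0 /andP[A0X nA0]]|/existsPn none] :=
  boolP [exists Y, (Y \in X) && nonbase Y]; last first.
  have -> : bases X = X; last exact: local_refl.
  apply/setP => Y; rewrite inE; have := none Y; case: (Y \in X) => //=.
pose P := [pred Y | (Y \in X) && nonbase Y].
have PA0 : P A0 by rewrite /= A0X.
case: (@arg_maxnP _ A0 P (fun Y => #|Y|) PA0) => A /andP[AX nA] Amax.
have {Amax} Amax Y : Y \in X -> A \subset Y -> Y = A.
  move=> YX AY; apply/esym/eqP; rewrite eqEcard AY /=; apply: Amax.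
  by rewrite /= YX (nonbase_sub AY).
have eA : e \in A by rewrite -(Amax _ (Xe _ AX nA) (subsetUr _ _)) setU11.
have nAe := nonbaseD1 nA.
(* Both sets have to go together: removing [A] alone would break closure under adding [e], and
   removing [A :\ e] alone would break downward closure. By maximality of [A], only these two
   members of [X] contain [A :\ e]. *)
pose X' := X :\: [set A; A :\ e].
have X'P Y : (Y \in X') = [&& Y \in X, Y != A & Y != A :\ e].
  by rewrite !inE negb_or andbC.
have addA Y : e |: Y = A -> Y = A \/ Y = A :\ e.
  move=> YA; have [eY|eY] := boolP (e \in Y).
    by left; rewrite -YA; apply/esym/setUidPr; rewrite sub1set.
  by right; rewrite -YA setU1K.
have X'd : downclosed X'.
  move=> Y Z; rewrite !X'P => /and3P[YX YA YAe] ZY; rewrite (Xd Y) //=.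
  apply/andP; split.
    by apply: contra YA => /eqP ZA; apply/eqP/Amax; rewrite -?ZA.
  apply/negP => /eqP ZA; rewrite ZA in ZY; have nY := nonbase_sub ZY nAe.
  have eYA : e |: Y = A.
    by apply: Amax; [apply: Xe | rewrite -(setD1K eA) setUS].
  by case: (addA Y eYA) => E; [rewrite E eqxx in YA | rewrite E eqxx in YAe].
have X'e Y : Y \in X' -> nonbase Y -> e |: Y \in X'.
  rewrite !X'P => /and3P[YX YA YAe] nY; rewrite Xe //=; apply/andP; split.
    by apply/eqP => /addA[] E; [rewrite E eqxx in YA | rewrite E eqxx in YAe].
  by apply: contraTneq (setU11 e Y) => ->; rewrite !inE eqxx.
have X'X : X' \subset X by apply: subsetDl.
have cardX' : (#|X'| < #|X|)%N.
  apply/proper_card/properP; split=> //; exists A => //.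
  by rewrite X'P eqxx andbF.
have bX' : bases X' = bases X.
  apply/setP => Y; rewrite [LHS]inE [RHS]inE X'P; case: (Y \in X) => //=.
  have [nY|nY] := boolP (nonbase Y); rewrite ?andbF // andbT; apply/andP.
  by split; apply: contraNneq nY => ->.
have L' : local F (fam (bases X)) (fam X').
  by rewrite -bX'; apply: IH => //; apply: leq_trans cardX' _; rewrite -ltnS.
apply: local_trans L' _.
have famX : fam X = subU (fam X') (fam [set A]).
  apply: sub_eq => c f /=; rewrite covered1 !covered_downclosed // X'P.
  set Y := image_of f; split=> [YX|[/and3P[]//|]]; last exact: Xd.
  rewrite YX /=; have [->|YA] := eqVneq Y A; first by right.
  by have [->|YAe] := eqVneq Y (A :\ e); [right; apply: subsetDl | left].
rewrite famX; apply: (local_pushout Ffib).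
pose L := powerset A :&: X'.
have Ld : downclosed L.
  by move=> Y Z /setIP[YA YX'] ZY; rewrite in_setI (powerset_downclosed YA ZY) (X'd Y).
have -> : subI (fam X') (fam [set A]) = fam L.
  apply: sub_eq => c f /=; rewrite covered1 !covered_downclosed // in_setI powersetE.
  by split=> [[-> ->]|/andP[]].
have [Aadm|Aadm] := pselect (admissible k A); last first.
  have -> : fam L = fam [set A]; last exact: local_refl.
  apply: fam_eq => Y Yadm; rewrite covered1 covered_downclosed // in_setI powersetE X'P.
  have [YA|//] := boolP (Y \subset A); rewrite (Xd A) //=; apply/andP; split.
    by apply: contra_not_neq Aadm => <-.
  by apply: contra_not_neq Aadm => YA'; apply: admissible_add => //; rewrite -YA'.
have LL : local F (fam (bases L)) (fam L).
  apply: IH => // [|Y].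
    apply: leq_trans (_ : #|X'| < n)%N; first by rewrite ltnS subset_leq_card ?subsetIr.
    by apply: leq_trans cardX' _; rewrite -ltnS.
  by rewrite !in_setI !powersetE => /andP[YA YX'] nY; rewrite subUset sub1set eA YA /=; exact: X'e.
have famb : fam (bases L) = fam [set below_edge A e; above_edge A e].
  apply: fam_eq => Y _; rewrite (covered_downclosed _ (bases_downclosed Ld)).
  rewrite in_bases in_setI powersetE X'P.
  apply/idP/idP => [/andP[/andP[YA _]]|]; first by rewrite (nonbase_split eA YA).
  move=> Ycov; have YA : Y \subset A.
    move: Ycov; rewrite covered2 => /orP[]/subset_trans; apply.
      exact: subsetDl.
    exact: subsetIl.
  rewrite (nonbase_split eA YA) Ycov YA (Xd A) //= !andbT.
  rewrite -(nonbase_split eA YA) in Ycov.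
  by apply/andP; split; apply: contraNneq Ycov => ->.
rewrite famb in LL.
(* The stars of [A] are local in the union of its two parts, this union is local in the horn by
   [LL], and the stars are local in [A] by the Segal condition. Cancellation leaves the inclusion of
   the horn in [A]. *)
have Lsplit := local_split eA Ffib (Fseg (admissible_below eA nA Aadm))
  (Fseg (admissible_above eA Aadm)).
apply: local_cancel (local_trans Lsplit LL) (Fseg Aadm).
by move=> c f /=; rewrite covered1 covered_downclosed // in_setI powersetE => /andP[].
Qed.

End Reduction.

Section Main.
Variable F : spsh (OmegaC k).
Hypothesis Ffib : inj_fibrant F.
Hypothesis Fseg : forall A, admissible k A -> local F (fam (stars A)) (fam [set A]).

(** The valences of [A] are left unbounded because the lemma is applied to all of [T]. With no inner
    edge, [A] is the star of its root and the two subpresheaves agree, whatever the valence of that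
    root. *)
Lemma local_stars A : rooted A -> local F (fam (stars A)) (fam [set A]).
Proof.
have [n] := ubnP #|A|; elim: n A => // n IH A leA [r rA rP].
have [/exists_inP[e eA /andP[er /exists_inP[y yA ey]]]|none] :=
  boolP [exists e in A, (e != r) && [exists y in A, e < y]]; last first.
  have -> : fam (stars A) = fam [set A]; last exact: local_refl.
  apply: fam_eq => Y _; rewrite covered1; apply/covered_stars/idP.
    by move=> [a aA /subset_trans]; apply; apply: star_sub.
  move=> YA; exists r => //; apply: subset_trans YA _; apply/subsetP => x xA.
  rewrite in_setU1; have [//|xr /=] := eqVneq x r.
  apply/coversP; split=> // [|z zA rz zx]; first by rewrite lt_neqAle eq_sym xr rP.
  apply/eqP; apply: contraNT none => zNx; apply/exists_inP; exists z => //.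
  rewrite gt_eqF //=; apply/exists_inP; exists x => //.
  by rewrite lt_neqAle zNx zx.
have re : r < e by rewrite lt_neqAle eq_sym er rP.
have L1 : local F (fam (stars (below_edge A e))) (fam [set below_edge A e]).
  apply: IH; last first.
    exists r; first by apply/below_edgeP; rewrite lt_gtF.
    by move=> x /below_edgeP[xA _]; apply: rP.
  rewrite ltnS in leA; apply: leq_trans leA; apply/proper_card/properP.
  split; first exact: subsetDl.
  by exists y => //; apply/below_edgeP => -[_ /negP].
have L2 : local F (fam (stars (above_edge A e))) (fam [set above_edge A e]).
  apply: IH; last by exists e => [|x /above_edgeP[]]; first exact: mem_above_edge.
  rewrite ltnS in leA; apply: leq_trans leA; apply/proper_card/properP.
  split; first exact: subsetIl.
  by exists r => //; apply/above_edgeP => -[_]; rewrite lt_geF.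
apply: local_trans (local_split eA Ffib L1 L2) _.
have -> : fam [set below_edge A e; above_edge A e] = fam (bases e (powerset A)).
  apply: fam_eq => Y _.
  rewrite (covered_downclosed _ (bases_downclosed (@powerset_downclosed A))) in_bases powersetE.
  apply/idP/andP => [Ycov|[YA]]; last by rewrite (nonbase_split eA YA).
  have YA : Y \subset A.
    move: Ycov; rewrite covered2 => /orP[]/subset_trans; apply.
      exact: subsetDl.
    exact: subsetIl.
  by rewrite (nonbase_split eA YA).
rewrite -fam_powerset; apply: local_bases => //; first exact: powerset_downclosed.
by move=> Y; rewrite !powersetE subUset sub1set eA.
Qed.

End Main.
End Families.

(** * The Segal condition for the right Kan extension *)

(** Elementary subtrees have leaves, so maps between them are not covered by the order criterion for
    closed targets. Preservation of the generating operations is used instead. *)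
Lemma covering_map_omega (X Y : tree) (h : X -> Y) : injective h ->
  (forall e, e \notin leaf X -> h e \notin leaf Y /\ h @: inputs e = inputs (h e)) ->
  forall s e, free_op s e -> free_op (map h s) (h e).
Proof.
move=> h_inj hP s e; elim=> {s e} [e|e s eX _ IH|s t e st _ IH].
- exact: free_id.
- have [heY he] := hP e eX.
  pose s' d := if [pick c | h c == d] is Some c then map h (s c) else [::].
  have s'E c : s' (h c) = map h (s c).
    rewrite /s'; case: pickP => [c' /eqP/h_inj -> //|/(_ c)].
    by rewrite eqxx.
  have -> : map h (flatten [seq s c | c <- enum (inputs e)]) =
      flatten [seq s' d | d <- map h (enum (inputs e))].
    by rewrite map_flatten -!map_comp; congr flatten; apply: eq_map => c /=; rewrite s'E.
  apply: (free_perm (s := flatten [seq s' d | d <- enum (inputs (h e))])).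
    apply/perm_flatten/perm_map; apply: uniq_perm; rewrite ?enum_uniq ?map_inj_uniq ?enum_uniq //.
    by move=> d; rewrite mem_enum -he; apply/imsetP/mapP => -[c ce ->]; exists c;
      rewrite // ?mem_enum // -mem_enum.
  apply: free_graft => // d; rewrite -he => /imsetP[c ce ->].
  by rewrite s'E; apply: IH.
- by apply: free_perm IH; apply: perm_map.
Qed.

Section StarTrees.

Lemma star_rootE n (x y : star n) : star_val x = ord0 -> x <= y.
Proof. by move=> x0; rewrite /Order.le /= /star_le x0 eqxx. Qed.

Lemma star_leE n (x y : star n) : (x <= y) = (star_val x == ord0) || (x == y).
Proof. by []. Qed.

Lemma corolla_leafE n (x : corolla n) : (x \in leaf (corolla n)) = (star_val x != ord0).
Proof. by rewrite inE. Qed.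

Lemma corolla_inputs n (r : corolla n) : star_val r = ord0 ->
  inputs r = [set x : corolla n | star_val x != ord0].
Proof.
move=> r0; apply/setP => x; rewrite !inE.
have xr : (x == r) = (star_val x == ord0) by rewrite -(inj_eq val_inj) /= r0.
have xrN : (r < x) = (star_val x != ord0).
  by rewrite lt_neqAle star_rootE // andbT eq_sym xr.
rewrite xrN; case: eqP => //= x0; apply/forallP => y; apply/implyP => ry.
apply/implyP; rewrite star_leE; case/orP => // /eqP y0.
by have := lt_geF ry; rewrite star_rootE.
Qed.

End StarTrees.

(** * Elementary subtrees and their images *)

Section Elementary.
Variable T : tree.
Hypothesis cT : is_closed T.
Implicit Types (e : T) (x y : OmegaEl T).

Definition el_tree x : tree := projT1 (sval x).
Definition el_map x : @hom Omega (el_tree x) T := projT2 (sval x).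
Definition el_image x : {set T} := image_of (el_map x).

Lemma el_map_inj x : injective (sval (el_map x)).
Proof. exact: (svalP x).1.1. Qed.

(** Elementary subtrees are injective on edges, so their category is a preorder. A chain is
    therefore known from its objects, which permits the embedding of its nerve in a codiscrete
    simplicial set. *)
Lemma el_hom_unique x y (h h' : hom x y) : h = h'.
Proof.
case: h h' => [h hP] [h' h'P]; apply/eq_exist/omega_eq => z.
apply: (@el_map_inj y).
exact: (congr1 (fun f : @hom Omega _ _ => sval f z) (etrans hP (esym h'P))).
Qed.

Lemma el_hom_image x y : hom x y -> el_image x \subset el_image y.
Proof. by move=> [h hP]; rewrite /el_image -[el_map x]hP image_of_comp. Qed.

Lemma el_hom_intro x y (h : el_tree x -> el_tree y) :
  (forall z, sval (el_map y) (h z) = sval (el_map x) z) ->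
  (forall d, d \notin leaf (el_tree x) ->
     h d \notin leaf (el_tree y) /\ h @: inputs d = inputs (h d)) ->
  inhabited (hom x y).
Proof.
move=> hE hP; have h_inj : injective h.
  by move=> a b ab; apply: (@el_map_inj x); rewrite -!hE ab.
by split; exists (exist _ h (covering_map_omega h_inj hP)); apply: omega_eq => z; exact: hE.
Qed.

Lemma order_map_hom (X : tree) (f : @hom Omega X T) : order_map (sval f).
Proof.
have [fmono fcomp] := hom_order_map (closure_transpose cT f) (closure_closed X).
by split=> [a b ab|a b ab]; [apply: fmono | apply: fcomp].
Qed.

Definition point_map e : @hom Omega eta T.
Proof.
apply: (order_hom cT (f := fun _ : eta => e)); split=> // x y _.
by case: x y => [x] [y]; rewrite [x]ord1 [y]ord1.
Defined.

Lemma point_elementary e : @elementary T (existT _ eta (point_map e)).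
Proof.
split; last by left.
split=> [[x] [y] _|x y e' /= ee' e'e]; first by rewrite [x]ord1 [y]ord1.
by exists x; apply/le_anti; rewrite ee' e'e.
Qed.

Definition el_point e : OmegaEl T := exist _ _ (point_elementary e).

Lemma el_point_image e : el_image (el_point e) = [set e].
Proof.
apply/setP => x; rewrite inE; apply/imsetP/eqP => [[_ _ ->] //|->].
by exists (Star ord0).
Qed.

Definition star_map e (z : corolla #|inputs e|) : T :=
  if star_val z == ord0 then e else nth e (enum (inputs e)) (star_val z).-1.

Lemma star_map_root e z : star_val z = ord0 -> @star_map e z = e.
Proof. by rewrite /star_map => ->. Qed.

Lemma star_pred_lt e (z : corolla #|inputs e|) :
  star_val z != ord0 -> ((star_val z).-1 < size (enum (inputs e)))%N.
Proof.
rewrite -cardE; case: z => -[m lm]; rewrite -(inj_eq val_inj) /= => m0.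
by rewrite -ltnS prednK ?lt0n.
Qed.

Lemma star_map_inputs e z : star_val z != ord0 -> @star_map e z \in inputs e.
Proof.
rewrite /star_map => z0; rewrite (negPf z0) -mem_enum mem_nth //.
exact: star_pred_lt.
Qed.

Lemma star_map_inj e : injective (@star_map e).
Proof.
have nz z : star_val z != ord0 -> @star_map e z != e.
  by move=> /star_map_inputs/inputs_lt; apply: contraTneq => ->; rewrite ltxx.
move=> z w; have [z0|z0] := eqVneq (star_val z) ord0; have [w0|w0] := eqVneq (star_val w) ord0.
- by move=> _; apply: val_inj; rewrite /= z0 w0.
- by rewrite (star_map_root z0) => E; have := nz _ w0; rewrite -E eqxx.
- by rewrite (star_map_root w0) => E; have := nz _ z0; rewrite E eqxx.
rewrite /star_map (negPf z0) (negPf w0) => /eqP.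
rewrite nth_uniq ?enum_uniq ?star_pred_lt // => /eqP zw; apply/val_inj/val_inj => /=.
rewrite -(inj_eq val_inj) /= in z0; rewrite -(inj_eq val_inj) /= in w0.
by rewrite -(prednK (n := star_val z)) ?lt0n // zw prednK ?lt0n.
Qed.

Lemma star_map_le e z w : @star_map e z <= star_map w -> z <= w.
Proof.
have [z0|z0] := eqVneq (star_val z) ord0; first by rewrite star_rootE.
have [w0|w0] := eqVneq (star_val w) ord0 => zw.
  by have := lt_le_trans (inputs_lt (star_map_inputs z0)) zw; rewrite star_map_root ?ltxx.
have -> // : z = w; apply: star_map_inj.
exact: inputs_inj (star_map_inputs z0) (star_map_inputs w0) zw (lexx _).
Qed.

Lemma star_map_order e : order_map (@star_map e).
Proof.
split=> z w; last by move/star_map_le => zw; rewrite /Order.comparable zw.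
rewrite star_leE => /orP[/eqP z0|/eqP -> //]; rewrite (star_map_root z0).
have [w0|/star_map_inputs/inputs_lt/ltW //] := eqVneq (star_val w) ord0.
by rewrite star_map_root.
Qed.

Lemma star_elementary e :
  @elementary T (existT _ (corolla #|inputs e|) (order_hom cT (star_map_order e))).
Proof.
split; last first.
  right; exists #|inputs e|; split=> // r rmin /=.
  by rewrite star_map_root //; have := rmin (Star ord0); rewrite star_leE => /orP[/eqP|/eqP ->].
split=> /= [|z w e' ze' e'w]; first exact: star_map_inj.
have : z <= w by apply: star_map_le (le_trans ze' e'w).
rewrite star_leE => /orP[/eqP z0|/eqP zw]; last first.
  by exists z; apply/le_anti; rewrite ze' zw e'w.
rewrite (star_map_root z0) in ze'; move: ze'; rewrite le_eqVlt => /predU1P[<-|ee'].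
  by exists z; rewrite star_map_root.
have [w0|w0] := eqVneq (star_val w) ord0.
  by move: e'w; rewrite (star_map_root w0) lt_geF.
have := star_map_inputs w0; rewrite inE => /andP[_ /forallP/(_ e')].
by rewrite ee' e'w => /eqP ->; exists w.
Qed.

Definition el_star e : OmegaEl T := exist _ _ (star_elementary e).

Lemma el_star_image e : el_image (el_star e) = star_of [set: T] e.
Proof.
rewrite /star_of covers_setT; apply/setP => x; apply/imsetP/setU1P => [[z _ ->]|].
  have [z0|z0] := eqVneq (star_val z) ord0; first by left; apply: star_map_root.
  by right; apply: star_map_inputs.
case=> [->|xe]; first by exists (Star ord0); rewrite //= star_map_root.
have le : ((index x (enum (inputs e))).+1 < #|inputs e|.+1)%N.
  by rewrite ltnS cardE index_mem mem_enum.
by exists (Star (Ordinal le)) => //; rewrite /= /star_map /= nth_index ?mem_enum.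
Qed.

(** Elementary subtrees are classified by image, as edges or full stars. The further clauses locate
    the root and its inputs in the source, as needed to build maps with [el_hom_intro]. *)
Lemma elP x :
  (exists e, el_image x = [set e]) \/
  (exists e, [/\ el_image x = star_of [set: T] e,
     forall z, (z \notin leaf (el_tree x)) = (sval (el_map x) z == e) &
     forall z, sval (el_map x) z = e -> inputs z = [set w | w != z]]).
Proof.
case: x => [[X f] [[f_inj fconv] /= XP]]; rewrite /el_image /el_map /el_tree /=.
have [fmono fcomp] := order_map_hom f.
case: XP => [XE|[n [XE XP]]].
  left; move: f f_inj fconv fmono fcomp; rewrite XE => f *; exists (sval f (Star ord0)).
  apply/setP => x; rewrite inE; apply/imsetP/eqP => [[[z] _ ->]|->]; first by rewrite [z]ord1.
  by exists (Star ord0).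
right; move: f f_inj fconv fmono fcomp XP; rewrite XE => f f_inj fconv fmono fcomp XP.
pose r : corolla n := Star ord0; exists (sval f r).
have rP (y : corolla n) : r <= y by apply: star_rootE.
have cardr := XP r rP.
(* By convexity, the input of the root below the image of a leaf is in the image, and only that leaf
   can map to it. The valence clause of [elementary] then turns the inclusion into an equality by
   counting. *)
have sub : [set sval f z | z in [set z : corolla n | star_val z != ord0]] \subset inputs (sval f r).
  apply/subsetP => fz /imsetP[z]; rewrite inE => z0 ->{fz}.
  have rz : sval f r < sval f z.
    rewrite lt_neqAle fmono // andbT; by apply: contra z0 => /eqP/f_inj rz; rewrite -rz.
  have [c ce cz] := inputs_ex rz.
  have [w wc] := fconv r z c (ltW (inputs_lt ce)) cz.
  suff -> : z = w by rewrite wc.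
  have w0 : star_val w != ord0.
    apply: contraTneq (inputs_lt ce) => w0; rewrite -wc (_ : w = r) ?ltxx //.
    exact: val_inj.
  have : w >=< z by apply: fcomp; rewrite wc.
  by rewrite /Order.comparable !star_leE (negPf w0) (negPf z0) /= => /orP[/eqP->|/eqP->].
have {sub} inE' :
    [set sval f z | z in [set z : corolla n | star_val z != ord0]] = inputs (sval f r).
  apply/eqP; rewrite eqEcard sub cardr card_imset //.
  have := cardsC [set r]; rewrite cards1 card_star add1n => -[/esym le].
  rewrite {1}le; apply/subset_leq_card/subsetP => z; rewrite !inE.
  by apply: contra => /eqP z0; apply/eqP/val_inj.
have rE z : (sval f z == sval f r) = (star_val z == ord0).
  by rewrite (inj_eq f_inj) -(inj_eq val_inj).
split=> [|z|z /eqP]; last 2 first.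
- by rewrite corolla_leafE negbK rE.
- rewrite rE => /eqP z0; rewrite corolla_inputs //; apply/setP => w.
  by rewrite !inE; congr negb; rewrite -[RHS](inj_eq val_inj) /= z0.
rewrite /star_of covers_setT -inE'; apply/setP => x.
apply/imsetP/setU1P => [[z _ ->]|[->|/imsetP[z _ ->]]]; last 2 first.
- by exists r.
- by exists z.
have [z0|z0] := eqVneq (star_val z) ord0; first by left; congr (sval f _); apply: val_inj.
by right; apply: imset_f; rewrite inE.
Qed.

Lemma el_image_star x : covered (stars [set: T]) (el_image x).
Proof.
apply/covered_stars; case: (elP x) => [[e ->]|[e [-> _ _]]]; exists e => //.
by rewrite sub1set setU11.
Qed.

Lemma star_root_unique e e' b : e < b -> e \in star_of [set: T] e' ->
  b \in star_of [set: T] e' -> e = e'.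
Proof.
rewrite /star_of covers_setT => eb /setU1P[//|ee'] /setU1P[be'|be'].
  by have := lt_trans (inputs_lt ee') eb; rewrite be' ltxx.
by have := inputs_inj ee' be' (ltW eb) (lexx b) => E; rewrite E ltxx in eb.
Qed.

Lemma el_star_type y r b : r < b -> r \in el_image y -> b \in el_image y ->
  [/\ el_image y = star_of [set: T] r,
      forall z, (z \notin leaf (el_tree y)) = (sval (el_map y) z == r) &
      forall z, sval (el_map y) z = r -> inputs z = [set w | w != z]].
Proof.
move=> rb; case: (elP y) => [[e ->] /set1P re /set1P be|[e [yE yl yi]]].
  by rewrite re be ltxx in rb.
by rewrite {1 2}yE => re be; rewrite (star_root_unique rb re be).
Qed.

(* This makes the fibres of the homotopy colimit of the P_(X^c) over K_T contractible. *)
Lemma el_initial (Y : {set T}) : rooted Y -> covered (stars [set: T]) Y ->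
  exists x, Y \subset el_image x /\ forall y, Y \subset el_image y -> inhabited (hom x y).
Proof.
move=> [r rY rmin] /covered_stars[e _ Ye].
(* If [Y] is one edge, that edge is initial. Otherwise two comparable edges of [Y] determine the
   root of any star containing them, so all elementary subtrees containing [Y] have the same image,
   the star at [r]. *)
have [/exists_inP[b bY rb]|single] := boolP [exists b in Y, r < b]; last first.
  have YE : Y = [set r].
    apply/setP => z; rewrite inE; apply/idP/eqP => [zY|->//].
    apply/eqP; apply: contraNT single => zr; apply/exists_inP; exists z => //.
    by rewrite lt_neqAle eq_sym zr rmin.
  exists (el_point r); rewrite el_point_image YE; split=> // y; rewrite sub1set => /imsetP[z _ rz].
  by apply: (@el_hom_intro (el_point r) y (fun _ => z)) => // e'; rewrite inE.
have re : r = e by apply: (star_root_unique rb); apply: (subsetP Ye).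
have Yr : Y \subset el_image (el_star r) by rewrite el_star_image re.
have [rE rl ri] := el_star_type rb (subsetP Yr _ rY) (subsetP Yr _ bY).
exists (el_star r); split=> // y Yy.
have [yE yl yi] := el_star_type rb (subsetP Yy _ rY) (subsetP Yy _ bY).
have fy z : exists w, sval (el_map y) w = sval (el_map (el_star r)) z.
  have : sval (el_map (el_star r)) z \in el_image y by rewrite yE -rE; apply: imset_f.
  by case/imsetP => w _ ->; exists w.
pose h z := projT1 (cid (fy z)); have hP z : sval (el_map y) (h z) = _ := projT2 (cid (fy z)).
apply: (@el_hom_intro (el_star r) y h) => // d; rewrite rl => /eqP dr.
have hdr : sval (el_map y) (h d) = r by rewrite hP.
rewrite yl hdr eqxx; split=> //; rewrite (ri d dr) (yi _ hdr); apply/setP => w; rewrite !inE.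
apply/imsetP/idP => [[z]|wd]; first rewrite inE => zd ->.
  by apply: contra zd => /eqP E; apply/eqP/(@el_map_inj (el_star r)); rewrite -!hP E.
have : sval (el_map y) w \in el_image (el_star r) by rewrite rE -yE; apply: imset_f.
case/imsetP => z _ wz; have wE : w = h z by apply: (@el_map_inj y); rewrite hP.
by exists z; rewrite // inE; apply: contra wd => /eqP <-; rewrite wE.
Qed.

End Elementary.

Program Definition subval (C : category) (B : psh C) (Z : sub B) : pmap (subp Z) B :=
  {| app := fun c x => sval x |}.

Lemma subval_inj (C : category) (B : psh C) (Z : sub B) c : injective (subval Z c).
Proof. by move=> [x xP] [y yP] /= xy; apply/eq_exist. Qed.

(** * The homotopy limit as a space of maps *)

Section Conversion.
Variables (k j : option nat) (kj : le_oo k j) (F0 : spaces_psh (OmegaC k)) (T : OmegaC j).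

Let T' : tree := sval T.
Let cT : is_closed T' := (svalP T).1.
Let u := incl_OmegaC kj.
Let F : spsh (OmegaC k) := F0.
Let G : spsh (OmegaC j) := RKan u F0.
Let El := OmegaEl T'.
Let Ffib : inj_fibrant F := @psh_of_fibrant _ F0.

Let edges : sub (rep k T') := fam k [set [set: T']].
Let core : sub (rep k T') := fam k (stars [set: T']).

Lemma core_le : sub_le core edges.
Proof.
by move=> c f /coveredP[A _ fA]; apply/coveredP; exists setT; rewrite ?set11 ?subsetT.
Qed.

Let core_El := prodp (subp core) (const (OmegaC k) (codiscrete El)).

(* The homotopy colimit of the P_(X^c), embedded over K_T in the product of K_T with a
   contractible simplicial set. *)
Program Definition nerve_sub : sub core_El :=
  {| mem_sub := fun c z =>
       (forall i i' : 'I_c.2.+1, (i <= i')%N -> inhabited (hom (z.2 i : El) (z.2 i'))) /\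
       image_of (sval z.1) \subset el_image (z.2 ord0) |}.
Next Obligation.
move=> c d f [[g gP] x] [/= xmono gx]; split=> [i i' ii'|].
  by apply: xmono; apply: (svalP f.2).
apply: subset_trans (image_of_comp g f.1) (subset_trans gx _).
by have [|h] := xmono ord0 (sval f.2 ord0) _; [|exact: el_hom_image].
Qed.

(** Over a map [f] the fibre is the nerve of the elementary subtrees containing its image, and it
    contracts to the initial one. As time is monotone, the vertices already moved there precede the
    others, so the result is again a chain. *)
Lemma weq_nerve_sub : weq (mapping_map F (subval nerve_sub)).
Proof.
apply/trivial_fibration_weq/mapping_trivial_fibration => // [c|S].
  exact: subval_inj.
have init (m : Delta) (f : subp core (S, m)) : exists x : El,
    image_of (sval f) \subset el_image x /\
    forall y : El, image_of (sval f) \subset el_image y -> inhabited (hom x y).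
  case: f => f fP; apply: el_initial => //.
  by have [] := image_admissible f (svalP S).
(* Making the choice depend on the image alone keeps it unchanged under simplicial operators. The
   default value, the root edge, is never reached for images of maps in the core. *)
pose X (Y : {set T'}) : El := if pselect (exists x : El, Y \subset el_image x /\
    forall y : El, Y \subset el_image y -> inhabited (hom x y)) is left e then projT1 (cid e)
  else el_point cT (projT1 (cid (tree_rooted T'))).
have XP (m : Delta) (f : subp core (S, m)) :
    image_of (sval f) \subset el_image (X (image_of (sval f))) /\
    forall y : El, image_of (sval f) \subset el_image y ->
      inhabited (hom (X (image_of (sval f))) y).
  rewrite /X; case: pselect => [e|]; last by case; exact: init.
  exact: (projT2 (cid e)).
pose D0 m (z : prodp (at_ S core_El) (simplex 1) m) : at_ S core_El m :=
  (z.1.1, fun i => if sval z.2 i == ord0 then X (image_of (sval z.1.1)) else z.1.2 i).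
have D0N (m n : Delta) (a : hom m n) z :
    D0 m (res (prodp (at_ S core_El) (simplex 1)) a z) = res (at_ S core_El) a (D0 n z).
  by [].
exists (Pmap D0N), ord0, ord_max; split=> //.
- by move=> m [[f fP] x].
- move=> m [f x]; have [fX _] := XP m f.
  suff H : nerve_sub (S, m) (D0 m ((f, x), cmap m ord0)) by exists (exist _ _ H).
  by split=> // i i' _; constructor; exact: idm.
- move=> m [f x] t [[w [wmono wim]] /= wE]; rewrite wE /= in wmono wim.
  suff H : nerve_sub (S, m) (D0 m ((f, x), t)) by exists (exist _ _ H).
  have [fX Xinit] := XP m f; split=> [i i' ii'|] /=.
    have := svalP t i i' ii'; case: (ord2P (sval t i)) => ->; case: (ord2P (sval t i')) => -> //= _.
    + by constructor; exact: (@idm El (X (image_of (sval f)))).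
    + apply: Xinit; apply: subset_trans wim _.
      by have [|h] := wmono ord0 i' _; [|exact: el_hom_image].
    + exact: wmono.
  by case: ifP.
Qed.

Lemma el_map_le (x : El) a b : sval (el_map x) a <= sval (el_map x) b -> a <= b.
Proof.
have [fmono fcomp] := order_map_hom cT (el_map x) => ab.
case/orP: (fcomp a b ab) => // ba.
suff -> : a = b by [].
by apply: (@el_map_inj _ x); apply/le_anti; rewrite ab fmono.
Qed.

Lemma el_factor (S : OmegaC k) (f : @hom Omega (sval S) T') (x : El) :
  image_of f \subset el_image x ->
  exists g : @hom (OmegaC j) (u S) (el_closure T x), @ccomp Omega _ _ _ (el_cone (T:=T) x) g = f.
Proof.
move=> fx; have pre s : exists w, sval (el_map x) w = sval f s.
  have /(subsetP fx)/imsetP[w _ ->] : sval f s \in image_of f by apply: imset_f.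
  by exists w.
pose g s := projT1 (cid (pre s)).
have gP s : sval (el_map x) (g s) = sval f s := projT2 (cid (pre s)).
have [fmono fcomp] := hom_order_map f (svalP S).1.
have gord : @order_map (sval S) (closure (el_tree x)) g.
  split=> [s s' ss'|s s' ss']; first by apply: (@el_map_le x); rewrite !gP; apply: fmono.
  apply: fcomp; rewrite -!gP; have [xmono _] := order_map_hom cT (el_map x).
  exact: (xmono (g s) (g s')).
exists (order_hom (closure_closed (el_tree x)) gord).
by apply: omega_eq => s; exact: gP.
Qed.

Lemma el_cone_inj (S : OmegaC k) (x : El) (g g' : @hom (OmegaC j) (u S) (el_closure T x)) :
  @ccomp Omega _ _ _ (el_cone (T:=T) x) g = @ccomp Omega _ _ _ (el_cone (T:=T) x) g' -> g = g'.
Proof.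
move=> E; apply: omega_eq => s; apply: (@el_map_inj _ x).
exact: (congr1 (fun h : @hom Omega _ _ => sval h s) E).
Qed.

Lemma el_chain_eq (X : El) (q : nat) (s s' : chain X q) :
  (forall i, projT1 s i = projT1 s' i) -> s = s'.
Proof.
case: s s' => [[s h i c] a] [[s' h' i' c'] a'] /= /funext ss'; subst s'.
by apply: chain_eq => [x y f|]; apply: el_hom_unique.
Qed.

Lemma chain_exists (X : El) (q : nat) (x : 'I_q.+1 -> El) :
  (forall i i' : 'I_q.+1, (i <= i')%N -> inhabited (hom (x i) (x i'))) ->
  inhabited (hom X (x ord0)) -> exists s : chain X q, forall i, projT1 s i = x i.
Proof.
move=> xmono [h].
have hx (i i' : 'I_q.+1) (ii' : (i <= i')%N) : hom (x i) (x i').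
  exact: inhabited_witness (xmono i i' ii').
have hxid i : hx i i (@idm (ordc q) i) = idm (x i) by exact: el_hom_unique.
have hxc (a b c : ordc q) (g : hom b c) (f : hom a b) :
  hx a c (ccomp g f) = ccomp (hx b c g) (hx a b f) by exact: el_hom_unique.
by exists (existT _ (@Functor (ordc q) El x hx hxid hxc) h).
Qed.

Let hocolim (n : Delta) := prodp (coslice_nerve El) (pull (sndF El Delta) (simplex n)).

(** Moving the first cell along [b] and the second along [h] leads to the same chain under [X], so
    naturality of [Phi], used twice, equates the values. They depend only on the vertices of the
    chain and the composite map to [T]. *)
Lemma nerve_eval (n : Delta) (Phi : holim (spull (el_closure T) G) n)
    (X X' : El) (p : Delta) (s : chain X p) (a : @hom Delta p n) (c : prodc (OmegaC k) Delta)
    (g : @hom (OmegaC j) (u c.1) (el_closure T X)) (b : @hom Delta c.2 p)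
    (s' : chain X' c.2) (a' : @hom Delta c.2 n)
    (g' : @hom (OmegaC j) (u c.1) (el_closure T X')) :
  inhabited (hom X X') -> (forall i, projT1 s' i = projT1 s (sval b i)) ->
  (forall i, sval a' i = sval a (sval b i)) ->
  @ccomp Omega _ _ _ (el_cone (T:=T) X') g' = @ccomp Omega _ _ _ (el_cone (T:=T) X) g ->
  (Phi (X, p) (s, a) : pmap _ _) c (g, b) = (Phi (X', c.2) (s', a') : pmap _ _) c (g', idm _).
Proof.
move=> [h] ss' aa' gg'.
have E : res (hocolim n) ((idm X, b) : @hom (prodc El Delta) (X, c.2) (X, p)) (s, a) =
    res (hocolim n) ((h, idm (c.2 : Delta)) : @hom (prodc El Delta) (X, c.2) (X', c.2)) (s', a').
  congr pair; first by apply: el_chain_eq => i /=; rewrite ss'.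
  by apply: Delta_eq => i /=; rewrite aa'.
have E1 := app_nat Phi ((idm X, b) : @hom (prodc El Delta) (X, c.2) (X, p)) (s, a).
have E2 := app_nat Phi ((h, idm (c.2 : Delta)) : @hom (prodc El Delta) (X, c.2) (X', c.2)) (s', a').
have E' := pmap_app (etrans (esym E1) (etrans (congr1 (Phi (X, c.2)) E) E2)) (g, idm (c.2 : Delta)).
etransitivity; last (etransitivity; first exact: E').
- by congr ((Phi _ _ : pmap _ _) c (_, _)); [apply: omega_eq | apply: Delta_eq].
- congr ((Phi _ _ : pmap _ _) c (_, _)); last exact: Delta_eq.
  by apply: el_cone_inj; rewrite gg' -(el_cone_nat (T:=T) h); apply: omega_eq.
Qed.

Lemma nerve_sub_eq (c : prodc (OmegaC k) Delta) (z z' : subp nerve_sub c) :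
  sval (sval z).1 = sval (sval z').1 -> (forall i, (sval z).2 i = (sval z').2 i) -> z = z'.
Proof.
case: z z' => [[[f fP] x] zP] [[[f' f'P] x'] z'P] /= ff' /funext xx'.
by subst f' x'; apply/eq_exist; congr (_, _); apply/eq_exist.
Qed.

Lemma nerve_sub_data (c : prodc (OmegaC k) Delta) (z : subp nerve_sub c) :
  exists (s : chain ((sval z).2 ord0 : El) c.2)
         (g : @hom (OmegaC j) (u c.1) (el_closure T ((sval z).2 ord0))),
    (forall i, projT1 s i = (sval z).2 i) /\
    @ccomp Omega _ _ _ (el_cone (T:=T) ((sval z).2 ord0)) g = sval (sval z).1.
Proof.
case: z => [[f x] [/= xmono fx]].
have [|s sP] := @chain_exists (x ord0) c.2 x xmono; first by constructor; exact: idm.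
by have [g gP] := el_factor fx; exists s, g.
Qed.

Lemma nerve_sub_intro (c : prodc (OmegaC k) Delta) (X : El) (p : nat) (s : chain X p)
    (g : @hom (OmegaC j) (u c.1) (el_closure T X)) (b : @hom Delta c.2 p) :
  exists z : subp nerve_sub c,
    sval (sval z).1 = @ccomp Omega _ _ _ (el_cone (T:=T) X) g /\
    forall i, (sval z).2 i = projT1 s (sval b i).
Proof.
set f := @ccomp Omega _ _ _ (el_cone (T:=T) X) g.
have fX : image_of f \subset el_image X by exact: (@image_of_comp T' _ _ (el_cone (T:=T) X) g).
have fcore : core c f.
  have /coveredP[A AQ XA] := el_image_star cT X.
  by apply/coveredP; exists A => //; apply: subset_trans XA.
suff zP : nerve_sub c (exist _ f fcore, fun i => projT1 s (sval b i)) by exists (exist _ _ zP).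
split=> [i i' ii'|] /=.
  by constructor; exact: (fhom (projT1 s) (svalP b _ _ ii' : @hom (ordc p) _ _)).
apply: subset_trans fX (subset_trans (el_hom_image (projT2 s)) _).
exact: el_hom_image (fhom (projT1 s) (leq0n _ : @hom (ordc p) ord0 _)).
Qed.

Definition data_chain c z := projT1 (cid (@nerve_sub_data c z)).
Definition data_map c z := projT1 (cid (projT2 (cid (@nerve_sub_data c z)))).

Lemma data_chainE c z i : projT1 (@data_chain c z) i = (sval z).2 i.
Proof. exact: (projT2 (cid (projT2 (cid (@nerve_sub_data c z))))).1. Qed.

Lemma data_mapE c z :
  @ccomp Omega _ _ _ (el_cone (T:=T) ((sval z).2 ord0)) (@data_map c z) = sval (sval z).1.
Proof. exact: (projT2 (cid (projT2 (cid (@nerve_sub_data c z))))).2. Qed.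

(** The chain is placed under its own first vertex. By [nerve_eval] the choices in [data_chain] and
    [data_map] do not affect the value. *)
Definition holim_fun (n : Delta) (Phi : holim (spull (el_closure T) G) n)
    (c : prodc (OmegaC k) Delta)
    (z : prodp (subp nerve_sub) (const (OmegaC k) (simplex n)) c) : F c :=
  (Phi ((sval z.1).2 ord0, c.2) (data_chain z.1, z.2) : pmap _ _) c
    (data_map z.1, idm (c.2 : Delta)).

Lemma holim_funE (n : Delta) (Phi : holim (spull (el_closure T) G) n)
    (X : El) (p : Delta) (s : chain X p) (a : @hom Delta p n) (c : prodc (OmegaC k) Delta)
    (g : @hom (OmegaC j) (u c.1) (el_closure T X)) (b : @hom Delta c.2 p)
    (z : subp nerve_sub c) (a' : @hom Delta c.2 n) :
  sval (sval z).1 = @ccomp Omega _ _ _ (el_cone (T:=T) X) g ->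
  (forall i, (sval z).2 i = projT1 s (sval b i)) ->
  (forall i, sval a' i = sval a (sval b i)) ->
  (Phi (X, p) (s, a) : pmap _ _) c (g, b) = holim_fun Phi (z, a').
Proof.
move=> zg zs aa'; apply: nerve_eval => //.
- constructor; rewrite zs; apply: ccomp (projT2 s).
  exact: (fhom (projT1 s) (leq0n _ : @hom (ordc p) ord0 _)).
- by move=> i; rewrite data_chainE.
- by rewrite data_mapE.
Qed.

Lemma holim_fun_nat (n : Delta) (Phi : holim (spull (el_closure T) G) n)
    (c d : prodc (OmegaC k) Delta) (f : hom c d) z :
  holim_fun Phi (res (prodp (subp nerve_sub) (const (OmegaC k) (simplex n))) f z) =
  res F f (holim_fun Phi z).
Proof.
rewrite /holim_fun -app_nat.
symmetry; apply: (@holim_funE n Phi _ d.2 _ z.2 c _ _ (res (subp nerve_sub) f z.1)) => //.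
  transitivity (@ccomp Omega _ _ _ (sval (sval z.1).1) f.1); first by [].
  by rewrite -(data_mapE z.1); exact: omega_eq.
by move=> i; rewrite data_chainE.
Qed.

Definition holim_to n Phi : mapping (subp nerve_sub) F n := Pmap (@holim_fun_nat n Phi).

Lemma holim_to_nat (m n : Delta) (a : hom m n) Phi :
  holim_to (res (holim (spull (el_closure T) G)) a Phi) =
  res (mapping (subp nerve_sub) F) a (holim_to Phi).
Proof. exact: pmap_eq. Qed.

Definition holim_map : pmap (holim (spull (el_closure T) G)) (mapping (subp nerve_sub) F) :=
  Pmap holim_to_nat.

(** The Bousfield-Kan limit of the spaces of maps from P_(X^c) to F is the space of maps out of the
    Bousfield-Kan colimit of the P_(X^c). That colimit is [nerve_sub]: the relations of the coend
    eliminate the apex [X]. *)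
Lemma holim_map_bij n : bijective (holim_map n).
Proof.
pose zof c X p s g b := projT1 (cid (@nerve_sub_intro c X p s g b)).
have zofE c X p s g b : sval (sval (zof c X p s g b)).1 = @ccomp Omega _ _ _ (el_cone (T:=T) X) g.
  exact: (projT2 (cid (@nerve_sub_intro c X p s g b))).1.
have zofs c X p s g b i : (sval (zof c X p s g b)).2 i = projT1 s (sval b i).
  exact: (projT2 (cid (@nerve_sub_intro c X p s g b))).2.
pose yoX (y : prodc El Delta) :=
  pull (prodF u (idF Delta)) (yo ((el_closure T y.1, y.2) : prodc (OmegaC j) Delta)).
pose inner (Psi : mapping (subp nerve_sub) F n) (y : prodc El Delta) (w : hocolim n y)
    (c : prodc (OmegaC k) Delta) (gb : yoX y c) : F c :=
  Psi c (zof c y.1 y.2 w.1 gb.1 gb.2, @ccomp Delta _ _ _ w.2 gb.2).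
have innerN Psi y w (c d : prodc (OmegaC k) Delta) (f : hom c d) gb :
    inner Psi y w c (res (yoX y) f gb) =
    res F f (inner Psi y w d gb).
  rewrite /inner -app_nat; congr (Psi c (_, _)); last exact: Delta_eq.
  apply: nerve_sub_eq => [|i]; last by rewrite zofs /= zofs.
  by rewrite zofE /= zofE; apply: omega_eq.
pose outer Psi y w : spull (el_closure T) G y := Pmap (innerN Psi y w).
have outerN Psi (y y' : prodc El Delta) (f : hom y y') w :
    outer Psi y (res (hocolim n) f w) = res (spull (el_closure T) G) f (outer Psi y' w).
  apply: pmap_eq => c gb.
  change (inner Psi y (res (hocolim n) f w) c gb =
    inner Psi y' w c (@ccomp (prodc (OmegaC j) Delta) _ _ _
      (fhom (prodF (el_closure T) (idF Delta)) f) gb)).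
  rewrite /inner; congr (Psi c (_, _)); last exact: Delta_eq.
  apply: nerve_sub_eq => [|i]; last by etransitivity; [exact: zofs | exact/esym/zofs].
  etransitivity; first exact: zofE.
  etransitivity; last exact/esym/zofE.
  by rewrite -(el_cone_nat (T:=T) f.1); exact: omega_eq.
exists (fun Psi => Pmap (outerN Psi)) => [Phi|Psi].
  apply: pmap_eq => -[X p] [s a]; apply: pmap_eq => c [g b].
  rewrite [LHS]/= /inner [LHS]/=; symmetry; apply: holim_funE => // i; exact: zofs.
apply: pmap_eq => c [z a].
change (inner Psi ((sval z).2 ord0, c.2) (data_chain z, a) c
  (data_map z, idm (c.2 : Delta)) = Psi c (z, a)).
rewrite /inner; congr (Psi c (_, _)); last exact: Delta_eq.
apply: nerve_sub_eq => [|i].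
  by etransitivity; [exact: zofE | exact: data_mapE].
by etransitivity; [exact: zofs | exact: data_chainE].
Qed.

Program Definition ran_edges : pmap (at_ T G) (mapping (subp edges) F) :=
  {| app := fun n (phi : at_ T G n) =>
       {| app := fun c x => (phi : pmap _ _) c (sval x.1 : @hom (OmegaC j) (u c.1) T, x.2) |} |}.
Next Obligation. by move=> n phi c d f x; rewrite -(app_nat (phi : pmap _ _)). Qed.
Next Obligation.
move=> m n a phi; apply: pmap_eq => c x /=; congr ((phi : pmap _ _) c (_, _)).
exact: omega_eq.
Qed.

Lemma ran_edges_bij n : bijective (ran_edges n).
Proof.
have all c (f : rep k T' c) : edges c f.
  by apply/coveredP; exists setT; rewrite ?set11 ?subsetT.
have N (psi : mapping (subp edges) F n) (c d : prodc (OmegaC k) Delta) (f : hom c d)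
    (x : pull (prodF u (idF Delta)) (yo ((T, n) : prodc (OmegaC j) Delta)) d) :
  let x' := res (pull (prodF u (idF Delta)) (yo ((T, n) : prodc (OmegaC j) Delta))) f x in
  psi c (exist _ x'.1 (all c x'.1), x'.2) = res F f (psi d (exist _ x.1 (all d x.1), x.2)).
  by rewrite -app_nat; congr (psi c (_, _)); apply/eq_exist.
exists (fun psi => Pmap (N psi) : at_ T G n) => [phi|psi]; apply: pmap_eq => c [x a] //=.
by congr (psi c (_, _)); case: x => x xP; apply/eq_exist.
Qed.

Lemma cone_map_square :
  pcomp holim_map (cone_map G (@el_cone_nat j T)) =
  pcomp (pcomp (mapping_map F (subval nerve_sub)) (pcomp
    (mapping_map F (codiscrete_proj El (subp core))) (mapping_map F (sub_incl core_le))))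
    ran_edges.
Proof.
apply: pmap_eq => n phi; apply: pmap_eq => c [z a].
change ((phi : pmap _ _) c (@ccomp (OmegaC j) _ _ _ (el_cone (T:=T) ((sval z).2 ord0))
    (data_map z), @ccomp Delta _ _ _ a (idm (c.2 : Delta))) =
  (phi : pmap _ _) c (sval (sval z).1 : @hom (OmegaC j) (u c.1) T, a)).
congr ((phi : pmap _ _) c (_, _)); last exact: Delta_eq.
exact: data_mapE.
Qed.

(** In [cone_map_square], [ran_edges] and [holim_map] are isomorphisms, and restriction along
    [codiscrete_proj] and to [nerve_sub] are weak equivalences. What remains is restriction from
    [edges] to [core]. *)
Theorem segal_RKan_local :
  weq (cone_map G (@el_cone_nat j T)) <-> local F core edges.
Proof.
(* A base point for the contraction of the codiscrete simplicial set on [El]. *)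
have [r _] := tree_rooted T'; pose nondeg : El := el_point cT r.
have pW : weq (mapping_map F (codiscrete_proj El (subp core))).
  exact: (weq_codiscrete_proj nondeg).
rewrite (weq_square (weq_bij ran_edges_bij) (weq_bij holim_map_bij) (esym cone_map_square)).
split=> [W|[CE W]].
  exists core_le; apply: (weq_cancel_r pW); apply: (weq_cancel_r weq_nerve_sub); exact: W.
apply: weq_comp weq_nerve_sub; apply: weq_comp pW.
by rewrite (Prop_irrelevance core_le CE).
Qed.

End Conversion.

Section Isomorphisms.
Variables (C : category) (F G : spsh C) (eta : pmap F G).
Hypothesis eta_bij : forall c, bijective (eta c).

Program Definition mapping_post (A : spsh C) : pmap (mapping A F) (mapping A G) :=
  {| app := fun n phi => pcomp eta phi |}.
Next Obligation. by move=> A m n a phi; apply: pmap_eq. Qed.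

Lemma mapping_post_bij A n : bijective (mapping_post A n).
Proof.
have [g [fg gf]] := pmap_inverse eta_bij.
by exists (fun phi => pcomp g phi) => phi; apply: pmap_eq => c x /=; [exact: fg | exact: gf].
Qed.
End Isomorphisms.

Lemma weq_cone_map_iso (C D : category) (u : functor D C) (c : C) (F G : spsh C)
    (eta : pmap F G) (tau : forall d : D, hom (u d) c)
    (tau_nat : forall (d e : D) (h : hom d e), ccomp (tau e) (fhom u h) = tau d) :
  (forall x, bijective (eta x)) -> weq (cone_map F tau_nat) -> weq (cone_map G tau_nat).
Proof.
move=> eta_bij; apply: (weq_square (a := at_map c eta)
  (b := mapping_post (pull_map (prodF u (idF Delta)) eta) (coslice_nerve D)) _ _ _).1.
- by apply: weq_bij => m; apply: eta_bij.
- apply: weq_bij => m; apply: mapping_post_bij => x; exact: eta_bij.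
- apply: pmap_eq => n x; apply: pmap_eq => y s /=.
  by rewrite app_nat.
Qed.

Lemma le_oo_refl k : le_oo k k.
Proof. by case: k => [k|]; rewrite /le_oo. Qed.

Section RestrictedYoneda.
Variables (C D : category) (u : functor C D) (F : psh C).

(* d0 stands for d seen in C: u is fully faithful at d. *)
Record lift_of (d : D) (d0 : C) := LiftOf {
  lift_hom : forall c, hom (u c) d -> hom c d0;
  unlift_hom : forall c, hom c d0 -> hom (u c) d;
  lift_homK : forall c, cancel (@lift_hom c) (@unlift_hom c);
  unlift_homK : forall c, cancel (@unlift_hom c) (@lift_hom c);
  lift_hom_nat : forall c c' (g : hom (u c) d) (f : hom c' c),
    lift_hom (ccomp g (fhom u f)) = ccomp (lift_hom g) f }.

Program Definition ran_unit d d0 (L : lift_of d d0) (x : F d0) : ran u F d :=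
  {| app := fun c (g : pull u (yo d) c) => res F (lift_hom L g) x |}.
Next Obligation. by move=> d d0 L x c c' f g; rewrite -res_comp -lift_hom_nat. Qed.

Lemma ran_unit_nat d d0 (L : lift_of d d0) e e0 (M : lift_of e e0)
    (f : hom d e) (f0 : hom d0 e0) x :
  (forall c (g : hom (u c) d), lift_hom M (ccomp f g) = ccomp f0 (lift_hom L g)) ->
  ran_unit L (res F f0 x) = res (ran u F) f (ran_unit M x).
Proof. by move=> fP; apply: pmap_eq => c g /=; rewrite fP res_comp. Qed.

Lemma ran_unit_bij d d0 (L : lift_of d d0) : bijective (ran_unit L).
Proof.
exists (fun phi : ran u F d => phi d0 (unlift_hom L (idm d0))) => [x|phi].
  by rewrite /= unlift_homK res_id.
apply: pmap_eq => c g; rewrite [LHS]/= -(app_nat phi); congr (phi c _).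
apply: (can_inj (lift_homK L (c:=c))).
by rewrite /= lift_hom_nat unlift_homK comp1m.
Qed.

End RestrictedYoneda.

Section SegalSelf.
Variables (k : option nat) (F0 : spaces_psh (OmegaC k)).
Let F : spsh (OmegaC k) := F0.
Let u := prodF (incl_OmegaC (le_oo_refl k)) (idF Delta).

Definition self_lift (d : prodc (OmegaC k) Delta) : lift_of u d d.
Proof.
by apply: (@LiftOf _ _ u d d (fun c (g : hom (u c) d) => g : hom c d)
  (fun c (g : hom c d) => g : hom (u c) d)).
Defined.

(** The criterion for right Kan extensions is applied with [j = k]: by Yoneda the extension is then
    isomorphic to [F] itself. *)
Lemma segal_local (S : OmegaC k) : segal F ->
  local F (fam k (stars [set: sval S])) (fam k [set [set: sval S]]).
Proof.
move=> Fseg; apply/(segal_RKan_local (le_oo_refl k) F0 S).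
have etaN (c d : prodc (OmegaC k) Delta) (f : hom c d) (x : F d) :
  ran_unit (self_lift c) (res F f x) = res (ran u F) f (ran_unit (self_lift d) x).
  exact: ran_unit_nat.
apply: (weq_cone_map_iso (eta := Pmap etaN) _ (Fseg S)).
by move=> x; apply: ran_unit_bij.
Qed.

End SegalSelf.

Lemma local_transport (C : category) (F B B' : spsh C) (i : pmap B B')
    (X Y : sub B) (X' Y' : sub B') :
  (forall c, injective (i c)) -> (forall c x, X' c (i c x) <-> X c x) ->
  (forall c x, Y' c (i c x) <-> Y c x) -> sub_le X' Y' ->
  (forall c y, Y' c y -> exists x, i c x = y) -> local F X Y -> local F X' Y'.
Proof.
move=> i_inj iX iY XY' isurj [XY W]; exists XY'.
have lift (Z : sub B) (Z' : sub B') : (forall c x, Z' c (i c x) <-> Z c x) -> sub_le Z' Y' ->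
  exists iZ : pmap (subp Z) (subp Z'), (forall c x, sval (iZ c x) = i c (sval x)) /\
    forall n, bijective (mapping_map F iZ n).
  move=> iZ ZY.
  pose iZf c (x : subp Z c) : subp Z' c := exist _ (i c (sval x)) ((iZ c _).2 (svalP x)).
  have iZN (c d : prodc C Delta) (f : hom c d) (x : subp Z d) :
      iZf c (res (subp Z) f x) = res (subp Z') f (iZf d x).
    by apply/eq_exist; rewrite /= app_nat.
  exists (Pmap iZN); split=> // n.
  have [|g [fg gf]] := pmap_inverse (f := Pmap iZN).
    move=> c; have ex (y : subp Z' c) : exists x : subp Z c, Pmap iZN c x = y.
      case: y => y yP; have [x xy] := isurj _ _ (ZY _ _ yP).
      have xP : Z c x by apply/iZ; rewrite xy.
      by exists (exist _ x xP); apply/eq_exist.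
    have iZf_inj : injective (iZf c) by move=> [x xP] [y yP] [/i_inj xy]; apply/eq_exist.
    exists (fun y => projT1 (cid (ex y))) => [x|y]; last exact: (projT2 (cid (ex y))).
    by apply: iZf_inj; exact: (projT2 (cid (ex (iZf c x)))).
  exists (mapping_map F g n) => phi; apply: pmap_eq => c [x t] /=.
    by congr (phi c (_, _)); apply: gf.
  by congr (phi c (_, _)); apply: fg.
have [iX' [iX'E iX'B]] := lift X X' iX XY'.
have [iY' [iY'E iY'B]] := lift Y Y' iY (fun _ _ => id).
apply/(weq_square (weq_bij iY'B) (weq_bij iX'B) _); last exact: W.
apply: pmap_eq => n phi; apply: pmap_eq => c [x t] /=; congr (phi c (_, _)).
by apply: (@subval_inj _ _ Y' c); rewrite /= iX'E iY'E.
Qed.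

(** * Admissible subsets as trees *)

Record subedge (T : tree) (A : {set T}) :=
  SubEdge { subedge_val : T; subedge_in : subedge_val \in A }.
HB.instance Definition _ T A := [isSub for @subedge_val T A].
HB.instance Definition _ T A := [Finite of @subedge T A by <:].
HB.instance Definition _ T A := [SubChoice_isSubPOrder of @subedge T A by <: with tree_disp T].

Section Subtrees.
Variables (k : option nat) (T : tree) (A : {set T}).
Hypothesis cT : is_closed T.

Hypothesis Aadm : admissible k A.

Definition subtree_rooted : exists r : subedge A, forall x : subedge A, r <= x.
Proof.
have [[r rA rP] _] := Aadm; exists (SubEdge rA) => -[x xA].
by rewrite leEsub /=; apply: rP.
Qed.

Lemma subtree_linear (x y z : subedge A) : y <= x -> z <= x -> y >=< z.
Proof. by rewrite /Order.comparable !leEsub; apply: tree_linear. Qed.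

Lemma subtree_leaf (l x : subedge A) : l \in [set y : subedge A | false] -> l <= x -> x = l.
Proof. by rewrite inE. Qed.

Definition subtree : tree := Tree subtree_rooted subtree_linear subtree_leaf.

Lemma subtree_closed : is_closed subtree.
Proof. by apply/setP => x; rewrite !inE. Qed.

Lemma mem_covers_subtree (a c : subtree) :
  (subedge_val c \in covers A (subedge_val a)) = (c \in covers [set: subtree] a).
Proof.
apply/coversP/coversP => -[_ ac cmin]; split=> //; rewrite ?subedge_in //.
- by move=> y _ ay yc; apply: val_inj; apply: cmin; rewrite ?subedge_in.
- by move=> y yA ay yc; exact: (congr1 val (cmin (SubEdge yA) (in_setT _) ay yc)).
Qed.

Lemma subtree_star (a c : subtree) :
  (subedge_val c \in star_of A (subedge_val a)) = (c \in star_of [set: subtree] a).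
Proof. by rewrite !in_setU1 mem_covers_subtree; congr orb; exact: (inj_eq val_inj). Qed.

Lemma subtree_dendroidal : closed_dendroidal k subtree.
Proof.
split=> [|a]; first exact: subtree_closed.
apply: le_oo_nat (Aadm.2 _ (subedge_in a)).
rewrite -covers_setT -(card_imset _ (val_inj : injective (@subedge_val T A))).
apply/subset_leq_card/subsetP => _ /imsetP[c ca ->].
by rewrite mem_covers_subtree.
Qed.

Definition subtree_object : OmegaC k := exist _ subtree subtree_dendroidal.

Lemma subtree_order : @order_map subtree T (@subedge_val T A).
Proof. by split=> // x y xy; apply/orP; left. Qed.

Definition subtree_map : @hom Omega subtree T := order_hom cT subtree_order.

Program Definition rep_subtree : pmap (rep k subtree) (rep k T) :=
  {| app := fun c f => @ccomp Omega _ _ _ subtree_map f |}.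
Next Obligation. by move=> c d f g; apply: omega_eq. Qed.

(** Maps from a closed tree to the subtree on [A] are the maps to [T] with image in [A]. So the
    Segal condition of [F] at this k-dendroidal tree becomes a statement about subsets of [T]. *)
Lemma local_subtree (F : spsh (OmegaC k)) :
  local F (fam k (stars [set: subtree])) (fam k [set [set: subtree]]) ->
  local F (fam k (stars A)) (fam k [set A]).
Proof.
apply: (local_transport (i := rep_subtree)).
- move=> c f g fg; apply: omega_eq => s; apply: val_inj.
  exact: (congr1 (fun h : @hom Omega _ _ => sval h s) fg).
- move=> c f; split=> /covered_stars[a aA fa]; apply/covered_stars.
    exists (SubEdge aA : subtree) => //; apply/subsetP => _ /imsetP[s _ ->].
    by rewrite -subtree_star; apply: (subsetP fa); apply: imset_f.
  exists (subedge_val a); first exact: subedge_in.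
  apply/subsetP => _ /imsetP[s _ ->]; rewrite /= subtree_star.
  by apply: (subsetP fa); apply: imset_f.
- move=> c f /=; rewrite !covered1 subsetT; split=> // _.
  by apply/subsetP => _ /imsetP[s _ ->]; apply: subedge_in.
- apply: fam_le => Y /covered_stars[a aA Ya]; rewrite covered1.
  exact: subset_trans Ya (star_sub aA).
- move=> c f /=; rewrite covered1 => fA.
  have inA s : sval f s \in A by apply: (subsetP fA); apply: imset_f.
  have gord : @order_map (sval c.1) subtree (fun s => SubEdge (inA s)).
    by have [fmono fcomp] := hom_order_map f (svalP c.1).1; split.
  by exists (order_hom subtree_closed gord); apply: omega_eq.
Qed.

End Subtrees.

Theorem RKan_segal (k j : option nat) (kj : le_oo k j) (F : spaces_psh (OmegaC k)) :
  segal F -> segal (RKan (incl_OmegaC kj) F).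
Proof.
move=> Fseg T; have cT := (svalP T).1.
apply/segal_RKan_local; apply: local_stars => [|A Aadm|].
- exact: psh_of_fibrant.
- apply: (local_subtree cT (Aadm := Aadm)).
  exact: (@segal_local k F (subtree_object Aadm)).
- by have [r rP] := tree_rooted (sval T); exists r.
Qed.

(** * Completeness *)

Section RezkFunctoriality.
Variables (W W' : spsh Delta) (eta : pmap W W').

Lemma op_nat (m n p : nat) (a : @hom Delta m n) (x : W (n, p)) :
  eta (m, p) (op a x) = op a (eta (n, p) x).
Proof. exact: app_nat. Qed.

Lemma vertex_nat (n p : nat) (i : 'I_p.+1) (x : W (n, p)) :
  eta (n, 0) (vertex i x) = vertex i (eta (n, p) x).
Proof. exact: app_nat. Qed.

Lemma map_homotopic_nat (f g : W (1, 0)) :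
  map_homotopic f g -> map_homotopic (eta (1, 0) f) (eta (1, 0) g).
Proof.
move=> [p [p0 p1 ps pt]]; exists (eta (1, 1) p); split.
- by rewrite -vertex_nat p0.
- by rewrite -vertex_nat p1.
- by rewrite /src -!op_nat -[op _ p]/(src p) ps app_nat.
- by rewrite /tgt -!op_nat -[op _ p]/(tgt p) pt app_nat.
Qed.

Lemma homotopy_equivalence_nat (g : W (1, 0)) :
  homotopy_equivalence g -> homotopy_equivalence (eta (1, 0) g).
Proof.
move=> [[a [ag ah]] [b [bg bh]]]; split; [exists (eta (2, 0) a)|exists (eta (2, 0) b)].
  split; first by rewrite -op_nat ag.
  by have := map_homotopic_nat ah; rewrite op_nat /degen op_nat /src op_nat.
split; first by rewrite -op_nat bg.
by have := map_homotopic_nat bh; rewrite op_nat /degen op_nat /tgt op_nat.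
Qed.

Program Definition spine_space_map (n : nat) : pmap (spine_space W n) (spine_space W' n) :=
  {| app := fun p x => exist _ (fun i => eta (1, p) (sval x i)) _ |}.
Next Obligation.
by move=> n p [x xP] i j ij; rewrite /tgt /src -!op_nat; congr (eta _ _); apply: xP.
Qed.
Next Obligation. by move=> n p q a x; apply/eq_exist/funext => i /=; rewrite app_nat. Qed.

Program Definition hoequiv_space_map : pmap (hoequiv_space W) (hoequiv_space W') :=
  {| app := fun p x => exist _ (eta (1, p) (sval x)) _ |}.
Next Obligation. by move=> p [x xP] i; rewrite -vertex_nat; apply/homotopy_equivalence_nat/xP. Qed.
Next Obligation. by move=> p q a x; apply/eq_exist; rewrite /= app_nat. Qed.

End RezkFunctoriality.

Lemma complete_segal_space_iso (W W' : spsh Delta) (eta : pmap W W') :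
  (forall c, bijective (eta c)) -> complete_segal_space W -> complete_segal_space W'.
Proof.
move=> eta_bij; have [theta [etaK thetaK]] := pmap_inverse eta_bij.
have at_bij n m : bijective (at_map n eta m) by exact: eta_bij.
move=> [[Wfib Wseg] Wcpl]; split; first split.
- move=> A B i i_inj iW f; have [g gP] := Wfib A B i i_inj iW (pcomp theta f).
  exists (pcomp eta g); rewrite -pcompA gP pcompA.
  by apply: pmap_eq => c x; exact: thetaK.
- move=> n n2; apply: (weq_square (a := at_map (n : Delta) eta)
    (b := spine_space_map eta n) _ _ _).1 (Wseg n n2).
  + exact: weq_bij.
  + apply: weq_bij => m; exists (spine_space_map theta n m) => -[x xP]; apply/eq_exist/funext => i.
      exact: etaK.
    exact: thetaK.
  + by apply: pmap_eq => m x; apply/eq_exist/funext => i; rewrite /= -op_nat.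
- apply: (weq_square (a := at_map (0 : Delta) eta) (b := hoequiv_space_map eta) _ _ _).1 Wcpl.
  + exact: weq_bij.
  + apply: weq_bij => m; exists (hoequiv_space_map theta m) => -[x xP]; apply/eq_exist.
      exact: etaK.
    exact: thetaK.
  + by apply: pmap_eq => m x; apply/eq_exist; rewrite /= /degen -op_nat.
Qed.

Section LinearTrees.
Variables (k j : option nat) (k1 : le_oo (Some 1) k) (j1 : le_oo (Some 1) j) (kj : le_oo k j)
  (F0 : spaces_psh (OmegaC k)).
Let F : spsh (OmegaC k) := F0.
Let u := prodF (incl_OmegaC kj) (idF Delta).

(** Linear trees belong to the smaller category and the inclusion is full, so the maps to them from
    its objects are the same in both categories. Yoneda then evaluates the Kan extension there. *)
Definition linear_lift (d : prodc Delta Delta) :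
  lift_of u ((lin j1 d.1, d.2) : prodc (OmegaC j) Delta)
    ((lin k1 d.1, d.2) : prodc (OmegaC k) Delta).
Proof.
by apply: (@LiftOf _ _ u (lin j1 d.1, d.2) (lin k1 d.1, d.2)
  (fun c (g : hom (u c) _) => g : hom c ((lin k1 d.1, d.2) : prodc (OmegaC k) Delta))
  (fun c (g : hom c _) => g : hom (u c) ((lin j1 d.1, d.2) : prodc (OmegaC j) Delta))).
Defined.

Lemma lin_unit_nat (c d : prodc Delta Delta) (f : hom c d) (x : spull (lin k1) F d) :
  (ran_unit (linear_lift c) (res (spull (lin k1) F) f x) : spull (lin j1) (ran u F) c) =
  res (spull (lin j1) (ran u F)) f (ran_unit (linear_lift d) x).
Proof. exact: ran_unit_nat. Qed.

Lemma complete_segal_space_RKan :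
  complete_segal_space (spull (lin k1) F) ->
  complete_segal_space (spull (lin j1) (RKan (incl_OmegaC kj) F0)).
Proof.
apply: (complete_segal_space_iso (eta := Pmap lin_unit_nat)) => d.
exact: ran_unit_bij.
Qed.

End LinearTrees.

Theorem proposition5p14 (k j : option nat) (k1 : le_oo (Some 1) k) (kj : le_oo k j)
    (F : spaces_psh (OmegaC k)) :
  complete_segal k1 F ->
  complete_segal (le_oo_trans k1 kj) (RKan (incl_OmegaC kj) F).
Proof.
by move=> [Fseg Fcpl]; split; [exact: RKan_segal | exact: complete_segal_space_RKan].
Qed.
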